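(* Let $V$ be a vertex algebra and $g$ an automorphism of $V$ of finite order $T$. There exists a bijection between the (isomorphism classes of) simple $\tilde A_g(V)$-modules and the (isomorphism classes of) irreducible $(1/T)\mathbb N$-graded $g$-twisted $\phi$-coordinated $V$-modules.
   Context: $V$ is a vertex algebra with vacuum $\mathbf 1$, $Y(v,x)=\sum_kv_kx^{-k-1}$, $\mathcal Dv=v_{-2}\mathbf 1$; $g$ an automorphism with $g^T=1$; $V^r=\{v: gv=e^{-2\pi\sqrt{-1}r/T}v\}$, $r\in\{0,\dots,T-1\}$. $\tilde A_g(V)=V/\tilde O_g(V)$: for $u\in V^r$, $u\diamond_gv=\operatorname{Res}_y\frac{(1+y)^{-1+\delta_0(r)+r/T}}{y^{\delta_0(r)+\delta_0(T-r)+1}}Y(u,\log(1+y))v$ with $\delta_0(0)=1$, $\delta_0(l)=0$ for $1\le l\le T$ ($(1+y)^\alpha$ expanded in powers of $y$, $x=\log(1+y)$ substituted into $Y(u,x)v$); $\tilde O_g(V)=\mathrm{span}\{u\diamond_gv:u,v\in V\}+\mathcal DV$; the associative product on $\tilde A_g(V)$ is induced by $u\bullet_gv=\operatorname{Res}_y y^{-1}Y(u,\log(1+y))v$ for $u\in V^0$ and $u\bullet_gv=0$ for $u\in V^r$, $r\ne0$. A $g$-twisted $\phi$-coordinated $V$-module is a vector space $W$ with a linear map $Y_W(\cdot,x):V\to\mathrm{Hom}(W,W((x^{1/T})))$, $Y_W(v,x)=\sum_{n\in(1/T)\mathbb Z}v_nx^{-n-1}$, with (i) $Y_W(\mathbf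 1,x)=\mathrm{id}_W$; (ii) $Y_W(gv,x)=\lim_{x^{1/T}\to\omega_T^{-1}x^{1/T}}Y_W(v,x)$, $\omega_T=e^{-2\pi\sqrt{-1}/T}$; (iii) for $u,v$ there is $k\in\mathbb N$ with $(x_1-x_2)^kY_W(u,x_1)Y_W(v,x_2)\in\mathrm{Hom}(W,W((x_1^{1/T},x_2^{1/T})))$ and $x_2^k(e^{x_0}-1)^kY_W(Y(u,x_0)v,x_2)=\big((x_1-x_2)^kY_W(u,x_1)Y_W(v,x_2)\big)|_{x_1^{1/T}=(x_2e^{x_0})^{1/T}}$. It is $(1/T)\mathbb N$-graded if $W=\bigoplus_{n\in(1/T)\mathbb N}W(n)$ with $v_mW(n)\subseteq W(n-m-1)$; nonzero graded modules are assumed to have $W(0)\ne0$. Irreducible: nonzero with no submodules other than $0$ and itself. *)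

(* Defs.v *)
From HB Require Import structures.
From mathcomp Require Import all_boot all_algebra.
From mathcomp Require Import reals trigo complex.
From Stdlib Require Import ClassicalEpsilon.

Set Implicit Arguments.
Unset Strict Implicit.
Unset Printing Implicit Defensive.

Import GRing.Theory Num.Theory.
Local Open Scope ring_scope.

(* Sum over Z of a finitely supported family (only used on families that
   are finitely supported; the support bound is chosen classically and the
   value does not depend on the choice). *)
Definition zsum (M : zmodType) (f : int -> M) : M :=
  let N := epsilon (inhabits 0%N)
             (fun N : nat => forall i : int, (N <= absz i)%N -> f i = 0) in
  \sum_(k < N.*2.+1) f (k%:Z - N%:Z).

Definition gbinom (F : fieldType) (b : F) (j : nat) : F :=
  (\prod_(l < j) (b - l%:R)) / (j`!)%:R.

Definition is_linear (K : fieldType) (U W : lmodType K) (f : U -> W) : Prop :=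
  forall (a : K) (x y : U), f (a *: x + y) = a *: f x + f y.

Definition is_subspace (K : fieldType) (U : lmodType K) (S : U -> Prop) : Prop :=
  S 0 /\ forall (a : K) (x y : U), S x -> S y -> S (a *: x + y).

(* Vertex algebras  (Y(u,x)v = sum_k u_k v x^{-k-1},  vmode u k v = u_k v) *)

Record vertex_algebra (K : fieldType) (V : lmodType K) := VertexAlgebra {
  vmode : V -> int -> V -> V;
  vac : V;
  vmode_linl : forall k v, is_linear (fun u => vmode u k v);
  vmode_linr : forall u k, is_linear (vmode u k);
  vmode_trunc : forall u v, exists N : int, forall k, N <= k -> vmode u k v = 0;
  vac_mode : forall k v, vmode vac k v = if k == - 1 then v else 0;
  creation_m1 : forall v, vmode v (- 1) vac = v;
  creation_pos : forall v k, 0 <= k -> vmode v k vac = 0;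
  borcherds : forall (u v w : V) (m n l : int),
    zsum (fun i : int => if 0 <= i then
            gbinom (m%:~R : K) (absz i) *: vmode (vmode u (l + i) v) (m + n - i) w
          else 0)
    = zsum (fun i : int => if 0 <= i then
            ((-1) ^+ (absz i) * gbinom (l%:~R : K) (absz i)) *:
              (vmode u (m + l - i) (vmode v (n + i) w)
               - (-1) ^+ (absz l) *: vmode v (n + l - i) (vmode u (m + i) w))
          else 0)
}.

Arguments vmode {K V} _ _ _ _.
Arguments vac {K V} _.

Definition vaD (K : fieldType) (V : lmodType K) (A : vertex_algebra V) (v : V) : V :=
  vmode A v (- 2) (vac A).

Definition is_va_automorphism (K : fieldType) (V : lmodType K)
    (A : vertex_algebra V) (g : V -> V) : Prop :=
  is_linear g /\ bijective g /\ g (vac A) = vac A /\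
  forall u k v, g (vmode A u k v) = vmode A (g u) k (g v).

Section Series.
Variable K : fieldType.

Definition psmul (a b : nat -> K) : nat -> K :=
  fun n => \sum_(i < n.+1) a i * b (n - i)%N.
Definition ps1 : nat -> K := fun n => (n == 0%N)%:R.
Definition psexp (h : nat -> K) (j : nat) : nat -> K := iter j (psmul h) ps1.
(* (1 + h)^beta, for h without constant term *)
Definition pspow (h : nat -> K) (beta : K) : nat -> K :=
  fun n => \sum_(j < n.+1) gbinom beta j * psexp h j n.
Definition psy : nat -> K := fun n => (n == 1%N)%:R.
(* log(1+y)/y - 1 *)
Definition pslogm1 : nat -> K :=
  fun n => if n == 0%N then 0 else (-1) ^+ n / (n.+1)%:R.

(* coefficient of y^{-1} in (1+y)^alpha y^{-p} (log(1+y))^{-k-1}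
   = coefficient of y^{p+k} in (1+y)^alpha (log(1+y)/y)^{-k-1} *)
Definition rescoef (alpha : K) (p : nat) (k : int) : K :=
  if 0 <= p%:Z + k then
    psmul (pspow psy alpha) (pspow pslogm1 (- (k + 1)%:~R)) (absz (p%:Z + k))
  else 0.
End Series.

Section Twisted.
Variable R : realType.
Local Notation C := (complex R).
Variable V : lmodType C.
Variable A : vertex_algebra V.
Variable g : V -> V.
Variable T : nat.

Definition omegaT : C :=
  Complex (cos (2%:R * pi / T%:R)) (- sin (2%:R * pi / T%:R)).

(* projection of u onto V^r = {v | g v = omega_T^r v} *)
Definition gproj (r : nat) (u : V) : V :=
  (T%:R)^-1 *: \sum_(j < T) ((omegaT ^-1) ^+ (r * j)) *: iter j g u.

(* Res_y (1+y)^alpha y^{-p} Y(u, log(1+y)) v *)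
Definition resprod (alpha : C) (p : nat) (u v : V) : V :=
  zsum (fun k : int => rescoef alpha p k *: vmode A u k v).

Definition delta0 (l : nat) : nat := (l == 0%N).

(* u <>_g v, extended linearly from u in V^r (r = 0..T-1) *)
Definition diamond_g (u v : V) : V :=
  \sum_(r < T)
     resprod (-1 + (delta0 r)%:R + (r%:R / T%:R))
             (delta0 r + delta0 (T - r) + 1) (gproj r u) v.

(* u ._g v  (zero on V^r for r <> 0) *)
Definition bullet_g (u v : V) : V := resprod 0 1 (gproj 0 u) v.

Definition in_Og (x : V) : Prop :=
  exists (s : seq (C * V * V)) (w : V),
    x = \sum_(t <- s) t.1.1 *: diamond_g t.1.2 t.2 + vaD A w.

(* A~_g(V)-modules, presented as V-actions factoring through the quotient
   V / O~_g(V) and multiplicative for the induced product (unital). *)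
Record AgModule := AgMod {
  am_car : lmodType C;
  am_act : V -> am_car -> am_car;
  am_linl : forall m, is_linear (fun a => am_act a m);
  am_linr : forall a, is_linear (am_act a);
  am_O : forall a, in_Og a -> forall m, am_act a m = 0;
  am_mul : forall a b m, am_act (bullet_g a b) m = am_act a (am_act b m);
  am_unit : forall m, am_act (vac A) m = m
}.
Arguments am_act : clear implicits.

Definition am_simple (M : AgModule) : Prop :=
  (exists m : am_car M, m <> 0) /\
  forall S : am_car M -> Prop, is_subspace S ->
    (forall a m, S m -> S (am_act M a m)) ->
    (forall m, S m -> m = 0) \/ (forall m, S m).

Definition am_iso (M1 M2 : AgModule) : Prop :=
  exists f : am_car M1 -> am_car M2,
    is_linear f /\ bijective f /\ forall a m, f (am_act M1 a m) = am_act M2 a (f m).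

(* g-twisted phi-coordinated modules: tw_mode v j = v_{j/T} *)

(* coefficient of x1^{s/T} x2^{t/T} in (x1-x2)^k Y_W(u,x1) Y_W(v,x2) w *)
Definition twF (W : lmodType C) (Y : V -> int -> W -> W) (u v : V) (k : nat)
    (w : W) (s t : int) : W :=
  \sum_(i < k.+1)
    ('C(k, i)%:R * (-1) ^+ i) *:
      Y u (T%:Z * (k%:Z - i%:Z - 1) - s) (Y v (T%:Z * (i%:Z - 1) - t) w).

(* coefficient of x0^q in (e^{x0} - 1)^k *)
Definition expm1_coef (k : nat) (q : int) : C :=
  if q < 0 then 0 else
  (\sum_(i < k.+1) 'C(k, i)%:R * (-1) ^+ (k - i) * (i%:R) ^+ (absz q))
    / ((absz q)`!)%:R.

Record TwModule := TwMod {
  tw_car : lmodType C;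
  tw_mode : V -> int -> tw_car -> tw_car;
  tw_linl : forall j w, is_linear (fun v => tw_mode v j w);
  tw_linr : forall v j, is_linear (tw_mode v j);
  tw_trunc : forall v w, exists N : int, forall j, N <= j -> tw_mode v j w = 0;
  tw_vac : forall j w, tw_mode (vac A) j w = if j == - (T%:Z) then w else 0;
  (* (ii) Y_W(gv,x) = lim_{x^{1/T} -> omega_T^{-1} x^{1/T}} Y_W(v,x) *)
  tw_g : forall v j w, tw_mode (g v) j w = omegaT ^ j *: tw_mode v j w;
  tw_assoc : forall u v : V, exists k : nat, forall w : tw_car, exists N : int,
    (forall s t : int, (s < N) || (t < N) -> twF tw_mode u v k w s t = 0) /\
    (forall m j : int,
      (* coefficient of x2^{m/T} x0^j in x2^k (e^{x0}-1)^k Y_W(Y(u,x0)v, x2) w *)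
      zsum (fun l : int => expm1_coef k (j + l + 1) *:
                tw_mode (vmode A u l v) (T%:Z * (k%:Z - 1) - m) w)
      =
      (* coefficient of x2^{m/T} x0^j in the substitution
         x1^{1/T} = (x2 e^{x0})^{1/T} of (x1-x2)^k Y_W(u,x1) Y_W(v,x2) w *)
      (if j < 0 then 0 else
       zsum (fun s : int =>
         (((s%:~R / T%:R) ^+ (absz j)) / ((absz j)`!)%:R) *:
           twF tw_mode u v k w s (m - s))))
}.
Arguments tw_mode : clear implicits.

(* (1/T)N-graded with W(0) <> 0; grading piece Wn a = W(a/T) *)
Definition tw_graded (W : TwModule) : Prop :=
  exists Wn : nat -> tw_car W -> Prop,
    (forall a, is_subspace (Wn a)) /\
    (forall w, exists (n : nat) (ws : nat -> tw_car W),
        (forall a, Wn a (ws a)) /\ w = \sum_(a < n) ws a) /\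
    (forall (n : nat) (ws : nat -> tw_car W), (forall a, Wn a (ws a)) ->
        \sum_(a < n) ws a = 0 -> forall a, (a < n)%N -> ws a = 0) /\
    (forall (v : V) (j : int) (a : nat) (w : tw_car W), Wn a w ->
        if (0 <= a%:Z - j - T%:Z)%R then Wn (absz (a%:Z - j - T%:Z)%R) (tw_mode W v j w)
        else tw_mode W v j w = 0) /\
    (exists w, Wn 0%N w /\ w <> 0).

Definition tw_irreducible (W : TwModule) : Prop :=
  (exists w : tw_car W, w <> 0) /\
  forall S : tw_car W -> Prop, is_subspace S ->
    (forall v j w, S w -> S (tw_mode W v j w)) ->
    (forall w, S w -> w = 0) \/ (forall w, S w).

Definition tw_iso (W1 W2 : TwModule) : Prop :=
  exists f : tw_car W1 -> tw_car W2,
    is_linear f /\ bijective f /\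
    forall v j w, f (tw_mode W1 v j w) = tw_mode W2 v j (f w).

End Twisted.

(* Main.v *)
(* With z = e^x the modes of a twisted phi-coordinated module W satisfy, for
   every q > 0, the identity obtained by multiplying the Jacobi
   identity by (z_1 - z_2)^{-q}: the two expansions of
   (z_1 - z_2)^{-q} Y(b,z_1) Y(d,z_2) w differ by a residue in which only
   Y(b[h]d,z_2) w occurs.  This family is equivalent to the associativity
   axiom (q = 1 and the D-derivative property give all q).  It shows that
   products of two modes of W are single modes u_(s) with u independent of W,
   and that the vectors killed by all modes of negative weight form a module
   over the Zhu algebra; for irreducible graded W that module is the bottom
   component and determines W.

   For existence, a Zhu module M embeds in the coinduced space of linear maps
   f : V -> M such that f (b[h] u) = 0 for rational functions h of high order
   at z = 0 and z = oo, by m |-> (u |-> u m).  There the mode d_(s) sends f to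
   u |-> - f (d[z^{-s/T} chi] u), where the cutoff chi, a rational function with
   poles at z = 1 only, is close to 1 at 0 and to 0 at oo.  The submodule
   generated by M has W(0) = M and is irreducible when M is simple, because a
   homogeneous f of degree a is recovered from (u_(-a) f)(1) = f(u). *)

Require Import Defs.
From HB Require Import structures.
From mathcomp Require Import all_boot all_order all_algebra.
From mathcomp Require Import reals trigo complex.
From mathcomp Require Import boolp functions.
From mathcomp Require Import zify ring lra.
From Stdlib Require Import ClassicalEpsilon.
Set Implicit Arguments.
Unset Strict Implicit.
Unset Printing Implicit Defensive.
Import Order.TTheory GRing.Theory Num.Theory.
Local Open Scope ring_scope.

(** The algebra V supplies residues at z = 1 only, whereas the modes of a module live at z = 0.
    Regard f(Y(d,z)u) as a differential form with poles at 0, 1 and oo: multiplying by the cutoff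
    isolates the residue at 0, which by the residue theorem is minus the residue at 1. Hence the
    sign in the coinduced action. Functionals compose in reverse, so the product of two modes on f
    is computed from the opposite product in V, and skew-symmetry restores the order on M.
    Coinduction also avoids the difficulty of a quotient construction, where M might collapse: here
    m is recovered as the value of its functional at the vacuum. What must be proved is the identity
    for q = 1, which is the Jacobi identity of V divided by z_1 - z_2; the two quotients telescope
    to finite sums because functionals die on test functions vanishing at both ends. The passage
    between associativity and the identities for all q rests on the injectivity of multiplication by
    z_1 - z_2 on arrays bounded below in one variable: it determines each expansion of a quotient
    uniquely. *)

(** * Finitely supported sums over the integers *)

Section ZSum.
Variable M : zmodType.
Implicit Types f : int -> M.

Definition zfin f := exists N : nat, forall i : int, (N <= absz i)%N -> f i = 0.

Definition zrange (N : nat) : seq int := [seq k%:Z - N%:Z | k <- iota 0 N.*2.+1].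

Lemma zrange_uniq N : uniq (zrange N).
Proof. by rewrite map_inj_uniq ?iota_uniq // => i j; lia. Qed.

Lemma mem_zrange N i : (i \in zrange N) = (absz i <= N)%N.
Proof.
apply/mapP/idP => [[k]|h]; first by rewrite mem_iota; lia.
by exists (absz (i + N%:Z)); rewrite ?mem_iota; lia.
Qed.

Lemma sum_supp (I : eqType) (s s' : seq I) (f : I -> M) : uniq s -> uniq s' ->
  (forall i, f i != 0 -> i \in s) -> (forall i, f i != 0 -> i \in s') ->
  \sum_(i <- s) f i = \sum_(i <- s') f i.
Proof.
have A (t : seq I) : \sum_(i <- t) f i = \sum_(i <- [seq i <- t | f i != 0]) f i.
  rewrite big_filter [LHS](bigID (fun i => f i != 0)) /= [X in _ + X]big1 ?addr0 // => i.
  by rewrite negbK => /eqP.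
move=> us us' hs hs'; rewrite (A s) (A s'); apply: perm_big.
apply: uniq_perm; rewrite ?filter_uniq // => i; rewrite !mem_filter.
by case: (boolP (f i == 0)) => //= h; rewrite hs // hs'.
Qed.

(** The bound inside [zsum] is a classical choice. As soon as one admissible bound exists, [epsilon]
    returns an admissible one, and terms outside the support contribute nothing; this frees later
    computations from the choice. *)
Lemma zsum_seq f s : uniq s -> (forall i, f i != 0 -> i \in s) ->
  zsum f = \sum_(i <- s) f i.
Proof.
move=> us hs; rewrite /zsum; set N := epsilon _ _.
have hN : forall i : int, (N <= absz i)%N -> f i = 0.
  apply: (epsilon_spec (inhabits 0%N)
    (fun N : nat => forall i : int, (N <= absz i)%N -> f i = 0)).
  exists (\max_(i <- s) absz i).+1 => i hi; apply/eqP/contraT => /hs h.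
  suff : (absz i <= \max_(i <- s) absz i)%N by lia.
  by rewrite (big_rem _ h) /= leq_maxl.
rewrite -(sum_supp (zrange_uniq N) us) //.
  by rewrite /zrange big_map -[iota 0 _]/(index_iota 0 N.*2.+1) big_mkord.
by move=> i hi; rewrite mem_zrange; apply: contraR hi => hi; apply/eqP/hN; lia.
Qed.

Lemma zsumE f N : (forall i : int, (N < absz i)%N -> f i = 0) ->
  zsum f = \sum_(i <- zrange N) f i.
Proof.
move=> h; apply: zsum_seq (zrange_uniq N) _ => i hi.
by rewrite mem_zrange; apply: contraR hi => hi; apply/eqP/h; lia.
Qed.

Lemma eq_zsum f f' : f =1 f' -> zsum f = zsum f'.
Proof. by move=> /funext ->. Qed.

Lemma zsum0 f : (forall i, f i = 0) -> zsum f = 0.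
Proof. by move=> h; rewrite (@zsum_seq _ [::]) ?big_nil // => i; rewrite h eqxx. Qed.

Lemma zsum1 f j : (forall i, i != j -> f i = 0) -> zsum f = f j.
Proof.
move=> h; rewrite (@zsum_seq _ [:: j]) ?big_seq1 // => i.
by rewrite inE; apply: contraR => /h ->.
Qed.

Lemma zsum_shift f j : zfin f -> zsum f = zsum (fun i => f (i + j)).
Proof.
case=> N hN.
have hs i : f i != 0 -> i \in zrange N.
  by rewrite mem_zrange => hi; apply: contraR hi => hi; apply/eqP/hN; lia.
rewrite (zsum_seq (zrange_uniq N) hs).
rewrite (@zsum_seq _ [seq i - j | i <- zrange N]).
- by rewrite [RHS]big_map; apply: eq_bigr => i _; rewrite subrK.
- by rewrite map_inj_uniq ?zrange_uniq // => a b; lia.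
- by move=> i /hs h; apply/mapP; exists (i + j) => //; rewrite addrK.
Qed.

Lemma zsum_opp f : zfin f -> zsum f = zsum (fun i => f (- i)).
Proof.
case=> N hN.
have hs i : f i != 0 -> i \in zrange N.
  by rewrite mem_zrange => hi; apply: contraR hi => hi; apply/eqP/hN; lia.
rewrite (zsum_seq (zrange_uniq N) hs).
rewrite (@zsum_seq _ [seq - i | i <- zrange N]).
- by rewrite [RHS]big_map; apply: eq_bigr => i _; rewrite opprK.
- by rewrite map_inj_uniq ?zrange_uniq // => a b; lia.
- by move=> i /hs h; apply/mapP; exists (- i) => //; rewrite opprK.
Qed.

Lemma zfinD f f' : zfin f -> zfin f' -> zfin (fun i => f i + f' i).
Proof. by case=> N h [N' h']; exists (N + N')%N => i hi; rewrite h ?h' ?addr0 //; lia. Qed.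

Lemma zsumD f f' : zfin f -> zfin f' ->
  zsum (fun i => f i + f' i) = zsum f + zsum f'.
Proof.
case=> N h [N' h'].
rewrite !(@zsumE _ (N + N')%N); first by rewrite big_split.
- by move=> i hi; rewrite h' //; lia.
- by move=> i hi; rewrite h //; lia.
- by move=> i hi; rewrite h ?h' ?addr0 //; lia.
Qed.

Lemma exchange_zsum (f : int -> int -> M) :
  (exists N : nat, forall i j : int, (N <= absz i)%N || (N <= absz j)%N -> f i j = 0) ->
  zsum (fun i => zsum (f i)) = zsum (fun j => zsum (f^~ j)).
Proof.
case=> N h.
rewrite (@zsumE (fun i => zsum (f i)) N); last first.
  by move=> i hi; apply: zsum0 => j; apply: h; lia.
rewrite (@zsumE (fun j => zsum (f^~ j)) N); last first.
  by move=> i hi; apply: zsum0 => j; apply: h; lia.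
transitivity (\sum_(i <- zrange N) \sum_(j <- zrange N) f i j).
  by apply: eq_bigr => i _; apply: zsumE => j hj; apply: h; lia.
rewrite exchange_big; apply: eq_bigr => j _.
by rewrite (@zsumE _ N) // => i hi; apply: h; lia.
Qed.

End ZSum.

Lemma zsum_raddf (M M' : zmodType) (g : M -> M') (f : int -> M) :
  g 0 = 0 -> {morph g : x y / x + y} -> zfin f ->
  g (zsum f) = zsum (fun i => g (f i)).
Proof.
move=> g0 gD [N h]; rewrite (@zsumE _ f N); last by move=> i hi; rewrite h //; lia.
rewrite (@zsumE _ _ N); last by move=> i hi; rewrite h ?g0 //; lia.
exact: (big_morph g gD g0).
Qed.

Lemma zsum_sum (M : zmodType) (I : Type) (s : seq I) (f : I -> int -> M) :
  (forall a, zfin (f a)) ->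
  zsum (fun i => \sum_(a <- s) f a i) = \sum_(a <- s) zsum (f a).
Proof.
move=> h; suff [] : zsum (fun i => \sum_(a <- s) f a i) = \sum_(a <- s) zsum (f a) /\
  zfin (fun i => \sum_(a <- s) f a i) by [].
elim: s => [|a s [IH1 IH2]].
  by split; [rewrite zsum0 ?big_nil // => i; rewrite big_nil | exists 0%N => i _; rewrite big_nil].
split; last by under [X in zfin X]funext do rewrite big_cons; apply: zfinD.
by rewrite big_cons -IH1 -zsumD //; apply: eq_zsum => i; rewrite big_cons.
Qed.

(** * Laurent series *)
Section LaurentRing.
Variable K : fieldType.

Definition lbounded (f : int -> K) := exists N : int, forall i, i < N -> f i = 0.

Record laurent := Laurent { lco :> int -> K; lcoP : lbounded lco }.

Lemma laurentP (f g : laurent) : (forall i, f i = g i) -> f = g.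
Proof.
case: f g => [f hf] [g hg] /= /funext h; rewrite h in hf *.
by rewrite (Prop_irrelevance hf hg).
Qed.

HB.instance Definition _ := gen_eqMixin laurent.
HB.instance Definition _ := gen_choiceMixin laurent.

Lemma lzero_bd : lbounded (fun=> 0). Proof. by exists 0. Qed.
Lemma lopp_bd (f : laurent) : lbounded (fun i => - f i).
Proof. by case: (lcoP f) => N h; exists N => i /h ->; rewrite oppr0. Qed.
Lemma ladd_bd (f g : laurent) : lbounded (fun i => f i + g i).
Proof.
case: (lcoP f) (lcoP g) => N h [N' h']; exists (Num.min N N') => i hi.
by rewrite h ?h' ?addr0 //; lia.
Qed.

Definition lzero := Laurent lzero_bd.
Definition lopp f := Laurent (lopp_bd f).
Definition ladd f g := Laurent (ladd_bd f g).

Lemma laddA : associative ladd.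
Proof. by move=> f g h; apply: laurentP => i /=; rewrite addrA. Qed.
Lemma laddC : commutative ladd.
Proof. by move=> f g; apply: laurentP => i /=; rewrite addrC. Qed.
Lemma ladd0 : left_id lzero ladd.
Proof. by move=> f; apply: laurentP => i /=; rewrite add0r. Qed.
Lemma laddN : left_inverse lzero lopp ladd.
Proof. by move=> f; apply: laurentP => i /=; rewrite addNr. Qed.
HB.instance Definition _ := GRing.isZmodule.Build laurent laddA laddC ladd0 laddN.

Definition lord (N : int) (f : laurent) := forall i, i < N -> f i = 0.

Definition lmulf (f g : laurent) (n : int) : K := zsum (fun i => f i * g (n - i)).

Lemma lmul_fin (f g : laurent) n : zfin (fun i => f i * g (n - i)).
Proof.
case: (lcoP f) (lcoP g) => N h [N' h'].
exists (absz N + absz N' + absz n).+1 => i hi.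
have [lt|le] := ltP i N; first by rewrite h ?mul0r.
by rewrite h' ?mulr0 //; lia.
Qed.

Lemma lmulf_ord (f g : laurent) N N' : lord N f -> lord N' g ->
  forall n, n < N + N' -> lmulf f g n = 0.
Proof.
move=> h h' n hn; apply: zsum0 => i; have [lt|le] := ltP i N; first by rewrite h ?mul0r.
by rewrite h' ?mulr0 //; lia.
Qed.

Lemma lmul_bd (f g : laurent) : lbounded (lmulf f g).
Proof.
by case: (lcoP f) (lcoP g) => N h [N' h']; exists (N + N') => i; apply: lmulf_ord.
Qed.

Lemma lone_bd : lbounded (fun i => (i == 0)%:R).
Proof. by exists 0 => i hi; rewrite (_ : (i == 0) = false) //; lia. Qed.

Definition lmul f g := Laurent (lmul_bd f g).
Definition lone := Laurent lone_bd.

Lemma zsum_mull (c : K) f : zfin f -> c * zsum f = zsum (fun i => c * f i).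
Proof. by move=> h; apply: (zsum_raddf (g := fun x => c * x)) => //; rewrite ?mulr0 // => x y; rewrite mulrDr. Qed.
Lemma zsum_mulr (c : K) f : zfin f -> zsum f * c = zsum (fun i => f i * c).
Proof. by move=> h; apply: (zsum_raddf (g := fun x => x * c)) => //; rewrite ?mul0r // => x y; rewrite mulrDl. Qed.

Lemma lmulC : commutative lmul.
Proof.
move=> f g; apply: laurentP => n; rewrite /= /lmulf.
rewrite [LHS](zsum_shift n); last exact: lmul_fin.
rewrite [LHS]zsum_opp; last first.
  case: (lmul_fin f g n) => N h; exists (N + absz n)%N => i hi; apply: h; lia.
apply: eq_zsum => i; rewrite mulrC; congr (lco _ _ * lco _ _); lia.
Qed.

Lemma lmulA : associative lmul.
Proof.
move=> f g h; apply: laurentP => n; rewrite /= /lmulf.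
under eq_zsum do rewrite (zsum_mull _ (lmul_fin g h _)).
under [RHS]eq_zsum do rewrite (zsum_mulr _ (lmul_fin f g _)).
rewrite [RHS]exchange_zsum; last first.
  case: (lcoP f) (lcoP g) (lcoP h) => a ha [b hb] [c hc].
  exists (absz a + absz b + absz c + absz n)%N.+1 => i j hij.
  have [lt|lea] := ltP j a; first by rewrite ha ?mul0r.
  have [lt|leb] := ltP (i - j) b; first by rewrite (hb (i - j)) // mulr0 mul0r.
  have [lt|lec] := ltP (n - i) c; first by rewrite (hc (n - i)) // mulr0.
  lia.
apply: eq_zsum => i; rewrite [RHS](zsum_shift i); last first.
  have [N hN] := lmul_fin g h (n - i).
  exists (N + absz i)%N => j hj; rewrite -mulrA.
  have := hN (j - i); rewrite (_ : n - i - (j - i) = n - j); last by lia.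
  by move=> ->; rewrite ?mulr0 //; lia.
apply: eq_zsum => j; rewrite -mulrA; congr (_ * (lco _ _ * lco _ _)); lia.
Qed.

Lemma lmul1 : left_id lone lmul.
Proof.
move=> f; apply: laurentP => n /=; rewrite /lmulf (zsum1 (j := 0)) /=.
  by rewrite mul1r subr0.
by move=> i /negbTE ->; rewrite mul0r.
Qed.

Lemma lmulD : left_distributive lmul ladd.
Proof.
move=> f g h; apply: laurentP => n /=; rewrite /lmulf -zsumD; try exact: lmul_fin.
by apply: eq_zsum => i; rewrite mulrDl.
Qed.

Lemma lone_neq0 : lone != lzero.
Proof.
apply/eqP => /(congr1 (fun f : laurent => f 0)) h.
by have /eqP := h : (1 : K) = 0; rewrite oner_eq0.
Qed.

HB.instance Definition _ :=
  GRing.Zmodule_isComNzRing.Build laurent lmulA lmulC lmul1 lmulD lone_neq0.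

Definition lunit : {pred laurent} := fun f => `[< exists g : laurent, g * f = 1 >].
Definition linv (f : laurent) : laurent :=
  match pselect (exists g : laurent, g * f = 1) with
  | left h => proj1_sig (cid h)
  | right _ => f
  end.
Lemma lmulV : {in lunit, left_inverse 1 linv *%R}.
Proof.
move=> f /asboolP h; rewrite /linv; case: pselect => // h'.
exact: (proj2_sig (cid h')).
Qed.
Lemma lunitP (f g : laurent) : g * f = 1 -> f \in lunit.
Proof. by move=> h; apply/asboolP; exists g. Qed.
Lemma linv_out : {in [predC lunit], linv =1 id}.
Proof.
move=> f; rewrite inE => /asboolPn h; rewrite /linv; by case: pselect.
Qed.
HB.instance Definition _ :=
  GRing.ComNzRing_hasMulInverse.Build laurent lmulV lunitP linv_out.

Lemma lscale_bd (c : K) (f : laurent) : lbounded (fun i => c * f i).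
Proof. by case: (lcoP f) => N h; exists N => i /h ->; rewrite mulr0. Qed.
Definition lscale c f := Laurent (lscale_bd c f).
Lemma lscaleA a b f : lscale a (lscale b f) = lscale (a * b) f.
Proof. by apply: laurentP => i /=; rewrite mulrA. Qed.
Lemma lscale1 : left_id 1 lscale.
Proof. by move=> f; apply: laurentP => i /=; rewrite mul1r. Qed.
Lemma lscaleDr : right_distributive lscale +%R.
Proof. by move=> a f g; apply: laurentP => i /=; rewrite mulrDr. Qed.
Lemma lscaleDl f : {morph lscale^~ f : a b / a + b}.
Proof. by move=> a b; apply: laurentP => i /=; rewrite mulrDl. Qed.
HB.instance Definition _ :=
  GRing.Zmodule_isLmodule.Build K laurent lscaleA lscale1 lscaleDr lscaleDl.
Lemma lscaleAl (a : K) (f g : laurent) : a *: (f * g) = (a *: f) * g.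
Proof.
apply: laurentP => n /=; rewrite /lmulf zsum_mull; last exact: lmul_fin.
by apply: eq_zsum => i; rewrite mulrA.
Qed.
HB.instance Definition _ := GRing.Lmodule_isLalgebra.Build K laurent lscaleAl.
Lemma lscaleAr (a : K) (f g : laurent) : a *: (f * g) = f * (a *: g).
Proof. by rewrite mulrC lscaleAl mulrC. Qed.
HB.instance Definition _ := GRing.Lalgebra_isAlgebra.Build K laurent lscaleAr.

Lemma lcoD (f g : laurent) i : (f + g) i = f i + g i. Proof. by []. Qed.
Lemma lcoN (f : laurent) i : (- f) i = - f i. Proof. by []. Qed.
Lemma lcoB (f g : laurent) i : (f - g) i = f i - g i. Proof. by []. Qed.
Lemma lcoZ a (f : laurent) i : (a *: f) i = a * f i. Proof. by []. Qed.
Lemma lco0 i : (0 : laurent) i = 0. Proof. by []. Qed.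
Lemma lco1 i : (1 : laurent) i = (i == 0)%:R. Proof. by []. Qed.
Lemma lcoM (f g : laurent) n : (f * g) n = zsum (fun i => f i * g (n - i)).
Proof. by []. Qed.
Lemma lco_sum (I : Type) (r : seq I) (F : I -> laurent) n :
  (\sum_(i <- r) F i) n = \sum_(i <- r) F i n.
Proof. by elim: r => [|a r IH]; rewrite ?big_nil // !big_cons lcoD IH. Qed.

Lemma lord_exists (f : laurent) : exists N, lord N f. Proof. exact: lcoP. Qed.
Lemma lordW N N' f : N' <= N -> lord N f -> lord N' f.
Proof. by move=> h hf i hi; apply: hf; lia. Qed.
Lemma lordM N N' f g : lord N f -> lord N' g -> lord (N + N') (f * g).
Proof. by move=> h h' i hi; apply: lmulf_ord hi. Qed.
Lemma lordD N f g : lord N f -> lord N g -> lord N (f + g).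
Proof. by move=> h h' i hi; rewrite lcoD h ?h' ?addr0. Qed.
Lemma lordZ N a f : lord N f -> lord N (a *: f).
Proof. by move=> h i hi; rewrite lcoZ h ?mulr0. Qed.
Lemma lordN N f : lord N f -> lord N (- f).
Proof. by move=> h i hi; rewrite lcoN h ?oppr0. Qed.
Lemma lord0 N : lord N 0. Proof. by []. Qed.
Lemma lord1 : lord 0 1.
Proof. by move=> i hi; rewrite lco1 (_ : (i == 0) = false) //; lia. Qed.
Lemma lord_sum N (I : Type) (r : seq I) (F : I -> laurent) :
  (forall i, lord N (F i)) -> lord N (\sum_(i <- r) F i).
Proof. by move=> h; elim/big_ind: _ => [|f g hf hg|i _]; [exact: lord0|exact: lordD|exact: h]. Qed.
Lemma lordX N f (n : nat) : lord N f -> lord (N *+ n) (f ^+ n).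
Proof.
move=> h; elim: n => [|n IH]; first by rewrite mulr0n expr0; apply: lord1.
by rewrite mulrS exprS; apply: lordM.
Qed.

Lemma lordM_co N N' f g : lord N f -> lord N' g -> (f * g) (N + N') = f N * g N'.
Proof.
move=> h h'; rewrite lcoM (zsum1 (j := N)).
  by congr (_ * lco _ _); lia.
move=> i hi; have [lt|le] := ltP i N; first by rewrite h ?mul0r.
by rewrite h' ?mulr0 //; lia.
Qed.

Lemma lmon_bd (n : int) : lbounded (fun i => (i == n)%:R).
Proof. by exists n => i hi; rewrite (_ : (i == n) = false) //; lia. Qed.
Definition lmon n := Laurent (lmon_bd n).
Lemma lcomon n i : lmon n i = (i == n)%:R. Proof. by []. Qed.
Lemma lord_mon n : lord n (lmon n).
Proof. by move=> i hi; rewrite lcomon (_ : (i == n) = false) //; lia. Qed.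
Lemma lmon0 : lmon 0 = 1. Proof. exact: laurentP. Qed.
Lemma lco_monM n f i : (lmon n * f) i = f (i - n).
Proof.
rewrite lcoM (zsum1 (j := n)) ?lcomon ?eqxx ?mul1r // => j /negbTE hj.
by rewrite lcomon hj mul0r.
Qed.
Lemma lmonD m n : lmon (m + n) = lmon m * lmon n.
Proof. by apply: laurentP => i; rewrite lco_monM !lcomon; congr (_%:R); lia. Qed.
Lemma lmon_unit n : lmon n \is a GRing.unit.
Proof. by apply/unitrPr; exists (lmon (- n)); rewrite -lmonD subrr lmon0. Qed.
Lemma lmonX n (k : nat) : lmon n ^+ k = lmon (n *+ k).
Proof. by elim: k => [|k IH]; rewrite ?mulr0n ?lmon0 // exprS IH mulrS lmonD. Qed.

Lemma lgeom_bd (h : laurent) : lord 1 h ->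
  lbounded (fun n => if 0 <= n then (\sum_(j < (absz n).+1) h ^+ j) n else 0).
Proof. by move=> hh; exists 0 => i hi; rewrite lt_geF. Qed.

(* geometric series: coefficients below n of sum_j h^j only involve j <= n *)
Lemma unit_1sub (h : laurent) : lord 1 h ->
  exists2 g, g * (1 - h) = 1 & lord 0 g.
Proof.
move=> hh; exists (Laurent (lgeom_bd hh)); last by move=> i hi /=; rewrite lt_geF.
have hX j : lord j%:Z (h ^+ j) by have := lordX (n := j) hh; rewrite natz.
have hg (n : int) (m : nat) : n <= m%:Z ->
    Laurent (lgeom_bd hh) n = (\sum_(j < m.+1) h ^+ j) n.
  move=> le /=; have [n0|n0] := leP 0 n; last first.
    rewrite lco_sum big1 // => j _; apply: hX; lia.
  have -> : m = (absz n + (m - absz n))%N by lia.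
  rewrite -addSn big_split_ord lcoD -[LHS]addr0; congr (_ + _).
  by rewrite lco_sum big1 // => j _; apply: hX => /=; lia.
apply: laurentP => n; have [n0|n0] := ltP n 0.
  rewrite lord1 //; apply: lmulf_ord (_ : n < 0 + 0) => //.
    by move=> i hi /=; rewrite lt_geF.
  by apply: lordD; [exact: lord1|apply: lordN; apply: (lordW _ hh)].
have -> : (Laurent (lgeom_bd hh) * (1 - h)) n
        = ((\sum_(j < (absz n).+1) h ^+ j) * (1 - h)) n.
  rewrite !lcoM; apply: eq_zsum => i.
  have [le|lt] := leP i n; first by rewrite (hg i (absz n)) //; lia.
  rewrite [(1 - h) _](_ : _ = 0) ?mulr0 //.
  have: lord 0 (1 - h) by apply: lordD; [exact: lord1|apply: lordN; apply: (lordW _ hh)].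
  by apply; lia.
rewrite mulrC -opprB mulNr -subrX1 opprB lcoB hX ?subr0 //; lia.
Qed.

(** After division by its leading term, f becomes 1 - h with h of order at least 1, and the
    geometric series inverts it. *)
Lemma lord_unit N f : lord N f -> f N != 0 ->
  f \is a GRing.unit /\ lord (- N) f^-1.
Proof.
move=> hf h0; set c := f N in h0.
have h1 : lord 1 (1 - c^-1 *: (lmon (- N) * f)).
  move=> i hi; rewrite lcoB lco1 lcoZ lco_monM opprK.
  have [->|ne] := eqVneq i 0; first by rewrite add0r mulVf // subrr.
  by rewrite hf ?mulr0 ?subr0 //; lia.
have [g hg og] := unit_1sub h1.
have hgf : (c^-1 *: (lmon (- N) * g)) * f = 1.
  rewrite -hg opprB addrC subrK -scalerAl -!lscaleAr; congr (_ *: _); ring.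
have uf : f \is a GRing.unit by apply/unitrPr; exists (c^-1 *: (lmon (- N) * g)); rewrite mulrC.
split=> //; rewrite -[f^-1]mul1r -hgf mulrK //.
by apply: lordZ; have := lordM (@lord_mon (- N)) og; rewrite addr0.
Qed.

Lemma lord_exprz (f : laurent) n : lord 1 f -> f 1 != 0 -> lord n (f ^ n).
Proof.
move=> hf h0; case: n => n; first by have := lordX (n := n) hf; rewrite natz.
have [u hi] := lord_unit hf h0.
rewrite NegzE -exprz_inv; have := lordX (n := n.+1) hi.
by rewrite mulNrn natz.
Qed.

Definition lder_f (f : laurent) (n : int) : K := (n + 1)%:~R * f (n + 1).
Lemma lder_bd f : lbounded (lder_f f).
Proof. by case: (lcoP f) => N h; exists (N - 1) => i hi; rewrite /lder_f h ?mulr0 //; lia. Qed.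
Definition lder f := Laurent (lder_bd f).
Lemma lcoder f n : lder f n = (n + 1)%:~R * f (n + 1). Proof. by []. Qed.
Lemma lderD f g : lder (f + g) = lder f + lder g.
Proof. by apply: laurentP => i; rewrite lcoD !lcoder lcoD mulrDr. Qed.
Lemma lderZ a f : lder (a *: f) = a *: lder f.
Proof. by apply: laurentP => i; rewrite lcoZ !lcoder lcoZ mulrCA. Qed.
Lemma lder_lin : linear lder.
Proof. by move=> a f g; rewrite lderD lderZ. Qed.
HB.instance Definition _ := GRing.isLinear.Build K laurent laurent *:%R lder lder_lin.
Lemma lder1 : lder 1 = 0.
Proof.
apply: laurentP => i; rewrite lcoder lco1 lco0.
by have [->|] := eqVneq (i + 1) 0; rewrite ?mul0r ?mulr0.
Qed.
Lemma lderM f g : lder (f * g) = lder f * g + f * lder g.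
Proof.
apply: laurentP => n; rewrite lcoD lcoder !lcoM.
rewrite zsum_mull; last exact: lmul_fin.
rewrite [X in _ = X + _](zsum_shift (- 1)); last exact: lmul_fin.
rewrite -zsumD; last exact: lmul_fin; last first.
  have [N h] := lmul_fin (lder f) g n; exists N.+1 => i hi; apply: h; lia.
apply: eq_zsum => i; rewrite !lcoder.
rewrite (_ : n - (i + -1) = n + 1 - i); last by lia.
rewrite (_ : n - i + 1 = n + 1 - i) ?subrK; last by lia.
rewrite (_ : (n + 1)%:~R = i%:~R + (n + 1 - i)%:~R :> K); last by rewrite -intrD; congr (_%:~R); lia.
ring.
Qed.
Lemma res_der f : (lder f) (- 1) = 0.
Proof. by rewrite lcoder addNr mul0r. Qed.
Lemma lderX f (n : nat) : lder (f ^+ n) = f ^+ n.-1 * lder f *+ n.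
Proof.
elim: n => [|n IH]; first by rewrite expr0 lder1 mulr0n.
rewrite exprS lderM IH; case: n {IH} => [|n] /=; first by rewrite mulr0n expr0; ring.
by rewrite exprS -mulrnAr; ring.
Qed.
Lemma lderV f : f \is a GRing.unit -> lder f^-1 = - (f^-1 * f^-1 * lder f).
Proof.
move=> u; have := congr1 lder (mulrV u); rewrite lder1 lderM => h.
apply: (mulrI u); apply/eqP; rewrite -subr_eq0 -[X in _ == X]h; apply/eqP.
rewrite -!mulrA mulrN opprK !mulrA mulrV // mul1r; ring.
Qed.
Lemma lder_exprz f n : f \is a GRing.unit -> lder (f ^ n) = n%:~R * f ^ (n - 1) * lder f.
Proof.
move=> u; case: n => n.
  rewrite -exprnP lderX; case: n => [|n]; first by rewrite mulr0n !mul0r.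
  rewrite (_ : n.+1%:Z - 1 = n%:Z) /=; last by lia.
  by rewrite -exprnP -mulr_natl mulrA.
rewrite NegzE -exprz_inv -exprnP lderX lderV //= -mulr_natl.
rewrite (_ : - n.+1%:Z - 1 = - n.+2%:Z); last by lia.
rewrite -exprz_inv -exprnP !exprS mulrNz -pmulrn; ring.
Qed.

End LaurentRing.

(** * The series e^{ax} and e^x - 1, residues, reflection of x *)

Section Exponential.
Variable K : numFieldType.
Local Notation L := (laurent K).

Lemma fact_neq0 n : (n`!)%:R != 0 :> K.
Proof. by rewrite pnatr_eq0 -lt0n fact_gt0. Qed.

Lemma lco_psM (f g : L) (n : nat) : lord 0 f -> lord 0 g ->
  (f * g) n%:Z = \sum_(i < n.+1) f i%:Z * g (n - i)%N%:Z.
Proof.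
move=> hf hg; rewrite lcoM (@zsum_seq _ _ [seq k%:Z | k <- iota 0 n.+1]).
- rewrite big_map -[iota 0 _]/(index_iota 0 n.+1) big_mkord; apply: eq_bigr => i _.
  by congr (_ * lco _ _); have := ltn_ord i; lia.
- by rewrite map_inj_uniq ?iota_uniq // => i j; lia.
- move=> i hi; apply/mapP; exists (absz i); last first.
    by have [lt|//] := ltP i 0; [rewrite hf ?mul0r ?eqxx in hi|lia].
  rewrite mem_iota; have [lt|le] := ltP i 0; first by rewrite hf ?mul0r ?eqxx in hi.
  have [lt|le'] := ltP (n%:Z - i) 0; first by rewrite (hg (_ - _)) ?mulr0 ?eqxx in hi.
  lia.
Qed.

Definition lE_f (a : K) (i : int) : K :=
  if 0 <= i then a ^+ absz i / ((absz i)`!)%:R else 0.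
Lemma lE_bd a : lbounded (lE_f a).
Proof. by exists 0 => i hi; rewrite /lE_f lt_geF. Qed.
Definition lE a : L := Laurent (lE_bd a).

Lemma lcoE a (n : nat) : lE a n%:Z = a ^+ n / (n`!)%:R. Proof. by []. Qed.
Lemma lord_E a : lord 0 (lE a).
Proof. by move=> i hi; rewrite /= /lE_f lt_geF. Qed.

Lemma lE0 : lE 0 = 1.
Proof.
apply: laurentP => -[[|n]|n]; rewrite ?lcoE ?lord_E ?lco1 ?expr0 ?divr1 //.
by rewrite expr0n /= mul0r.
Qed.

Lemma lED a b : lE (a + b) = lE a * lE b.
Proof.
apply: laurentP => -[n|n]; last first.
  rewrite lord_E // (_ : (lE a * lE b) (Negz n) = 0) //.
  by have := lordM (@lord_E a) (@lord_E b); apply.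
rewrite lco_psM; try exact: lord_E.
rewrite lcoE addrC exprDn mulr_suml; apply: eq_bigr => i _.
rewrite !lcoE -mulr_natr.
have -> : (n`!)%:R = ('C(n, i) * (i`! * (n - i)`!))%:R :> K by rewrite bin_fact // -ltnS.
have h0 : ('C(n, i))%:R != 0 :> K by rewrite pnatr_eq0 -lt0n bin_gt0 -ltnS.
rewrite !natrM; have := fact_neq0 i; have := fact_neq0 (n - i) => h1 h2.
by field; rewrite h0 h1 h2.
Qed.

Lemma lEX a n : lE a ^+ n = lE (a *+ n).
Proof. by elim: n => [|n IH]; rewrite ?expr0 ?mulr0n ?lE0 // exprS IH mulrS lED. Qed.

Lemma lderE a : lder (lE a) = a *: lE a.
Proof.
apply: laurentP => i; rewrite lcoZ lcoder.
have [ge|lt] := leP 0 i; last first.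
  rewrite [lE a i]lord_E // mulr0; have [->|ne] := eqVneq i (- 1); first by rewrite mul0r.
  by rewrite lord_E ?mulr0 //; lia.
case: i ge => // n _; rewrite (_ : Posz n + 1 = n.+1); last by lia.
rewrite !lcoE factS exprS natrM -pmulrn.
have h2 := fact_neq0 n; have h1 : n.+1%:R != 0 :> K by rewrite pnatr_eq0.
by rewrite -natr1 in h1 *; field; rewrite h2 h1.
Qed.

(** With z = e^x this is z - 1, the local parameter at z = 1 in which the test functions are
    expanded. *)
Definition ly : L := lE 1 - 1.
Lemma lord_y : lord 1 ly.
Proof.
move=> -[[|n]|n] // _; rewrite /ly lcoB lco1.
  by rewrite lcoE expr0 divr1 subrr.
by rewrite lord_E // subrr.
Qed.
Lemma lco_y1 : ly 1 = 1.
Proof. by rewrite /ly lcoB lco1 lcoE expr1 divr1 subr0. Qed.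
Lemma ly_unit : ly \is a GRing.unit.
Proof. by have [] := lord_unit lord_y; rewrite // lco_y1 oner_eq0. Qed.
Lemma lE1y : lE 1 = 1 + ly. Proof. by rewrite /ly addrC subrK. Qed.
Lemma lder_y : lder ly = lE 1.
Proof. by rewrite /ly raddfB /= lder1 subr0 lderE scale1r. Qed.
Lemma lord_yz n : lord n (ly ^ n).
Proof. by apply: lord_exprz; [exact: lord_y|rewrite lco_y1 oner_eq0]. Qed.
Lemma lyzD m n : ly ^ (m + n) = ly ^ m * ly ^ n.
Proof. exact/exprzDr/ly_unit. Qed.
Lemma lyzS n : ly ^ (n + 1) = ly * ly ^ n.
Proof. by rewrite lyzD mulrC. Qed.
Lemma lder_yz n : lder (ly ^ n) = n%:~R *: (ly ^ (n - 1) * lE 1).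
Proof. by rewrite lder_exprz ?ly_unit // lder_y -mulrA mulrzl scaler_int. Qed.

Definition lres (f : L) : K := f (- 1).
Lemma lresD f g : lres (f + g) = lres f + lres g. Proof. by []. Qed.
Lemma lresB f g : lres (f - g) = lres f - lres g. Proof. by []. Qed.
Lemma lresN f : lres (- f) = - lres f. Proof. by []. Qed.
Lemma lresZ a f : lres (a *: f) = a * lres f. Proof. by []. Qed.
Lemma lres_ord f : lord 0 f -> lres f = 0. Proof. by apply. Qed.
Lemma lyV : ly * ly ^ (- 1) = 1. Proof. by rewrite exprN1 mulrV ?ly_unit. Qed.
Lemma lres_yV : lres (ly ^ (- 1)) = 1.
Proof.
have h1 := lord_y; have h2 := @lord_yz (- 1).
by have := lordM_co h1 h2; rewrite lyV (_ : 1 + -1 = 0) // lco_y1 mul1r lco1 eqxx => /esym.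
Qed.
Lemma lres_E1yV : lres (lE 1 * ly ^ (- 1)) = 1.
Proof. by rewrite lE1y mulrDl mul1r lresD lres_yV lyV lres_ord ?addr0 //; apply: lord1. Qed.
(** Up to the factor n + 1 this series is the derivative of y^{n+1}, and a derivative has no
    residue. *)
Lemma lres_E1y n : n != - 1 -> lres (lE 1 * ly ^ n) = 0.
Proof.
move=> hn; have := res_der (ly ^ (n + 1)); rewrite lder_yz addrK lcoZ mulrC => /eqP.
rewrite mulf_eq0 intr_eq0 mulrC; case/orP => /eqP // h; move: hn; lia.
Qed.

Lemma lyX_sum k : ly ^+ k = \sum_(i < k.+1) ('C(k, i)%:R * (- 1) ^+ (k - i)) *: lE i%:R.
Proof.
rewrite /ly addrC exprDn; apply: eq_bigr => i _.
rewrite lEX -scaler_nat -scalerA; congr (_ *: _).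
by rewrite -[RHS]mulr_algl -in_algE rmorphXn rmorphN1.
Qed.

(** The right-hand side is the formula of [expm1_coef], so this identifies the coefficients in the
    associativity axiom with a power of the series y. *)
Lemma lco_yX k (q : int) : (ly ^+ k) q =
  if q < 0 then 0 else
  (\sum_(i < k.+1) 'C(k, i)%:R * (- 1) ^+ (k - i) * (i%:R) ^+ (absz q))
    / ((absz q)`!)%:R.
Proof.
have [h|h] := ltP q 0.
  by have := lordX (n := k) lord_y; rewrite natz; apply; lia.
rewrite lyX_sum lco_sum mulr_suml; apply: eq_bigr => i _.
by rewrite lcoZ -mulrA; congr (_ * _); case: q h.
Qed.

(** The reflection x -> -x, which enters through skew-symmetry. *)
Definition lsig_f (f : L) (i : int) : K := (- 1) ^ i * f i.
Lemma lsig_bd f : lbounded (lsig_f f).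
Proof. by case: (lcoP f) => N h; exists N => i hi; rewrite /lsig_f h ?mulr0. Qed.
Definition lsig f : L := Laurent (lsig_bd f).
Lemma lco_sig f i : lsig f i = (- 1) ^ i * f i. Proof. by []. Qed.
Lemma lsigM f g : lsig (f * g) = lsig f * lsig g.
Proof.
apply: laurentP => n; rewrite lco_sig !lcoM zsum_mull; last exact: lmul_fin.
apply: eq_zsum => i; rewrite !lco_sig [in LHS](_ : n = i + (n - i)); last by lia.
rewrite exprzDr ?unitrN1 //; set m := n - i.
by rewrite (_ : i + m - i = m); [ring|lia].
Qed.
Lemma lsigB f g : lsig (f - g) = lsig f - lsig g.
Proof. by apply: laurentP => i; rewrite lcoB !lco_sig lcoB mulrBr. Qed.
Lemma lsig1 : lsig 1 = 1.
Proof.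
apply: laurentP => i; rewrite lco_sig lco1.
by have [->|] := eqVneq i 0; rewrite ?expr0z ?mul1r ?mulr0.
Qed.
Lemma lsigX f n : lsig (f ^+ n) = lsig f ^+ n.
Proof. by elim: n => [|n IH]; rewrite ?expr0 ?lsig1 // !exprS lsigM IH. Qed.
Lemma lsigE a : lsig (lE a) = lE (- a).
Proof.
apply: laurentP => -[n|n]; last by rewrite lco_sig !lord_E ?mulr0.
by rewrite lco_sig !lcoE exprNn -exprnP mulrA.
Qed.
Lemma lsig_y : lsig ly = - (lE (- 1) * ly).
Proof. by rewrite /ly lsigB lsig1 lsigE mulrBr -lED addNr lE0 mulr1 opprB. Qed.
Lemma lres_sig f : lres (lsig f) = - lres f.
Proof. by rewrite /lres lco_sig exprN1 invrN1 mulN1r. Qed.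

End Exponential.

Arguments lco : simpl never.

Section IsLinear.
Variable K : fieldType.
Variables U W : lmodType K.
Variable g : U -> W.
Hypothesis hg : is_linear g.
Lemma is_linear0 : g 0 = 0.
Proof.
have := hg 1 0 0; rewrite !scale1r addr0 => /eqP.
by rewrite -subr_eq0 opprD addrA subrr sub0r oppr_eq0 => /eqP.
Qed.
Lemma is_linearD : {morph g : x y / x + y}.
Proof. by move=> x y; have := hg 1 x y; rewrite !scale1r. Qed.
Lemma is_linearZ a x : g (a *: x) = a *: g x.
Proof. by have := hg a x 0; rewrite is_linear0 !addr0. Qed.
Lemma is_linearN x : g (- x) = - g x.
Proof. by rewrite -scaleN1r is_linearZ scaleN1r. Qed.
Lemma is_linearB x y : g (x - y) = g x - g y.
Proof. by rewrite is_linearD is_linearN. Qed.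
Lemma is_linear_sum (I : Type) (r : seq I) (P : pred I) (F : I -> U) :
  g (\sum_(i <- r | P i) F i) = \sum_(i <- r | P i) g (F i).
Proof. exact: (big_morph g is_linearD is_linear0). Qed.
Lemma is_linear_zsum (F : int -> U) : zfin F -> g (zsum F) = zsum (fun i => g (F i)).
Proof. exact: zsum_raddf is_linear0 is_linearD. Qed.
End IsLinear.

Lemma is_linear_comp (K : fieldType) (U V W : lmodType K) (f : U -> V) (g : V -> W) :
  is_linear f -> is_linear g -> is_linear (fun x => g (f x)).
Proof. by move=> hf hg a x y; rewrite hf hg. Qed.

(** * Residue pairing of Laurent series with sequences of modes *)

Section Pairing.
Variable K : numFieldType.
Variable M : lmodType K.
Local Notation L := (laurent K).
Implicit Types (h : L) (phi : int -> M).

Definition ubd phi := exists N : int, forall l, N <= l -> phi l = 0.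

(* the residue pairing of h(x) with sum_l phi_l x^{-l-1} *)
Definition pr h phi : M := zsum (fun l => h l *: phi l).

Lemma pr_fin h phi : ubd phi -> zfin (fun l => h l *: phi l).
Proof.
case: (lcoP h) => N hN [N' hN']; exists (absz N + absz N').+1 => l hl.
have [lt|le] := ltP l N; first by rewrite hN ?scale0r.
by rewrite hN' ?scaler0 //; lia.
Qed.

Lemma prDl h h' phi : ubd phi -> pr (h + h') phi = pr h phi + pr h' phi.
Proof.
move=> u; rewrite /pr -zsumD; try exact: pr_fin.
by apply: eq_zsum => l; rewrite scalerDl.
Qed.
Lemma prZl a h phi : ubd phi -> pr (a *: h) phi = a *: pr h phi.
Proof.
move=> u; rewrite /pr (zsum_raddf (g := fun x => a *: x)).
- by apply: eq_zsum => l; rewrite scalerA.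
- by rewrite scaler0.
- by move=> x y; rewrite scalerDr.
- exact: pr_fin.
Qed.
Lemma pr_lin phi : ubd phi -> is_linear (pr ^~ phi).
Proof. by move=> u a x y; rewrite prDl // prZl. Qed.

Lemma prDr h phi phi' : ubd phi -> ubd phi' ->
  pr h (fun l => phi l + phi' l) = pr h phi + pr h phi'.
Proof.
move=> u u'; rewrite /pr -zsumD; try exact: pr_fin.
by apply: eq_zsum => l; rewrite scalerDr.
Qed.
Lemma prZr h a phi : ubd phi -> pr h (fun l => a *: phi l) = a *: pr h phi.
Proof.
move=> u; rewrite /pr (zsum_raddf (g := fun x => a *: x)).
- by apply: eq_zsum => l; rewrite !scalerA mulrC.
- by rewrite scaler0.
- by move=> x y; rewrite scalerDr.
- exact: pr_fin.
Qed.
Lemma prBr h phi phi' : ubd phi -> ubd phi' ->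
  pr h (fun l => phi l - phi' l) = pr h phi - pr h phi'.
Proof.
move=> u u'; rewrite -scaleN1r -prZr // -prDr //.
  by apply: eq_zsum => l; rewrite scaleN1r.
by case: u' => N h'; exists N => l /h' ->; rewrite scaler0.
Qed.

Lemma pr_sumr (I : Type) (r : seq I) h (phi : I -> int -> M) : (forall i, ubd (phi i)) ->
  pr h (fun l => \sum_(i <- r) phi i l) = \sum_(i <- r) pr h (phi i).
Proof.
move=> u; rewrite /pr -zsum_sum => [|i]; last exact: pr_fin.
by apply: eq_zsum => l; rewrite scaler_sumr.
Qed.

Lemma eq_pr h phi phi' : phi =1 phi' -> pr h phi = pr h phi'.
Proof. by move=> /funext ->. Qed.

Lemma pr0 h phi : (forall l, phi l = 0) -> pr h phi = 0.
Proof. by move=> h0; apply: zsum0 => l; rewrite h0 scaler0. Qed.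

Lemma pr_ord N h phi : lord N h -> (forall l, N <= l -> phi l = 0) -> pr h phi = 0.
Proof.
move=> hN hphi; apply: zsum0 => l; have [lt|le] := ltP l N.
  by rewrite hN ?scale0r.
by rewrite hphi ?scaler0.
Qed.

Lemma pr_mon n phi : pr (lmon K n) phi = phi n.
Proof.
rewrite /pr (zsum1 (j := n)) ?lcomon ?eqxx ?scale1r // => i /negbTE hi.
by rewrite lcomon hi scale0r.
Qed.

Lemma pr_monM n h phi : ubd phi -> pr (lmon K n * h) phi = pr h (fun l => phi (l + n)).
Proof.
move=> u; rewrite /pr (zsum_shift n); last exact: pr_fin.
by apply: eq_zsum => l; rewrite lco_monM addrK.
Qed.

(** Continuity in the x-adic topology: below order N only finitely many monomials of h occur, so h
    is a finite combination of monomials plus a series of order N. *)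
Lemma cont_ext (Lam : L -> M) (N : int) : is_linear Lam ->
  (forall h, lord N h -> Lam h = 0) -> (forall n, Lam (lmon K n) = 0) -> forall h, Lam h = 0.
Proof.
move=> hl hN hm h; case: (lcoP h) => a ha.
pose s := [seq (k%:Z + a) | k <- iota 0 (absz (N - a))].
have us : uniq s by rewrite map_inj_uniq ?iota_uniq // => i j; lia.
have -> : h = (h - \sum_(n <- s) h n *: lmon K n) + \sum_(n <- s) h n *: lmon K n.
  by rewrite subrK.
rewrite (is_linearD hl) (is_linear_sum hl) hN ?add0r.
  by apply: big1 => n _; rewrite (is_linearZ hl) hm scaler0.
move=> i hi; rewrite lcoB lco_sum.
have [hs|hs] := boolP (i \in s).
  rewrite (bigD1_seq i) //= lcoZ lcomon eqxx mulr1 big1 ?addr0 ?subrr // => j /negbTE hj.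
  by rewrite lcoZ lcomon eq_sym hj mulr0.
rewrite big1_seq ?subr0 => [|j /= hj].
  apply: ha; rewrite ltNge; apply: contra hs => le; apply/mapP.
  by exists (absz (i - a)); rewrite ?mem_iota; lia.
rewrite lcoZ lcomon; case: eqVneq => [e|]; last by rewrite mulr0.
by rewrite -e (negbTE hs) in hj.
Qed.

Lemma pr_mul h1 h2 phi : ubd phi ->
  pr h1 (fun a => pr h2 (fun c => phi (a + c))) = pr (h1 * h2) phi.
Proof.
move=> u; have us a : ubd (fun c => phi (a + c)).
  by case: u => N h; exists (N - a) => l hl; apply: h; lia.
have [N hN] := u; have [b hb] := lord_exists h2.
have u2 : ubd (fun a => pr h2 (fun c => phi (a + c))).
  by exists (N - b) => l hl; apply: (pr_ord hb) => c hc; apply: hN; lia.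
apply/eqP; rewrite -subr_eq0; apply/eqP.
apply: (@cont_ext (fun h1 => pr h1 (fun a => pr h2 (fun c => phi (a + c))) - pr (h1 * h2) phi)
   (N - b)).
- move=> a x y; rewrite (pr_lin u2) mulrDl -scalerAl (pr_lin u) scalerBr opprD.
  by rewrite !addrA; congr (_ + _); rewrite -!addrA; congr (_ + _); rewrite addrC.
- move=> h hh; rewrite (pr_ord hh) => [|l hl]; last first.
    by apply: (pr_ord hb) => c hc; apply: hN; lia.
  rewrite (pr_ord (N := N)) ?subrr // => i hi.
  by apply: (lordM hh hb); lia.
- move=> n; rewrite pr_mon pr_monM //; apply/eqP; rewrite subr_eq0; apply/eqP.
  by apply: eq_pr => c; rewrite addrC.
Qed.

End Pairing.

Lemma pr_raddf (K : numFieldType) (M M' : lmodType K) (g : M -> M') (h : laurent K)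
  (phi : int -> M) : is_linear g -> ubd phi -> g (pr h phi) = pr h (fun l => g (phi l)).
Proof.
move=> hg u; rewrite /pr (is_linear_zsum hg); last exact: pr_fin.
by apply: eq_zsum => l; rewrite (is_linearZ hg).
Qed.

(** * Linear independence of exponentials *)

Section Separation.
Variable K : numFieldType.
Local Notation L := (laurent K).

(** The factors j! undo the denominators of the exponential series, so pairing with e^{ax} evaluates
    p at a. *)
Definition polykernel (p : {poly K}) : L :=
  \sum_(j < size p) (p`_j * (j`!)%:R) *: lmon K (- j%:Z - 1).
Lemma polykernelP (p : {poly K}) a : lres (polykernel p * lE a) = p.[a].
Proof.
rewrite mulr_suml /lres lco_sum horner_coef; apply: eq_bigr => j _.
rewrite -scalerAl lcoZ lco_monM (_ : -1 - (- j%:Z - 1) = j); last by lia.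
by rewrite lcoE -mulrA mulrCA mulrA mulrC; field; apply: fact_neq0.
Qed.

(** A kernel whose polynomial vanishes at every exponent in the support except [al s0] isolates the
    coefficient [c s0]. *)
Lemma exp_indep (M : lmodType K) (al : int -> K) (c : int -> M) : injective al -> zfin c ->
  (forall h : L, zsum (fun s => lres (h * lE (al s)) *: c s) = 0) -> forall s, c s = 0.
Proof.
move=> inj [N hN] H s0.
have [hs|hs] := leqP N (absz s0); first exact: hN.
pose p : {poly K} := \prod_(s <- zrange N | s != s0) ('X - (al s)%:P).
have hp s : s \in zrange N -> s != s0 -> p.[al s] = 0.
  move=> h1 h2; rewrite /p -big_filter horner_prod.
  have hm : s \in [seq i <- zrange N | i != s0] by rewrite mem_filter h2.
  by rewrite (big_rem s) //= hornerXsubC subrr mul0r.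
have p0 : p.[al s0] != 0.
  rewrite /p horner_prod prodf_seq_neq0; apply/allP => s _; apply/implyP => hs'.
  by rewrite hornerXsubC subr_eq0 (inj_eq inj) eq_sym.
have := H (polykernel p).
rewrite (@zsumE _ _ N) => [|i hi]; last by rewrite hN ?scaler0 //; lia.
rewrite (bigD1_seq s0) ?zrange_uniq ?mem_zrange //=; last by lia.
rewrite polykernelP big1_seq ?addr0 => [|s /andP[h1 h2]]; last first.
  by rewrite polykernelP hp ?scale0r.
by move/eqP; rewrite scaler_eq0 (negbTE p0) => /eqP.
Qed.
End Separation.

(** * The substitution y = e^x - 1 *)
Section Substitution.
Variable K : numFieldType.
Local Notation L := (laurent K).
Local Notation y := (ly K).
Implicit Types (a b h : nat -> K) (f g : L).

Lemma lord_eq f g : (forall N : nat, lord N%:Z (f - g)) -> f = g.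
Proof.
move=> h; apply: laurentP => i; apply/eqP; rewrite -subr_eq0; apply/eqP.
by apply: (h (absz i).+1); lia.
Qed.

Definition yev N a : L := \sum_(n < N) a n *: y ^+ n.

Lemma lord_yX (n : nat) : lord n%:Z (y ^+ n).
Proof. exact: (@lord_yz K n). Qed.

Lemma horner_alg_y (p : {poly K}) : horner_alg y p = \sum_(i < size p) p`_i *: y ^+ i.
Proof.
rewrite /horner_alg /horner_morph horner_coef size_map_poly.
by apply: eq_bigr => i _; rewrite coef_map /= mulr_algl.
Qed.
Lemma yev_poly N a : yev N a = horner_alg y (\poly_(n < N) a n).
Proof.
rewrite poly_def linear_sum; apply: eq_bigr => n _.
by rewrite linearZ /= mulr_algl; congr (_ *: _); rewrite rmorphXn; congr (_ ^+ _); exact: (esym (horner_algX y)).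
Qed.
Lemma lord_horner_alg N (p : {poly K}) : (forall i, (i < N)%N -> p`_i = 0) ->
  lord N%:Z (horner_alg y p).
Proof.
move=> h; rewrite horner_alg_y; apply: lord_sum => i.
have [lt|le] := ltnP i N; first by rewrite h // scale0r.
by apply: lordZ; apply: (lordW _ (@lord_yX i)); lia.
Qed.

(** Substitution of y = e^x - 1 into the power series with coefficients a. Since y has order 1, the
    coefficient of x^m involves only y^n with n <= m, so the sum may be cut after m + 1 terms. *)
Definition pe_f a (m : int) : K := if 0 <= m then yev (absz m).+1 a m else 0.
Lemma pe_bd a : lbounded (pe_f a).
Proof. by exists 0 => i hi; rewrite /pe_f lt_geF. Qed.
Definition pe a : L := Laurent (pe_bd a).

Lemma yev_split m n a : yev (m + n) a = yev m a + \sum_(i < n) a (m + i)%N *: y ^+ (m + i).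
Proof. by rewrite /yev big_split_ord. Qed.

Lemma lord_pe N a : lord N%:Z (pe a - yev N a).
Proof.
move=> i hi; rewrite lcoB; have [lt|le] := ltP i 0.
  rewrite [pe a i]/lco /= /pe_f lt_geF // lco_sum big1 ?subrr // => j _.
  by rewrite lcoZ lord_yX ?mulr0 //; lia.
rewrite [pe a i]/lco /= /pe_f le (_ : N = (absz i).+1 + (N - (absz i).+1))%N; last by lia.
rewrite yev_split lcoD opprD addrA subrr add0r lco_sum big1 ?oppr0 // => j _.
by rewrite lcoZ lord_yX ?mulr0 //; lia.
Qed.

Lemma lord_yev N a : lord 0 (yev N a).
Proof. by apply: lord_sum => i; apply: lordZ; apply: (lordW _ (@lord_yX i)). Qed.

Lemma lord_pe0 a : lord 0 (pe a).
Proof. by have := @lord_pe 0 a; rewrite /yev big_ord0 subr0. Qed.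

Lemma lord_trans N f g g' : lord N (f - g) -> lord N (g - g') -> lord N (f - g').
Proof. by move=> h1 h2; rewrite -[f](subrK g) -addrA; apply: lordD. Qed.
Lemma lord_sym N f g : lord N (f - g) -> lord N (g - f).
Proof. by move=> h; rewrite -opprB; apply: lordN. Qed.
Lemma lord_cM N f f' g g' : lord 0 f -> lord 0 g' -> lord N (f - f') -> lord N (g - g') ->
  lord N (f * g - f' * g').
Proof.
move=> hf hg h h'; rewrite (_ : _ - _ = f * (g - g') + (f - f') * g'); last by ring.
apply: lordD; first by have := lordM hf h'; rewrite add0r.
by have := lordM h hg; rewrite addr0.
Qed.

Lemma peM a b : pe (psmul a b) = pe a * pe b.
Proof.
apply: lord_eq => N; apply: lord_trans (@lord_pe N _) _; apply: lord_sym.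
apply: lord_trans (lord_cM (@lord_pe0 _) (@lord_yev N b) (@lord_pe N a) (@lord_pe N b)) _.
rewrite !yev_poly -rmorphM -rmorphB; apply: lord_horner_alg => i hi.
rewrite coefB coefM coef_poly hi; apply/eqP; rewrite subr_eq0; apply/eqP.
apply: eq_bigr => j _; have := ltn_ord j => hj; rewrite !coef_poly.
have -> : (j < N)%N by lia.
by have -> : (i - j < N)%N by lia.
Qed.

Lemma pe1 : pe (@ps1 K) = 1.
Proof.
apply: lord_eq => -[|N].
  by apply: lordD; [exact: lord_pe0|apply: lordN; exact: lord1].
apply: lord_trans (@lord_pe N.+1 _) _.
rewrite /yev big_ord_recl /ps1 /= expr0 scale1r big1 ?addr0 ?subrr; first exact: lord0.
by move=> i _; rewrite scale0r.
Qed.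

Lemma pe_exp h j : pe (psexp h j) = pe h ^+ j.
Proof. by elim: j => [|j IH]; [rewrite pe1|rewrite exprS -IH -peM]. Qed.

Lemma psexp_eq0 h j n : h 0%N = 0 -> (n < j)%N -> psexp h j n = 0.
Proof.
move=> h0; elim: j n => // j IH n hn; rewrite /psexp /= /psmul big1 // => -[[|i] hi] _ /=.
  by rewrite h0 mul0r.
by rewrite -/(psexp h j) IH ?mulr0 //; lia.
Qed.

Lemma pspow_widen N n h be : h 0%N = 0 -> (n < N)%N ->
  pspow h be n = \sum_(j < N) gbinom be j * psexp h j n.
Proof.
move=> h0 hn; rewrite /pspow (_ : N = n.+1 + (N - n.+1))%N; last by lia.
rewrite big_split_ord [X in _ = _ + X]big1 ?addr0 // => i _.
by rewrite psexp_eq0 ?mulr0 //=; lia.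
Qed.

Lemma lord_pspow N h be : h 0%N = 0 ->
  lord N%:Z (pe (pspow h be) - \sum_(j < N) gbinom be j *: pe h ^+ j).
Proof.
move=> h0; apply: lord_trans (@lord_pe N _) _.
have -> : yev N (pspow h be) = \sum_(j < N) gbinom be j *: yev N (psexp h j).
  under [RHS]eq_bigr do rewrite scaler_sumr.
  rewrite exchange_big; apply: eq_bigr => n _ /=.
  under [RHS]eq_bigr do rewrite scalerA.
  rewrite -scaler_suml; congr (_ *: _).
  exact: pspow_widen.
rewrite -sumrB; apply: lord_sum => j; rewrite -scalerBr -pe_exp; apply: lordZ.
exact/lord_sym/lord_pe.
Qed.

Lemma gbinom0 (be : K) : gbinom be 0 = 1.
Proof. by rewrite /gbinom big_ord0 divr1. Qed.
Lemma gbinomS (be : K) n : n.+1%:R * gbinom be n.+1 = (be - n%:R) * gbinom be n.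
Proof.
rewrite /gbinom big_ord_recr factS natrM /=.
have h2 := fact_neq0 K n; have h1 : n.+1%:R != 0 :> K by rewrite pnatr_eq0.
by rewrite -natr1 in h1 *; field; rewrite h2 h1.
Qed.
Lemma gbinom_pascal (be : K) n : gbinom (be + 1) n.+1 = gbinom be n.+1 + gbinom be n.
Proof.
have hn m : m.+1%:R != 0 :> K by rewrite pnatr_eq0.
elim: n => [|n IH].
  by apply: (mulfI (hn 0%N)); rewrite mulrDr !gbinomS !gbinom0; ring.
apply: (mulfI (hn n.+1)); rewrite mulrDr !gbinomS.
rewrite IH (_ : be + 1 - n.+1%:R = be - n%:R); last by rewrite -natr1; ring.
by rewrite mulrDr -gbinomS -!natr1; ring.
Qed.
Lemma gbinom_nat n j : gbinom (n%:R : K) j = 'C(n, j)%:R.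
Proof.
elim: n j => [|n IH] [|j]; rewrite ?gbinom0 ?bin0 //; last first.
  by rewrite -natr1 gbinom_pascal !IH binS natrD.
by rewrite /gbinom big_ord_recl subrr !mul0r.
Qed.
Lemma gbinomN1 j : gbinom (- 1 : K) j = (-1) ^+ j.
Proof.
elim: j => [|j IH]; first by rewrite gbinom0.
have hn : j.+1%:R != 0 :> K by rewrite pnatr_eq0.
by apply: (mulfI hn); rewrite gbinomS IH exprS -natr1; ring.
Qed.

Lemma pspow_recr h be : h 0%N = 0 ->
  pe (pspow h (be + 1)) = (1 + pe h) * pe (pspow h be).
Proof.
move=> h0; apply: lord_eq => N; apply: (@lordW _ N.+1%:Z); first by lia.
apply: lord_trans (@lord_pspow N.+1 h _ h0) _; apply: lord_sym.
have o1 : lord 0 (1 + pe h) by apply: lordD; [exact: lord1|exact: lord_pe0].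
have oh : lord 1 (pe h).
  rewrite -[pe h](subrK (yev 1 h)); apply: lordD; first exact: (@lord_pe 1).
  by rewrite /yev big_ord_recl big_ord0 h0 scale0r addr0; apply: lord0.
have ohX j : lord j%:Z (pe h ^+ j) by have := lordX (n := j) oh; rewrite natz.
apply: (lord_trans (g := (1 + pe h) * \sum_(j < N.+1) gbinom be j *: pe h ^+ j)).
  rewrite -mulrBr -[N.+1%:Z]add0r; apply: lordM => //; exact: lord_pspow.
rewrite mulrDl mul1r [X in _ + X - _]mulr_sumr.
rewrite [X in _ + X - _]big_ord_recr /= -scalerAr -exprS.
rewrite [X in X + _ - _]big_ord_recl [X in _ - X]big_ord_recl !gbinom0.
under [X in _ - (_ + X)]eq_bigr do rewrite gbinom_pascal scalerDl.
rewrite big_split /=.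
under [X in _ + (X + _) - _]eq_bigr do rewrite -scalerAr -exprS.
rewrite (_ : _ - _ = gbinom be N *: pe h ^+ N.+1); last by rewrite /bump /=; ring.
by apply: lordZ.
Qed.

(** Both sides satisfy the same recursion in n, coming from Pascal's rule. As 1 + h is invertible,
    the recursion also runs downwards from n = 0. *)
Lemma pe_pow_int h (n : int) : h 0%N = 0 -> 1 + pe h \is a GRing.unit ->
  pe (pspow h n%:~R) = (1 + pe h) ^ n.
Proof.
move=> h0 u; have hS m : pe (pspow h (m + 1)%:~R) = (1 + pe h) * pe (pspow h m%:~R).
  by rewrite intrD pspow_recr.
have e0 : pe (pspow h 0%:~R) = 1.
  apply: lord_eq => -[|N]; first by apply: lordD; [exact: lord_pe0|apply: lordN; exact: lord1].
  apply: lord_trans (@lord_pspow N.+1 h _ h0) _.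
  rewrite big_ord_recl gbinom0 expr0 scale1r big1 ?addr0 ?subrr; first exact: lord0.
  by move=> i _; rewrite -[0%:~R]/(0%:R) gbinom_nat bin0n scale0r.
case: n => n.
  elim: n => [|n IH]; first by rewrite e0 expr0z.
  by rewrite (_ : n.+1%:Z = n%:Z + 1) ?hS ?IH ?exprSz //; [rewrite mulrC -exprSzr; congr (_ ^ _)|]; lia.
elim: n => [|n IH].
  have := hS (- 1); rewrite addNr e0 => e; rewrite NegzE.
  by apply: (mulrI u); rewrite -e exprN1 mulrV.
have := hS (Negz n.+1); rewrite (_ : Negz n.+1 + 1 = Negz n); last by lia.
rewrite IH => e; apply: (mulrI u); rewrite -e -[X in X * _]expr1z -exprzDr //.
by congr (_ ^ _); lia.
Qed.

End Substitution.

Section ResCoef.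
Variable K : numFieldType.
Local Notation L := (laurent K).
Local Notation y := (ly K).

Lemma lscale_in_alg (a : K) (f : L) : a *: f = in_alg L a * f.
Proof. by rewrite in_algE mulr_algl. Qed.

Lemma lscale_sign n (f : L) : ((-1) ^+ n) *: f = (-1) ^+ n * f.
Proof. by rewrite -[LHS]mulr_algl -in_algE rmorphXn rmorphN1. Qed.

Lemma lord_lder N (f : L) : lord N f -> lord (N - 1) (lder f).
Proof. by move=> h i hi; rewrite lcoder h ?mulr0 //; lia. Qed.

Lemma lder_eq0 (f : L) : lder f = 0 -> f = (f 0) *: 1.
Proof.
move=> h; apply: laurentP => i; rewrite lcoZ lco1.
have [->|ne] := eqVneq i 0; first by rewrite mulr1.
have := congr1 (fun g : L => g (i - 1)) h; rewrite lcoder subrK lco0 => /eqP.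
by rewrite mulf_eq0 intr_eq0 (negbTE ne) /= => /eqP ->; rewrite mulr0.
Qed.

Lemma lder_yX n : lder (y ^+ n.+1) = n.+1%:R *: (y ^+ n * lE 1).
Proof. by rewrite lderX lder_y /= scaler_nat. Qed.

Lemma pe_psy : pe (@psy K) = y.
Proof.
apply: lord_eq => -[|[|N]].
- apply: lord_trans (@lord_pe K 0 _) _; rewrite /yev big_ord0 sub0r; apply: lordN.
  by apply: (lordW _ (@lord_y K)).
- apply: lord_trans (@lord_pe K 1 _) _.
  by rewrite /yev big_ord_recl big_ord0 /psy scale0r add0r sub0r; apply: lordN; apply: lord_y.
- apply: lord_trans (@lord_pe K N.+2 _) _.
  rewrite /yev !big_ord_recl big1 => [|i _]; last by rewrite /psy scale0r.
  by rewrite /psy scale0r scale1r expr1 add0r addr0 subrr; apply: lord0.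
Qed.

(** Both series solve f' = al f in the variable x: the partial sums do so up to a multiple of y^N.
    Multiplication by e^{- al x} then leaves a constant, read off at x = 0. *)
Lemma binomial_series (al : K) : pe (pspow (@psy K) al) = lE al.
Proof.
set f := pe _; have hF N : lord N%:Z (f - \sum_(j < N) gbinom al j *: y ^+ j).
  by have := @lord_pspow K N (@psy K) al erefl; rewrite pe_psy.
have hD N : lder (\sum_(j < N.+1) gbinom al j *: y ^+ j) =
    al *: (\sum_(j < N.+1) gbinom al j *: y ^+ j) - (N.+1%:R * gbinom al N.+1) *: y ^+ N.
  elim: N => [|N IH].
    rewrite !big_ord_recl !big_ord0 gbinomS gbinom0 !addr0 expr0 scale1r lder1 subr0 mulr1.
    by rewrite subrr.
  rewrite big_ord_recr lderD IH /= lderZ lder_yX lE1y.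
  rewrite (gbinomS al N.+1) !lscale_in_alg exprS; ring.
have d0 : lder f = al *: f.
  apply: lord_eq => N.
  apply: lord_trans (_ : lord N%:Z (lder f - lder (\sum_(j < N.+1) gbinom al j *: y ^+ j))) _.
    by rewrite -raddfB; have := lord_lder (hF N.+1); rewrite (_ : N.+1%:Z - 1 = N) //; lia.
  rewrite hD -addrA -opprD [X in _ - X]addrC opprD addrA -scalerBr; apply: lordD.
    by apply: lordZ; apply: lord_sym; apply: (lordW _ (hF N.+1)); lia.
  by apply: lordN; apply: lordZ; apply: lord_yX.
have h : f * lE (- al) = 1.
  have e : lder (f * lE (- al)) = 0.
    by rewrite lderM d0 lderE -scalerAl -scalerAr scaleNr subrr.
  rewrite (lder_eq0 e); have := lordM_co (@lord_pe0 K _ : lord 0 f) (@lord_E K (- al)).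
  rewrite addr0 => ->; rewrite (lcoE _ 0) expr0 divr1 mulr1.
  have := hF 1%N 0; rewrite lcoB big_ord_recl big_ord0 gbinom0 expr0 scale1r addr0 lco1 => h1.
  have /eqP : f 0 - 1 = 0 by apply: h1.
  by rewrite subr_eq0 => /eqP ->; rewrite scale1r.
by rewrite -[f]mulr1 -lE0 -(addNr al) lED mulrA h mul1r.
Qed.

(** The left-hand side is log(1 + y), whose x-derivative is 1 because e^x = 1 + y turns the
    differentiated partial sums into a geometric series. Both sides have order at least 1, so no
    constant remains. *)
Lemma log_series : y * (1 + pe (@pslogm1 K)) = lmon K 1.
Proof.
set f := pe _.
pose s N : L := \sum_(n < N) ((-1) ^+ n / n.+1%:R) *: y ^+ n.
have hs N : lord N%:Z (1 + f - s N).
  case: N => [|N].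
    by rewrite /s big_ord0 subr0; apply: lordD; [apply: lord1|apply: lord_pe0].
  rewrite (_ : 1 + f - s N.+1 = f - (s N.+1 - 1)); last by ring.
  rewrite (_ : s N.+1 - 1 = yev N.+1 (@pslogm1 K)); first exact: lord_pe.
  rewrite /s /yev !big_ord_recl /pslogm1 /= !expr0 scale0r divr1 scale1r add0r addrC addrA.
  by rewrite addNr add0r.
have d1 : lder (y * (1 + f)) = 1.
  apply: lord_eq => N.
  apply: (lord_trans (g := lder (y * s N.+1))).
    rewrite -raddfB -mulrBr; have := lord_lder (lordM (@lord_y K) (hs N.+1)).
    by move=> h; apply: (lordW _ h); lia.
  have -> : lder (y * s N.+1) = 1 - (- y) ^+ N.+1.
    rewrite -[1 - _]opprB subrX1 -mulNr opprB opprK mulr_sumr raddf_sum /= mulr_sumr.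
    apply: eq_bigr => n _; rewrite -scalerAr -exprS lderZ lder_yX scalerA.
    by rewrite divfK ?pnatr_eq0 // lE1y [(- y) ^+ _]exprNn lscale_sign; ring.
  rewrite addrC addrA addNr add0r; apply: lordN; rewrite exprNn.
  rewrite -lscale_sign; apply: lordZ.
  by apply: (lordW _ (@lord_yX K N.+1)); lia.
apply/eqP; rewrite -subr_eq0; apply/eqP.
have e : lder (y * (1 + f) - lmon K 1) = 0.
  rewrite raddfB /= d1; apply: laurentP => i; rewrite lcoB lcoder lco1 lcomon lco0.
  have [->|ne] := eqVneq i 0; first by rewrite mul1r subrr.
  by rewrite (_ : (i + 1 == 1) = false) ?mulr0 ?subr0 //; lia.
rewrite (lder_eq0 e) lcoB lcomon subr0.
have := lordM (@lord_y K) (_ : lord 0 (1 + f)) => -> //; first by rewrite scale0r.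
by apply: lordD; [apply: lord1|apply: lord_pe0].
Qed.

(** Change of variables dy = e^x dx: the residue of e^x y^{n-q-1} vanishes unless n = q. *)
Lemma res_pe a q : lres (pe a * (lE 1 * y ^ (- q.+1%:Z))) = a q.
Proof.
rewrite -[pe a](subrK (yev q.+1 a)) mulrDl lresD [X in X + _]lres_ord ?add0r; last first.
  have := lordM (@lord_pe K q.+1 a) (lordM (@lord_E K 1) (@lord_yz K (- q.+1%:Z))).
  by rewrite add0r subrr.
rewrite /yev mulr_suml /lres lco_sum big_ord_recr /= big1 => [|n _].
  rewrite add0r -scalerAl lcoZ mulrCA exprnP -lyzD (_ : Posz q + - q.+1%:Z = - 1); last by lia.
  by rewrite -/(lres _) lres_E1yV mulr1.
rewrite -scalerAl lcoZ mulrCA exprnP -lyzD -/(lres _) lres_E1y ?mulr0 //.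
have := ltn_ord n; lia.
Qed.

Lemma lexpzMl (f g : L) n : f \is a GRing.unit -> g \is a GRing.unit ->
  (f * g) ^ n = f ^ n * g ^ n.
Proof.
move=> uf ug; case: n => n; first by rewrite -!exprnP exprMn.
by rewrite NegzE -!exprz_inv -!exprnP -exprMn invrM // mulrC.
Qed.

(* change of variables y = e^x - 1 in the residue defining resprod *)
Lemma rescoefE (al : K) (p : nat) (k : int) :
  rescoef al p k = (lE (al + 1) * y ^ (- p%:Z)) k.
Proof.
rewrite /rescoef; have [ge|lt] := leP 0 (p%:Z + k); last first.
  have := lordM (@lord_E K (al + 1)) (@lord_yz K (- p%:Z)).
  by rewrite add0r => ->//; lia.
have e0 : pslogm1 K 0%N = 0 by [].
have u : 1 + pe (@pslogm1 K) \is a GRing.unit.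
  have := lmon_unit K 1; rewrite -log_series unitrM => /andP[] //.
have e1 : 1 + pe (@pslogm1 K) = lmon K 1 * y ^ (- 1).
  by rewrite -log_series mulrAC lyV mul1r.
rewrite -res_pe peM binomial_series -mulrNz pe_pow_int // e1.
rewrite lexpzMl ?lmon_unit ?exprN1 ?unitrV ?ly_unit // -exprN1 exprz_exp.
have -> : lmon K 1 ^ (- (k + 1)) = lmon K (- (k + 1)).
  case: (- (k + 1)) => n; first by rewrite -exprnP lmonX natz.
  rewrite NegzE -exprz_inv -exprnP (_ : (lmon K 1)^-1 = lmon K (- 1)).
    by rewrite lmonX mulNrn natz.
  by apply: (mulrI (lmon_unit K 1)); rewrite mulrV ?lmon_unit // -lmonD subrr lmon0.
rewrite (_ : _ * _ = lmon K (- (k + 1)) * ((lE al * lE 1) *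
   (y ^ (-1 * - (k + 1)) * y ^ (- (absz (p%:Z + k)).+1%:Z)))); last by ring.
rewrite -lED -lyzD /lres lco_monM; congr (lco (_ * y ^ _) _); lia.
Qed.

End ResCoef.

(** * Triple residue pairings *)
Section Triple.
Variable K : numFieldType.
Variable M : lmodType K.
Local Notation L := (laurent K).
Local Notation X := (lmon K 1).
Implicit Types (h g : L) (q : int -> int -> int -> M).

(** The finiteness that makes pairing with three Laurent series meaningful: each region bounded
    below in all indices contains finitely many non-zero entries. *)
Definition abd3 q := forall l0 m0 n0 : int, exists N : int, forall l m n,
  l0 <= l -> m0 <= m -> n0 <= n -> (N <= l) || (N <= m) || (N <= n) -> q l m n = 0.

Definition tp q ka h1 h2 : M :=
  pr ka (fun l => pr h1 (fun m => pr h2 (fun n => q l m n))).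

Lemma ubd_tp3 q l m : abd3 q -> ubd (q l m).
Proof.
move=> a; have [N h] := a l m 0; exists (Num.max N 0) => n hn; apply: h => //; lia.
Qed.
Lemma ubd_tp2 q l h2 : abd3 q -> ubd (fun m => pr h2 (q l m)).
Proof.
move=> a; have [n0 hn0] := lord_exists h2; have [N h] := a l 0 n0.
by exists (Num.max N 0) => m hm; apply: (pr_ord hn0) => n hn; apply: h => //; lia.
Qed.
Lemma ubd_tp1 q h1 h2 : abd3 q -> ubd (fun l => pr h1 (fun m => pr h2 (q l m))).
Proof.
move=> a; have [m0 hm0] := lord_exists h1; have [n0 hn0] := lord_exists h2.
have [N h] := a 0 m0 n0; exists (Num.max N 0) => l hl.
apply: (pr_ord hm0) => m hm; apply: (pr_ord hn0) => n hn; apply: h => //; lia.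
Qed.

Lemma tp_lin1 q h1 h2 : abd3 q -> is_linear (fun ka => tp q ka h1 h2).
Proof. by move=> a; apply: pr_lin; apply: ubd_tp1. Qed.
Lemma tp_lin2 q ka h2 : abd3 q -> is_linear (fun h1 => tp q ka h1 h2).
Proof.
move=> a c x y; rewrite /tp -prZr; last exact: ubd_tp1.
rewrite -prDr; last exact: ubd_tp1.
  by apply: eq_pr => l; apply: pr_lin; apply: ubd_tp2.
by have [N h] := ubd_tp1 x h2 a; exists N => l /h ->; rewrite scaler0.
Qed.
Lemma tp_lin3 q ka h1 : abd3 q -> is_linear (fun h2 => tp q ka h1 h2).
Proof.
move=> a c x y; rewrite /tp -prZr; last exact: ubd_tp1.
rewrite -prDr; last exact: ubd_tp1.
  apply: eq_pr => l; rewrite -prZr; last exact: ubd_tp2.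
  rewrite -prDr; last exact: ubd_tp2.
    by apply: eq_pr => m; apply: pr_lin; apply: ubd_tp3.
  by have [N h] := ubd_tp2 l x a; exists N => m /h ->; rewrite scaler0.
by have [N h] := ubd_tp1 h1 x a; exists N => l /h ->; rewrite scaler0.
Qed.

Lemma tp_cont q (l0 m0 n0 : int) : abd3 q -> exists N : int, forall ka h1 h2,
  lord l0 ka -> lord m0 h1 -> lord n0 h2 -> lord N ka \/ lord N h1 \/ lord N h2 ->
  tp q ka h1 h2 = 0.
Proof.
move=> a; have [N h] := a l0 m0 n0; exists (Num.max (Num.max N l0) (Num.max m0 n0)).
move=> ka h1 h2 o1 o2 o3 [o|[o|o]].
- apply: (pr_ord o) => l hl; apply: (pr_ord o2) => m hm; apply: (pr_ord o3) => n hn.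
  by apply: h => //; lia.
- apply: (pr_ord o1) => l hl; apply: (pr_ord o) => m hm; apply: (pr_ord o3) => n hn.
  by apply: h => //; lia.
- apply: (pr_ord o1) => l hl; apply: (pr_ord o2) => m hm; apply: (pr_ord o) => n hn.
  by apply: h => //; lia.
Qed.

(** The relation x_0 = x_1 - x_2 for an array whose three indices belong to x_0, x_1, x_2. It holds
    for both orders of the product of Y(b,x_1) and Y(d,x_2). *)
Definition Srel q := forall l m n, q (l + 1) m n = q l (m + 1) n - q l m (n + 1).

Lemma tpX q ka h1 h2 : abd3 q -> Srel q ->
  tp q (X * ka) h1 h2 = tp q ka (X * h1) h2 - tp q ka h1 (X * h2).
Proof.
move=> a s; rewrite /tp pr_monM; last exact: ubd_tp1.
rewrite -prBr; try exact: ubd_tp1.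
apply: eq_pr => l; rewrite pr_monM; last exact: ubd_tp2.
rewrite -prBr; try exact: ubd_tp2; last first.
  have [N hN] := ubd_tp2 l h2 a; exists (N - 1) => m hm; apply: hN; lia.
apply: eq_pr => m; rewrite pr_monM; last exact: ubd_tp3.
rewrite -prBr; try exact: ubd_tp3; last first.
  have [N hN] := ubd_tp3 l m a; exists (N - 1) => n hn; apply: hN; lia.
by apply: eq_pr => n; rewrite s.
Qed.

Lemma lE_trunc al (N : nat) :
  exists2 r, lE al = \sum_(n < N) (al ^+ n / (n`!)%:R) *: lmon K n%:Z + r & lord N%:Z r.
Proof.
exists (lE al - \sum_(n < N) (al ^+ n / (n`!)%:R) *: lmon K n%:Z); first by rewrite addrC subrK.
move=> [i|i] hi; rewrite lcoB lco_sum.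
  have hi' : (i < N)%N by lia.
  rewrite (bigD1 (Ordinal hi')) //= lcoZ lcomon eqxx mulr1 lcoE big1 ?addr0 ?subrr // => j hj.
  rewrite lcoZ lcomon (_ : (i%:Z == j%:Z) = false) ?mulr0 //.
  by apply/negbTE; apply: contra hj => /eqP [e]; apply/eqP/val_inj.
rewrite lord_E // big1 ?subrr // => j _; rewrite lcoZ lcomon (_ : (_ == _) = false) ?mulr0 //.
Qed.

Lemma sum_triangle (N : nat) (F : nat -> nat -> M) :
  (forall a b, (N <= a + b)%N -> F a b = 0) ->
  \sum_(a < N) \sum_(b < N) F a b = \sum_(n < N) \sum_(r < n.+1) F (n - r)%N r.
Proof.
move=> h; rewrite exchange_big /=.
transitivity (\sum_(b < N) \sum_(n < N | (b <= n)%N) F (n - b)%N b).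
  apply: eq_bigr => b _; have hb := ltn_ord b.
  rewrite -(big_mkord xpredT (fun a => F a b)) (@big_cat_nat _ _ _ (N - b)) /=; try lia.
  rewrite [X in _ + X]big_nat_cond [X in _ + X]big1 ?addr0 => [|a]; last first.
    by move=> ha; apply: h; lia.
  transitivity (\sum_(b <= n < N) F (n - b)%N b); last by rewrite big_geq_mkord.
  rewrite -[X in \sum_(X <= _ < _) F (_ - _)%N b]add0n big_addn.
  by apply: eq_bigr => a _; rewrite addnK.
rewrite (exchange_big_dep xpredT) //=; apply: eq_bigr => n _.
rewrite -(big_mkord (fun b => (b <= n)%N) (fun b => F (n - b)%N b)).
have hn := ltn_ord n.
rewrite (@big_cat_nat _ _ _ n.+1) //=.
rewrite [X in _ + X]big_nat_cond [X in _ + X]big1 ?addr0 => [|b]; last by lia.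
rewrite big_mkord; apply: eq_bigl => b; have := ltn_ord b; lia.
Qed.

(* e^{x_1} = e^{x_1 - x_2} e^{x_2} *)
Lemma tpE q ka h1 h2 : abd3 q -> Srel q ->
  tp q (lE 1 * ka) h1 h2 = tp q ka (lE 1 * h1) (lE (- 1) * h2).
Proof.
move=> a s.
pose Lam g := tp q (g * ka) h1 h2; pose Ga g1 g2 := tp q ka (g1 * h1) (g2 * h2).
have LamL : is_linear Lam.
  by move=> c x y; rewrite /Lam mulrDl -scalerAl (tp_lin1 _ _ a).
have GaL1 g2 : is_linear (fun g1 => Ga g1 g2).
  by move=> c x y; rewrite /Ga mulrDl -scalerAl (tp_lin2 _ _ a).
have GaL2 g1 : is_linear (Ga g1).
  by move=> c x y; rewrite /Ga mulrDl -scalerAl (tp_lin3 _ _ a).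
have [l0 hl0] := lord_exists ka; have [m0 hm0] := lord_exists h1.
have [n0 hn0] := lord_exists h2; have [I hI] := tp_cont l0 m0 n0 a.
pose I' := (absz I + absz l0 + absz m0 + absz n0)%N.
have Lam0 g : lord I'%:Z g -> Lam g = 0.
  move=> hg; apply: hI => //; last by left; apply: (lordW _ (lordM hg hl0)); lia.
  by apply: (lordW _ (lordM hg hl0)); lia.
have Ga0 g1 g2 : lord 0 g1 -> lord 0 g2 -> lord I'%:Z g1 \/ lord I'%:Z g2 -> Ga g1 g2 = 0.
  move=> o1 o2 o; apply: hI => //.
  - by apply: (lordW _ (lordM o1 hm0)); lia.
  - by apply: (lordW _ (lordM o2 hn0)); lia.
  - right; case: o => o; [left|right].
      by apply: (lordW _ (lordM o hm0)); lia.
    by apply: (lordW _ (lordM o hn0)); lia.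
have Lmon (n : nat) : Lam (lmon K n%:Z) =
    \sum_(r < n.+1) ('C(n, r)%:R * (-1) ^+ r) *: Ga (lmon K (n - r)%N%:Z) (lmon K r%:Z).
  have mX (k : nat) g : lmon K k%:Z * (X * g) = lmon K k.+1%:Z * g.
    by rewrite mulrA -lmonD (_ : Posz k + 1 = k.+1) //; lia.
  have gen (i : nat) : forall g1 g2 h, tp q (lmon K i%:Z * h) (g1 * h1) (g2 * h2) =
      \sum_(r < i.+1) ('C(i, r)%:R * (-1) ^+ r) *:
         tp q h (lmon K (i - r)%N%:Z * g1 * h1) (lmon K r%:Z * g2 * h2).
    elim: i => [|i IH] g1 g2 h.
      by rewrite big_ord1 bin0 mul1r expr0 scale1r !lmon0 !mul1r.
    have e1 : Posz i.+1 = 1 + i%:Z by lia.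
    rewrite {1}e1 lmonD -mulrA tpX //.
    rewrite ![X * (_ * _)]mulrA !IH.
    under eq_bigr do rewrite mX; under [X in _ - X]eq_bigr do rewrite mX.
    rewrite big_ord_recl [RHS]big_ord_recl.
    rewrite [X in _ - X]big_ord_recr [X in _ = _ + X]big_ord_recr /= !bin0 !binn !expr0.
    rewrite opprD addrA -[LHS]addrA -[in LHS]addrA; congr (_ + _); first by rewrite !subn0.
    rewrite addrA; congr (_ + _); last first.
      by rewrite subnn /bump /= add1n !mul1r exprS mulN1r scaleNr !subnn.
    rewrite -sumrB; apply: eq_bigr => r _; rewrite /bump /= !add1n.
    have hr := ltn_ord r; rewrite subnSK // subSS binS natrD mulrDl scalerDl; congr (_ + _).
    by rewrite exprS mulN1r mulrN scaleNr.
  rewrite /Lam; have := gen n 1 1 ka; rewrite !mul1r => ->; apply: eq_bigr => r _.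
  by rewrite /Ga !mulr1.
(* With N = 2 I', a pair of exponents with a + b >= N has a >= I' or b >= I', so its term vanishes
   and the double sum lives on the triangle a + b < N. *)
pose N := (I' + I')%N.
have [r1 e1 o1] := lE_trunc 1 N; have [r2 e2 o2] := lE_trunc (- 1) N.
have om (n : nat) : lord 0 (lmon K n%:Z).
  by apply: (lordW _ (@lord_mon _ n%:Z)).
have IN : (I' <= N)%N by rewrite /N; lia.
transitivity (Lam (lE 1)) => //; transitivity (Ga (lE 1) (lE (- 1))) => //.
rewrite {1}e1 (is_linearD LamL) (Lam0 r1) ?addr0; last by apply: (lordW _ o1); lia.
rewrite (is_linear_sum LamL) e1 (is_linearD (GaL1 _)).
rewrite [X in _ = _ + X]Ga0 ?addr0; first last.
- by left; apply: (lordW _ o1); lia.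
- exact: lord_E.
- by apply: (lordW _ o1); lia.
rewrite (is_linear_sum (GaL1 _)).
pose F a b := ((1 ^+ a / (a`!)%:R) * ((-1) ^+ b / (b`!)%:R)) *: Ga (lmon K a%:Z) (lmon K b%:Z).
transitivity (\sum_(a < N) \sum_(b < N) F a b); last first.
  apply: eq_bigr => a' _; rewrite (is_linearZ (GaL1 _)) e2 (is_linearD (GaL2 _)).
  rewrite [X in _ + X]Ga0 ?addr0; first last.
  - by right; apply: (lordW _ o2); lia.
  - by apply: (lordW _ o2); lia.
  - exact: om.
  rewrite (is_linear_sum (GaL2 _)) scaler_sumr; apply: eq_bigr => b _.
  by rewrite (is_linearZ (GaL2 _)) scalerA.
rewrite sum_triangle => [|a' b hab]; last first.
  rewrite /F Ga0 ?scaler0 //; have [ha|ha] := leqP I' a'.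
    by left; apply: (lordW _ (@lord_mon _ a'%:Z)); lia.
  by right; apply: (lordW _ (@lord_mon _ b%:Z)); rewrite /N in hab; lia.
apply: eq_bigr => n _; rewrite (is_linearZ LamL) Lmon scaler_sumr; apply: eq_bigr => r _.
rewrite /F scalerA; congr (_ *: _); rewrite !expr1n !mul1r.
have <- : ('C(n, r) * (r`! * (n - r)`!))%:R = (n`!)%:R :> K by rewrite bin_fact // -ltnS.
have h0 : ('C(n, r))%:R != 0 :> K by rewrite pnatr_eq0 -lt0n bin_gt0 -ltnS.
rewrite !natrM; have h1' := fact_neq0 K r; have h2' := fact_neq0 K (n - r).
by field; rewrite h0 h1' h2'.
Qed.

(* inverts multiplication by z_1 - z_2 on bilinear residue functionals *)
Definition Xf q h1 h2 := tp q (ly K ^ (- 1)) h1 (lE (- 1) * h2).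

(** By [tpE], multiplication by e^{x_1} - e^{x_2} becomes e^{x_2} (e^{x_1 - x_2} - 1), which cancels
    the kernel y^{-1} and the factor e^{-x_2} of [Xf]. *)
Lemma XfP q h1 h2 : abd3 q -> Srel q ->
  Xf q (lE 1 * h1) h2 - Xf q h1 (lE 1 * h2) = pr h1 (fun m => pr h2 (q 0 m)).
Proof.
move=> a s; rewrite /Xf -tpE // mulrA -lED addNr lE0 mul1r.
rewrite lE1y mulrDl mul1r (is_linearD (tp_lin1 _ _ a)) addrC addrA addNr add0r.
by rewrite lyV -lmon0 /tp pr_mon.
Qed.

Lemma Xf_lin1 q h2 : abd3 q -> is_linear (fun h1 => Xf q h1 h2).
Proof. exact: tp_lin2. Qed.
Lemma Xf_lin2 q h1 : abd3 q -> is_linear (Xf q h1).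
Proof. by move=> a c x y; rewrite /Xf mulrDr -scalerAr (tp_lin3 _ _ a). Qed.

Lemma Xf_y q h1 h2 : abd3 q -> Srel q ->
  Xf q (ly K * h1) h2 = Xf q h1 (ly K * h2) + pr h1 (fun m => pr h2 (q 0 m)).
Proof.
have e g : lE 1 * g = g + ly K * g by rewrite lE1y [(1 + _) * _]mulrDl mul1r.
move=> a s; rewrite -(XfP _ _ a s) !e.
rewrite (is_linearD (Xf_lin1 _ a)) (is_linearD (Xf_lin2 _ a)).
by rewrite opprD addrACA subrr add0r addrCA subrr addr0.
Qed.

End Triple.

(** * Binomial series and iterated derivatives *)

Section BinomialSeries.
Variable K : numFieldType.
Local Notation L := (laurent K).
Local Notation X := (lmon K 1).

Definition lbin_f (c : K) (n i : int) : K :=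
  if 0 <= i then c ^+ absz i * gbinom (n%:~R) (absz i) else 0.
Lemma lbin_bd c n : lbounded (lbin_f c n).
Proof. by exists 0 => i hi; rewrite /lbin_f lt_geF. Qed.
(* (1 + c x)^n *)
Definition lbin c n : L := Laurent (lbin_bd c n).

Lemma lcobin c n i : lbin c n i = if 0 <= i then c ^+ absz i * gbinom (n%:~R) (absz i) else 0.
Proof. by []. Qed.
Lemma lord_bin c n : lord 0 (lbin c n).
Proof. by move=> i hi; rewrite lcobin lt_geF. Qed.
Lemma lbin0 c : lbin c 0 = 1.
Proof.
apply: laurentP => i; rewrite lcobin lco1; case: i => [[|i]|i] //=.
  by rewrite gbinom0 mulr1.
by rewrite -[0%:~R]/(0%:R) gbinom_nat bin0n mulr0.
Qed.
Lemma lbinS c n : lbin c (n + 1) = lbin c n + c *: (X * lbin c n).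
Proof.
apply: laurentP => i; rewrite lcoD lcoZ lco_monM !lcobin intrD.
case: i => [[|i]|i]; first by rewrite /= !gbinom0 mulr0 addr0.
- have -> : Posz i.+1 - 1 = i by lia.
  by rewrite /= gbinom_pascal exprS; ring.
- by rewrite [0 <= Negz i - 1](_ : _ = false) ?mulr0 ?addr0 //; lia.
Qed.
Lemma gbinomN2 j : (-1) ^+ j * gbinom (- 2%:R : K) j = j.+1%:R.
Proof.
elim: j => [|j IH]; first by rewrite gbinom0 mulr1.
have hn : j.+1%:R != 0 :> K by rewrite pnatr_eq0.
apply: (mulfI hn); rewrite mulrCA gbinomS exprS.
transitivity ((2%:R + j%:R) * ((-1) ^+ j * gbinom (- 2%:R : K) j)); first by ring.
rewrite IH -!natr1; ring.
Qed.

Lemma iter_lder (i : nat) (h : L) n :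
  iter i (@lder K) h n = (i`!)%:R * (lbin 1 (n + i%:Z) i%:Z * h (n + i%:Z)).
Proof.
elim: i n => [|i IH] n /=.
  by rewrite addr0 lcobin /= expr0 gbinom0 !mul1r.
rewrite lcoder IH !lcobin /= !expr1n !mul1r factS natrM.
rewrite (_ : n + 1 + Posz i = n + i.+1%:Z); last by lia.
set m := n + i.+1%:Z; have gS := gbinomS (m%:~R : K) i.
have em : m%:~R - i%:R = (n + 1)%:~R :> K.
  by rewrite -[i%:R]/(i%:Z%:~R) -intrB; congr (_%:~R); rewrite /m; lia.
transitivity ((i`!)%:R * h m * ((n + 1)%:~R * gbinom (m%:~R : K) i)); first by ring.
by rewrite -em -gS; ring.
Qed.

Lemma pr_sig (M : lmodType K) (h : L) (phi : int -> M) :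
  pr h (fun l => (-1) ^ l *: phi l) = pr (lsig h) phi.
Proof. by apply: eq_zsum => l; rewrite scalerA lco_sig mulrC. Qed.

End BinomialSeries.

Lemma exchange_pr (K : numFieldType) (M : lmodType K) (h g : laurent K)
  (phi : int -> int -> M) :
  (forall a0 b0 : int, exists N : int, forall a b, a0 <= a -> b0 <= b ->
     (N <= a) || (N <= b) -> phi a b = 0) ->
  pr h (fun a => pr g (phi a)) = pr g (fun b => pr h (phi^~ b)).
Proof.
move=> H; have [a0 ha] := lord_exists h; have [b0 hb] := lord_exists g.
have [N hN] := H a0 b0.
have ub a : a0 <= a -> ubd (phi a).
  move=> le; exists (Num.max N b0) => b hb'; apply: hN => //; lia.
have ua b : b0 <= b -> ubd (phi ^~ b).
  move=> le; exists (Num.max N a0) => a ha'; apply: hN => //; lia.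
transitivity (zsum (fun a => zsum (fun b => (h a * g b) *: phi a b))).
  apply: eq_zsum => a; have [lt|le] := ltP a a0.
    by rewrite ha // scale0r zsum0 // => b; rewrite mul0r scale0r.
  rewrite /pr (zsum_raddf (g := fun x => h a *: x)) ?scaler0 //.
  - by apply: eq_zsum => b; rewrite scalerA.
  - by move=> x y; rewrite scalerDr.
  - exact/pr_fin/ub.
rewrite exchange_zsum.
  apply: eq_zsum => b; have [lt|le] := ltP b b0.
    by rewrite hb // scale0r zsum0 // => a; rewrite mulr0 scale0r.
  rewrite /pr (zsum_raddf (g := fun x => g b *: x)) ?scaler0 //.
  - by apply: eq_zsum => a; rewrite scalerA mulrC.
  - by move=> x y; rewrite scalerDr.
  - exact/pr_fin/ua.
exists (absz N + absz a0 + absz b0)%N.+1 => a b hab.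
have [lt|le] := ltP a a0; first by rewrite ha // mul0r scale0r.
have [lt'|le'] := ltP b b0; first by rewrite hb // mulr0 scale0r.
by rewrite hN ?scaler0 //; lia.
Qed.

(** * Modes of a vertex algebra *)
Section VertexAlgebra.
Variable K : numFieldType.
Variable V : lmodType K.
Variable A : vertex_algebra V.
Local Notation L := (laurent K).
Local Notation X := (lmon K 1).
Local Notation vac := (vac A).
Local Notation D := (vaD A).
Implicit Types (b d u v : V) (h : L).
Local Notation mo := (vmode A).

Lemma ubd_vm b v : ubd (fun k => (mo b k v)).
Proof. exact: vmode_trunc. Qed.

Lemma vac_modeE k v : (mo vac k v) = if k == - 1 then v else 0.
Proof. exact: vac_mode. Qed.

Lemma vm0l k v : (mo (0 : V) k v) = 0. Proof. exact: is_linear0 (vmode_linl A k v). Qed.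
Lemma vm0r b k : (mo b k 0) = 0. Proof. exact: is_linear0 (vmode_linr A b k). Qed.

Lemma lbin_zsum (M : lmodType K) (c : K) n (phi : int -> M) :
  zsum (fun i : int => if 0 <= i then (c ^+ absz i * gbinom (n%:~R : K) (absz i)) *: phi i else 0)
  = pr (lbin c n) phi.
Proof. by apply: eq_zsum => i; rewrite lcobin; case: ifP => // _; rewrite scale0r. Qed.

(** Borcherds' identity with the vacuum as second vector and third index -2. At most one vacuum mode
    survives, according to the sign of l, and its coefficient comes from (-1)^j binom(-2,j) = j +
    1. *)
Lemma vaD_mode b l v : (mo (D b) l v) = (- l%:~R) *: (mo b (l - 1) v).
Proof.
have := borcherds A b vac v 0 l (- 2).
rewrite (zsum1 (j := 0)); last first.
  move=> i hi; case: ifP => // ge; rewrite -[0%:~R]/(0%:R) gbinom_nat bin0n.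
  by rewrite (_ : (absz i == 0%N) = false) ?scale0r //; lia.
rewrite /= gbinom0 scale1r ?addr0 ?add0r ?subr0 => ->.
under eq_zsum do rewrite !vac_modeE.
have e2 j : (-1) ^+ j * gbinom ((-2)%:~R : K) j = j.+1%:R.
  by rewrite -gbinomN2; congr (_ * gbinom _ _); rewrite mulrNz.
have [lt|ge] := ltP l 0.
  rewrite (zsum1 (j := - 1 - l)) => [|i hi].
    have -> : (0 <= -1 - l) = true by lia.
    have -> : (l + (-1 - l) == -1) = true by lia.
    rewrite (_ : (l + -2 - (-1 - l) == -1) = false); last by lia.
    rewrite e2 scaler0 subr0; congr (_ *: _); last by congr (vmode _ _ _ _); lia.
    by rewrite -[_.+1%:R]/(_.+1%:Z%:~R) -mulrNz; congr (_%:~R); lia.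
  case: ifP => // ge.
  rewrite (_ : (l + i == -1) = false); last by lia.
  rewrite (_ : (l + -2 - i == -1) = false); last by lia.
  by rewrite vm0r scaler0 subr0 scaler0.
have [->|ne] := eqVneq l 0.
  rewrite oppr0 scale0r zsum0 // => i; case: ifP => // ge'.
  rewrite (_ : (0 + i == -1) = false); last by lia.
  rewrite (_ : (0 + -2 - i == -1) = false); last by lia.
  by rewrite vm0r scaler0 subr0 scaler0.
rewrite (zsum1 (j := l - 1)) => [|i hi].
  have -> : (0 <= l - 1) = true by lia.
    have -> : (l + -2 - (l - 1) == -1) = true by lia.
  rewrite (_ : (l + (l - 1) == -1) = false); last by lia.
  rewrite e2 vm0r sub0r /= sqrrN expr1n scale1r add0r scalerN -scaleNr.
  congr (_ *: _); rewrite -[_.+1%:R]/(_.+1%:Z%:~R) -mulrNz -mulrNz; congr (_%:~R); lia.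
case: ifP => // ge'.
rewrite (_ : (l + i == -1) = false); last by lia.
rewrite (_ : (l + -2 - i == -1) = false); last by lia.
by rewrite vm0r scaler0 subr0 scaler0.
Qed.

Lemma vaD_cr c (i : nat) : (mo (D c) (-1 - i%:Z) vac) = i.+1%:R *: (mo c (-1 - i.+1%:Z) vac).
Proof.
rewrite vaD_mode; congr (_ *: _); last by congr (vmode _ _ _ _); lia.
by rewrite -[_.+1%:R]/(_.+1%:Z%:~R) -mulrNz; congr (_%:~R); lia.
Qed.

Lemma vaD_vm b l v : D (mo b l v) = (mo (D b) l v) + (mo b l (D v)).
Proof.
have := borcherds A b v vac 0 (- 2) l.
rewrite (zsum1 (j := 0)); last first.
  move=> i hi; case: ifP => // ge; rewrite -[0%:~R]/(0%:R) gbinom_nat bin0n.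
  by rewrite (_ : (absz i == 0%N) = false) ?scale0r //; lia.
rewrite /= gbinom0 scale1r ?addr0 ?add0r => e; rewrite {1}/vaD e.
rewrite (@zsum_seq _ _ [:: 0; 1]) // => [|i].
  rewrite big_cons big_seq1 /= expr0 expr1 gbinom0 !mul1r !scale1r.
  rewrite !(creation_pos A b) // !vm0r !scaler0 !subr0 ?addr0 ?add0r.
  rewrite (_ : -2 + 1 = -1) // creation_m1 vaD_mode addrC; congr (_ *: _ + _).
  have := gbinomS (l%:~R : K) 0; rewrite gbinom0 mul1r mulr1 subr0 => ->; ring.
apply: contraR; rewrite !inE => hi; case: ifP => // ge.
rewrite (creation_pos A v) ?(creation_pos A b) ?vm0r ?scaler0 ?subr0 ?scaler0 //; lia.
Qed.

(** Borcherds' identity on the vacuum with m = -1 and n = 0: creation leaves only the term i = 0 on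
    the right. *)
Lemma skew_symmetry b d l : (mo d l b) =
  - ((-1) ^ l *: zsum (fun i : int => if 0 <= i then
       (-1) ^+ absz i *: (mo (mo b (l + i) d) (-1 - i) vac) else 0)).
Proof.
have := borcherds A b d vac (-1) 0 l.
have -> : zsum (fun i : int => if 0 <= i then gbinom ((-1)%:~R : K) (absz i) *:
    (mo (mo b (l + i) d) (-1 + 0 - i) vac) else 0) =
   zsum (fun i : int => if 0 <= i then (-1) ^+ absz i *: (mo (mo b (l + i) d) (-1 - i) vac) else 0).
  by apply: eq_zsum => i; rewrite mulrN1z gbinomN1 addr0.
move=> ->; rewrite (zsum1 (j := 0)) => [|i hi].
  rewrite /= expr0 gbinom0 mul1r scale1r subr0 addr0 add0r creation_m1.
  rewrite creation_pos // vm0r sub0r scalerN opprK scalerA.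
  have -> : (-1) ^+ absz l = (-1) ^ l :> K.
    by case: l => l //; rewrite NegzE -exprz_inv invrN1 abszN.
  by rewrite -expfzMl mulrNN mulr1 exp1rz scale1r subr0.
case: ifP => // ge; rewrite !creation_pos ?vm0r ?scaler0 ?subr0 ?scaler0 //; lia.
Qed.

(** Skew-symmetry Y(d,x)b = e^{xD} Y(b,-x)d, seen by a functional on which e^{xD} acts as e^{mu x}.
    The substitution x -> -x produces [lsig], the factor e^{- mu x} and the sign of the residue. *)
Lemma skew_pr (N : lmodType K) (f : V -> N) (mu : K) b d h : is_linear f ->
  (forall c (i : nat), f (mo c (-1 - i%:Z) vac) = (mu ^+ i / (i`!)%:R) *: f c) ->
  pr h (fun l => f (mo d l b)) = - pr (lsig h * lE (- mu)) (fun l => f (mo b l d)).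
Proof.
move=> hf hmu.
have uf : ubd (fun l => f (mo b l d)).
  have [N0 h0] := ubd_vm b d; exists N0 => l hl; rewrite h0 //; exact: is_linear0 hf.
rewrite -pr_mul // -pr_sig /pr -scaleN1r (zsum_raddf (g := fun x => (-1 : K) *: x)).
- apply: eq_zsum => l; rewrite skew_symmetry (is_linearN hf) (is_linearZ hf) scaleN1r scalerN.
  congr (- (_ *: (_ *: _))).
  have [N0 h0] := ubd_vm b d.
  rewrite (is_linear_zsum hf); last first.
    exists (absz N0 + absz l)%N => i hi; case: ifP => // ge.
    by rewrite h0 ?vm0l ?scaler0 //; lia.
  apply: eq_zsum => i; case: i => i /=; last first.
    by rewrite lord_E // scale0r; exact: is_linear0 hf.
  rewrite (is_linearZ hf) hmu scalerA lcoE [(- mu) ^+ _]exprNn; congr (_ *: _); ring.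
- by rewrite scaler0.
- by move=> x y; rewrite scalerDr.
- apply: pr_fin; have [N0 h0] := uf; exists N0 => l hl.
  rewrite -/(pr _ _) (pr_ord (@lord_E K _)) ?scaler0 // => c hc; apply: h0; lia.
Qed.

End VertexAlgebra.

Lemma unif_bound (P : int -> int -> Prop) :
  (forall j, exists I : int, forall k, I <= k -> P j k) ->
  forall a c : int, exists I : int, forall j k, a <= j -> j < c -> I <= k -> P j k.
Proof.
move=> h a c; suff H (n : nat) : exists I : int, forall j k,
    a <= j -> j < a + n%:Z -> I <= k -> P j k.
  by have [I hI] := H (absz (c - a)); exists I => j k h1 h2; apply: hI => //; lia.
elim: n => [|n [I hI]]; first by exists 0 => j k h1 h2; lia.
have [I' hI'] := h (a + n%:Z); exists (Num.max I I') => j k h1 h2 h3.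
have [->|ne] := eqVneq j (a + n%:Z); first by apply: hI'; lia.
by apply: hI => //; lia.
Qed.

Lemma signz (K : fieldType) (l : int) : (-1) ^+ absz l = (-1) ^ l :> K.
Proof. by case: l => l //; rewrite NegzE -exprz_inv invrN1 abszN. Qed.

Lemma is_linear_sub (K : fieldType) (U W : lmodType K) (f g : U -> W) :
  is_linear f -> is_linear g -> is_linear (fun x => f x - g x).
Proof. by move=> hf hg a x y; rewrite hf hg scalerBr opprD addrACA. Qed.

(** * The Jacobi identity of V tested against Laurent series *)

Section Jacobi.
Variable K : numFieldType.
Variable V : lmodType K.
Variable A : vertex_algebra V.
Local Notation L := (laurent K).
Local Notation vac := (vac A).
Local Notation D := (vaD A).
Local Notation mo := (vmode A).
Implicit Types (b d u v : V) (h : L).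

Definition vm b h v : V := pr h (fun l => mo b l v).

Lemma vm_linh b v : is_linear (fun h => vm b h v).
Proof. by apply: pr_lin; apply: ubd_vm. Qed.
Lemma vm_linb h v : is_linear (fun b => vm b h v).
Proof.
move=> a x y; rewrite /vm -prZr; last exact: ubd_vm.
rewrite -prDr; [|by have [N hN] := ubd_vm A x v; exists N => l /hN ->; rewrite scaler0|exact: ubd_vm].
by apply: eq_pr => l; exact: (vmode_linl A).
Qed.
Lemma vm_linv b h : is_linear (vm b h).
Proof.
move=> a x y; rewrite /vm -prZr; last exact: ubd_vm.
rewrite -prDr; [|by have [N hN] := ubd_vm A b x; exists N => l /hN ->; rewrite scaler0|exact: ubd_vm].
by apply: eq_pr => l; exact: (vmode_linr A).
Qed.
Lemma vm_ord b v : exists N : int, forall h, lord N h -> vm b h v = 0.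
Proof. by have [N hN] := ubd_vm A b v; exists N => h hh; apply: pr_ord hh hN. Qed.
Lemma vm_lmon b n v : vm b (lmon K n) v = mo b n v.
Proof. exact: pr_mon. Qed.

Lemma vm_D b h v : vm (D b) h v = - vm b (lder h) v.
Proof.
have [N hN] := vm_ord b v; have [N' hN'] := vm_ord (D b) v.
apply/eqP; rewrite -subr_eq0 opprK; apply/eqP.
apply: (@cont_ext _ _ (fun h => vm (D b) h v + vm b (lder h) v) (Num.max (N + 1) N')).
- move=> a x y; rewrite (vm_linh (D b) v) linearP (vm_linh b v) scalerDr.
  by rewrite addrACA.
- move=> g hg; rewrite hN' ?hN ?addr0 //; last by apply: (lordW _ hg); lia.
  by apply: (lordW _ (lord_lder hg)); lia.
- move=> n; rewrite vm_lmon vaD_mode.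
  have -> : lder (lmon K n) = n%:~R *: lmon K (n - 1).
    apply: laurentP => i; rewrite lcoder lcoZ !lcomon.
    have [->|ne] := eqVneq i (n - 1); first by rewrite subrK eqxx !mulr1.
    by rewrite (_ : (i + 1 == n) = false) ?mulr0 //; lia.
  by rewrite (is_linearZ (vm_linh b v)) vm_lmon -scalerDl addNr scale0r.
Qed.

Lemma vaD_lin : is_linear D.
Proof. exact: (vmode_linl A). Qed.

Lemma D_vm b h v : D (vm b h v) = vm (D b) h v + vm b h (D v).
Proof.
rewrite /vm (pr_raddf _ vaD_lin) -?prDr; try exact: ubd_vm.
by apply: eq_pr => l; rewrite vaD_vm.
Qed.

Lemma vac_vm h v : vm vac h v = lres h *: v.
Proof.
rewrite /vm /pr (zsum1 (j := -1)) ?vac_mode //= => i hi.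
by rewrite vac_mode (negbTE hi) scaler0.
Qed.

Section Families.
Variable N : lmodType K.
Variable f : V -> N.
Hypothesis hf : is_linear f.
Variable u : V.

(** [q12], [q21] and [q0] are the three terms of the Jacobi identity paired with x_0^l x_1^m x_2^n
    and seen through f: the two orders of the product, with (x_1 - x_2)^l expanded accordingly, and
    the iterate. *)
Definition q12 b d (l m n : int) : N :=
  pr (lbin (-1 : K) l) (fun i => f (mo b (m + l - i) (mo d (n + i) u))).
Definition q21 b d (l m n : int) : N := (-1) ^ l *: q12 d b l n m.
Definition q0 b d (l m n : int) : N :=
  pr (lbin (1 : K) m) (fun i => f (mo (mo b (l + i) d) (m + n - i) u)).

Lemma q12_ubd b d l m n : ubd (fun i => f (mo b (m + l - i) (mo d (n + i) u))).
Proof.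
have [J hJ] := ubd_vm A d u; exists (J - n) => i hi.
by rewrite hJ ?vm0r ?(is_linear0 hf) //; lia.
Qed.

Lemma q12_n b d : exists J : int, forall l m n, J <= n -> q12 b d l m n = 0.
Proof.
have [J hJ] := ubd_vm A d u; exists J => l m n hn; apply: (pr_ord (lord_bin _ _)) => i hi.
by rewrite hJ ?vm0r ?(is_linear0 hf) //; lia.
Qed.
Lemma q21_m b d : exists J : int, forall l m n, J <= m -> q21 b d l m n = 0.
Proof.
by have [J hJ] := q12_n d b; exists J => l m n hm; rewrite /q21 hJ ?scaler0.
Qed.

Lemma q12_abd b d : abd3 (q12 b d).
Proof.
move=> l0 m0 n0; have [J hJ] := ubd_vm A d u.
have [I hI] := unif_bound (fun j => ubd_vm A b (mo d j u)) n0 J.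
exists (absz J + absz I + absz l0 + absz m0 + absz n0)%N.+1 => l m n hl hm hn h.
apply: (pr_ord (lord_bin _ _)) => i hi.
have [le|lt] := leP J (n + i); first by rewrite hJ ?vm0r ?(is_linear0 hf).
by rewrite hI ?(is_linear0 hf) //; lia.
Qed.
Lemma q21_abd b d : abd3 (q21 b d).
Proof.
move=> l0 m0 n0; have [I h] := q12_abd d b l0 n0 m0; exists I => l m n h1 h2 h3 h4.
by rewrite /q21 h ?scaler0 //; lia.
Qed.

Lemma q12_S b d : Srel (q12 b d).
Proof.
move=> l m n; rewrite /q12 lbinS prDl; last exact: q12_ubd.
rewrite prZl; last exact: q12_ubd.
rewrite pr_monM; last exact: q12_ubd.
rewrite scaleN1r; congr (_ - _); apply: eq_pr => i.
  by congr (f (mo b _ _)); lia.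
by congr (f (mo b _ (mo d _ _))); lia.
Qed.
Lemma q21_S b d : Srel (q21 b d).
Proof.
move=> l m n; rewrite /q21 q12_S expfzDr ?oppr_eq0 ?oner_eq0 // expr1z mulrN1 scaleNr.
by rewrite -scalerN opprB scalerBr.
Qed.

Lemma borcherdsE b d l m n : q12 b d l m n - q21 b d l m n = q0 b d l m n.
Proof.
rewrite /q0; have u1 : ubd (fun i => mo (mo b (l + i) d) (m + n - i) u).
  by have [J hJ] := ubd_vm A b d; exists (J - l) => i hi; rewrite hJ ?vm0l //; lia.
rewrite -(pr_raddf _ hf) // -lbin_zsum.
under eq_zsum do rewrite expr1n mul1r.
rewrite borcherds lbin_zsum.
have u2 x y a c : ubd (fun i => mo x (a - i) (mo y (c + i) u)).
  by have [J hJ] := ubd_vm A y u; exists (J - c) => i hi; rewrite hJ ?vm0r //; lia.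
have u3 x y a c e : ubd (fun i => e *: mo x (a - i) (mo y (c + i) u)).
  by have [J hJ] := u2 x y a c; exists J => i /hJ ->; rewrite scaler0.
rewrite prBr // (is_linearB hf) !(pr_raddf _ hf) //; congr (_ - _).
rewrite /q21 /q12 -prZr; last exact: q12_ubd.
apply: eq_pr => i; rewrite (is_linearZ hf); congr (_ *: _).
by rewrite signz.
Qed.

Lemma tp_jacobi b d ka h1 h2 :
  tp (q12 b d) ka h1 h2 - tp (q21 b d) ka h1 h2 = tp (q0 b d) ka h1 h2.
Proof.
rewrite /tp -prBr; try by apply: ubd_tp1; [exact: q12_abd || exact: q21_abd].
apply: eq_pr => l; rewrite -prBr; try by apply: ubd_tp2; [exact: q12_abd || exact: q21_abd].
apply: eq_pr => m; rewrite -prBr; try by apply: ubd_tp3; [exact: q12_abd || exact: q21_abd].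
by apply: eq_pr => n; rewrite borcherdsE.
Qed.

Lemma pr_q12 b d h1 h2 : pr h1 (fun m => pr h2 (q12 b d 0 m)) = f (vm b h1 (vm d h2 u)).
Proof.
rewrite /vm (pr_raddf _ hf); last exact: ubd_vm.
apply: eq_pr => m.
rewrite (pr_raddf _ (vmode_linr A b m)); last exact: ubd_vm.
rewrite (pr_raddf _ hf); last first.
  by have [J hJ] := ubd_vm A d u; exists J => i /hJ ->; rewrite vm0r.
by apply: eq_pr => n; rewrite /q12 lbin0 -lmon0 pr_mon subr0 !addr0.
Qed.
Lemma pr_q21 b d h1 h2 : pr h1 (fun m => pr h2 (q21 b d 0 m)) = f (vm d h2 (vm b h1 u)).
Proof.
rewrite -pr_q12 exchange_pr; last first.
  move=> a0 b0; have [I hI] := q21_abd b d 0 a0 b0; exists I => m n h3 h4 h5.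
  by apply: hI => //; lia.
by apply: eq_pr => n; apply: eq_pr => m; rewrite /q21 expr0z scale1r.
Qed.

Lemma iter_lder_mon (i : nat) m :
  iter i (@lder K) (lmon K m) = ((i`!)%:R * lbin (1 : K) m i%:Z) *: lmon K (m - i%:Z).
Proof.
apply: laurentP => n; rewrite iter_lder lcoZ !lcomon mulrA.
have [->|ne] := eqVneq n (m - i%:Z); first by rewrite subrK eqxx !mulr1.
by rewrite (_ : (n + Posz i == m) = false) ?mulr0 //; lia.
Qed.
Lemma iter_lder_lin (i : nat) : is_linear (iter i (@lder K)).
Proof. by elim: i => [|i IH] a x y //=; rewrite IH linearP. Qed.
Lemma lord_iter_lder (i : nat) n h : lord n h -> lord (n - i%:Z) (iter i (@lder K) h).
Proof.
move=> hh; elim: i => [|i IH] /=; first by rewrite subr0.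
by apply: (lordW _ (lord_lder IH)); lia.
Qed.

(** Taylor's formula for h1(x_2 + x_0), which stops at I because higher modes of b kill d. It is
    checked on monomials h1 and extended by continuity. *)
Lemma q0_eval b d l h1 h2 (I : nat) : (forall k, l + I%:Z <= k -> mo b k d = 0) ->
  pr h1 (fun m => pr h2 (q0 b d l m)) =
  \sum_(i < I) ((i`!)%:R)^-1 *: f (vm (mo b (l + i%:Z) d) (iter i (@lder K) h1 * h2) u).
Proof.
move=> hI; apply/eqP; rewrite -subr_eq0; apply/eqP.
have [n0 hn0] := lord_exists h2.
have [J hJ] := unif_bound (fun j => ubd_vm A (mo b (l + j) d) u) 0 I%:Z.
pose q l m n := q12 b d l m n - q21 b d l m n.
have qq : q =2 q0 b d by move=> l' m'; apply: funext => n'; rewrite /q borcherdsE.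
have aq : abd3 q.
  move=> l0 m0 n0'; have [I1 h1'] := q12_abd b d l0 m0 n0'.
  have [I2 h2'] := q21_abd b d l0 m0 n0'; exists (Num.max I1 I2) => l' m n a1 a2 a3 a4.
  by rewrite /q h1' ?h2' ?subrr //; lia.
have uq : ubd (fun m => pr h2 (q0 b d l m)).
  by have [m0 hm0] := ubd_tp2 l h2 aq; exists m0 => m /hm0; rewrite qq.
have [m0 hm0] := uq.
pose R h1 := \sum_(i < I) ((i`!)%:R)^-1 *:
  f (vm (mo b (l + i%:Z) d) (iter i (@lder K) h1 * h2) u).
apply: (@cont_ext _ _ (fun h1 => pr h1 (fun m => pr h2 (q0 b d l m)) - R h1)
   (Num.max m0 (J + I%:Z - n0))).
- apply: is_linear_sub; first exact: pr_lin.
  move=> a x y; rewrite /R scaler_sumr -big_split /=; apply: eq_bigr => i _.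
  rewrite iter_lder_lin mulrDl -scalerAl (vm_linh _ u) (hf a) scalerDr; congr (_ + _).
  by rewrite !scalerA mulrC.
- move=> g hg; rewrite (pr_ord (N := m0)) //; last by apply: (lordW _ hg); lia.
  rewrite /R big1 ?subrr // => i _.
  have -> : vm (mo b (l + i%:Z) d) (iter i (@lder K) g * h2) u = 0.
    apply: (pr_ord (N := J)) => [|k hk]; last by apply: hJ => //; have := ltn_ord i; lia.
    by apply: (lordW _ (lordM (lord_iter_lder (i := i) hg) hn0)); have := ltn_ord i; lia.
  by rewrite (is_linear0 hf) scaler0.
- move=> m; rewrite pr_mon; apply/eqP; rewrite subr_eq0; apply/eqP.
  have hs n : q0 b d l m n = \sum_(i < I) lbin (1 : K) m i%:Z *: f (mo (mo b (l + i%:Z) d) (m + n - i%:Z) u).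
    rewrite /q0 /pr (@zsum_seq _ _ [seq i%:Z | i <- iota 0 I]).
    + by rewrite big_map -{1}[I]subn0 -/(index_iota 0 I) big_mkord.
    + by rewrite map_inj_uniq ?iota_uniq // => i j; lia.
    + move=> i hi; apply/mapP; exists (absz i); rewrite ?mem_iota.
        have [lt|le] := ltP i 0; first by rewrite (lord_bin _ _ lt) scale0r eqxx in hi.
        have [lt|le'] := ltP i I%:Z; first lia.
        by rewrite hI ?vm0l ?(is_linear0 hf) ?scaler0 ?eqxx // in hi; lia.
      have [lt|le] := ltP i 0; first by rewrite (lord_bin _ _ lt) scale0r eqxx in hi.
      lia.
  under eq_pr do rewrite hs.
  have uf (i : nat) : ubd (fun n => f (mo (mo b (l + i%:Z) d) (m + n - i%:Z) u)).
    have [k0 hk0] := ubd_vm A (mo b (l + i%:Z) d) u; exists (k0 - m + i%:Z) => n hn.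
    by rewrite hk0 ?(is_linear0 hf) //; lia.
  rewrite pr_sumr => [|i]; last first.
    by have [k0 hk0] := uf i; exists k0 => n /hk0 ->; rewrite scaler0.
  apply: eq_bigr => i _; rewrite prZr //.
  rewrite iter_lder_mon -scalerAl (is_linearZ (vm_linh _ u)) (is_linearZ hf) scalerA mulrA.
  rewrite mulVf ?fact_neq0 // mul1r; congr (_ *: _).
  rewrite /vm pr_monM; last exact: ubd_vm.
  rewrite (pr_raddf _ hf); last first.
    have [k0 hk0] := ubd_vm A (mo b (l + i%:Z) d) u; exists (k0 - m + i%:Z) => n hn.
    by apply: hk0; lia.
  by apply: eq_pr => n; congr (f (mo _ _ _)); lia.
Qed.

Lemma vm_commutator b d h1 h2 (I : nat) : (forall k, I%:Z <= k -> mo b k d = 0) ->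
  f (vm b h1 (vm d h2 u)) - f (vm d h2 (vm b h1 u)) =
  \sum_(i < I) ((i`!)%:R)^-1 *: f (vm (mo b i%:Z d) (iter i (@lder K) h1 * h2) u).
Proof.
move=> hI; have := tp_jacobi b d (lmon K 0) h1 h2; rewrite /tp !pr_mon pr_q12 pr_q21 => ->.
exact: (@q0_eval b d 0 h1 h2 I).
Qed.

End Families.
End Jacobi.

(** * Division by z_1 - z_2 *)
Section Division.
Variable K : numFieldType.
Variable W : lmodType K.
Implicit Types (F G : int -> int -> W).

(* multiplication by z_1 - z_2 on coefficient arrays *)
Definition Sop F (i j : int) : W := F (i - 1) j - F i (j - 1).
Definition Sit (q : nat) F := iter q Sop F.

Lemma Sop_ext F G : F =2 G -> Sop F =2 Sop G.
Proof. by move=> h i j; rewrite /Sop !h. Qed.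
Lemma Sit_ext q F G : F =2 G -> Sit q F =2 Sit q G.
Proof. by move=> h; elim: q => [|q IH] //; apply: Sop_ext. Qed.
Lemma SitD q p F : Sit (q + p) F = Sit q (Sit p F).
Proof. exact: iterD. Qed.
Lemma SitSr q F : Sit q.+1 F = Sit q (Sop F).
Proof. exact: iterSr. Qed.
Lemma Sit_sub q F G i j : Sit q (fun i j => F i j - G i j) i j = Sit q F i j - Sit q G i j.
Proof.
elim: q i j => [|q IH] i j //=; rewrite /Sop !IH !opprB addrACA [RHS]addrACA.
by congr (_ + _); rewrite addrC.
Qed.

Lemma Sit_binom q F i j : Sit q F i j =
  \sum_(a < q.+1) ('C(q, a)%:R * (-1) ^+ a) *: F (i - (q%:Z - a%:Z)) (j - a%:Z).
Proof.
elim: q i j => [|q IH] i j.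
  by rewrite big_ord1 bin0 mul1r expr0 scale1r /= !subr0.
rewrite /= /Sop -/(Sit q F) !IH big_ord_recl [RHS]big_ord_recl.
rewrite [X in _ - X]big_ord_recr [X in _ = _ + X]big_ord_recr /= !bin0 !binn !expr0.
have E (a b c d a' e f : W) : a = a' -> b - c = e -> - d = f -> a + b - (c + d) = a' + (e + f).
  by move=> -> <- <-; rewrite opprD addrACA -!addrA; congr (_ + _); rewrite addrCA.
apply: E; first by congr (_ *: F _ _); lia.
  2: by rewrite /bump /= add1n !mul1r exprS mulN1r scaleNr; congr (- (_ *: F _ _)); lia.
rewrite -sumrB; apply: eq_bigr => a _; rewrite /bump /= !add1n.
rewrite binS natrD mulrDl scalerDl; congr (_ + _); first by congr (_ *: F _ _); lia.
rewrite exprS mulN1r mulrN scaleNr; congr (- (_ *: F _ _)); lia.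
Qed.

(** Where (z_1 - z_2) F vanishes, F i j equals F (i+1) (j-1); repeating this descends into the
    region j < N where F is zero. *)
Lemma Sit_van1 q F (J N : int) :
  (forall i j, j <= J -> Sit q F i j = 0) -> (forall i j, j < N -> F i j = 0) ->
  forall i j, j <= J -> F i j = 0.
Proof.
elim: q F => [|q IH] F h1 h2; first by move=> i j; apply: h1.
have h3 i j : j <= J -> Sop F i j = 0.
  apply: (IH (Sop F)) => [i' j' h|i' j' h]; first by rewrite -SitSr; apply: h1.
  by rewrite /Sop !h2 ?subrr //; lia.
suff H (n : nat) : forall i j, j <= J -> j < N + n%:Z -> F i j = 0.
  by move=> i j hj; apply: (H (absz (j - N)).+1) => //; lia.
elim: n => [|n IHn] i j hj hn; first by apply: h2; lia.
have := h3 (i + 1) j hj; rewrite /Sop addrK => /eqP; rewrite subr_eq0 => /eqP ->.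
by apply: IHn; lia.
Qed.
Lemma Sit_van2 q F (I N : int) :
  (forall i j, i <= I -> Sit q F i j = 0) -> (forall i j, i < N -> F i j = 0) ->
  forall i j, i <= I -> F i j = 0.
Proof.
elim: q F => [|q IH] F h1 h2; first by move=> i j; apply: h1.
have h3 i j : i <= I -> Sop F i j = 0.
  apply: (IH (Sop F)) => [i' j' h|i' j' h]; first by rewrite -SitSr; apply: h1.
  by rewrite /Sop !h2 ?subrr //; lia.
suff H (n : nat) : forall i j, i <= I -> i < N + n%:Z -> F i j = 0.
  by move=> i j hi; apply: (H (absz (i - N)).+1) => //; lia.
elim: n => [|n IHn] i j hi hn; first by apply: h2; lia.
have := h3 i (j + 1) hi; rewrite /Sop addrK => /eqP; rewrite subr_eq0 eq_sym => /eqP ->.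
by apply: IHn; lia.
Qed.

Lemma Sit_inj1 q F G (N : int) : Sit q F =2 Sit q G ->
  (forall i j, j < N -> F i j = 0) -> (forall i j, j < N -> G i j = 0) -> F =2 G.
Proof.
move=> h h1 h2 i j; apply/eqP; rewrite -subr_eq0; apply/eqP.
apply: (@Sit_van1 q (fun i j => F i j - G i j) j N) => //.
- by move=> i' j' _; rewrite Sit_sub h subrr.
- by move=> i' j' hj; rewrite h1 ?h2 ?subrr.
Qed.
Lemma Sit_inj2 q F G (N : int) : Sit q F =2 Sit q G ->
  (forall i j, i < N -> F i j = 0) -> (forall i j, i < N -> G i j = 0) -> F =2 G.
Proof.
move=> h h1 h2 i j; apply/eqP; rewrite -subr_eq0; apply/eqP.
apply: (@Sit_van2 q (fun i j => F i j - G i j) i N) => //.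
- by move=> i' j' _; rewrite Sit_sub h subrr.
- by move=> i' j' hj; rewrite h1 ?h2 ?subrr.
Qed.

Section Expansions.
Variable G : int -> int -> W.
Variable N : int.
Hypothesis hG : forall i j, (i < N) || (j < N) -> G i j = 0.

(* the coefficient of z^{-n} in the expansion of (z - 1)^{-p} at infinity minus the one at 0 *)
Definition kap (p : nat) (n : int) : K := lres (lE n%:~R * ly K ^ (- p%:Z)).

Lemma kapS p n : kap p.+1 (n + 1) - kap p.+1 n = kap p n.
Proof.
rewrite /kap -lresB intrD lED -mulrBl -[X in (_ - X) * _]mulr1 -mulrBr -mulrA; congr (lres (_ * _)).
by rewrite -[lE 1 - 1]/(ly K) -lyzS; congr (_ ^ _); lia.
Qed.
Lemma kap1 p : kap p.+2 1 = 0.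
Proof. by rewrite /kap lres_E1y //; lia. Qed.
Lemma kap11 : kap 1 1 = 1.
Proof. exact: lres_E1yV. Qed.
Lemma kap0 n : kap 0 n = 0.
Proof. by rewrite /kap oppr0 expr0z mulr1 lres_ord //; apply: lord_E. Qed.

(** The quotient of G by (z_1 - z_2)^p expanded in |z_1| > |z_2|; [Fm] is the one in |z_2| > |z_1|.
    Each takes one side of the kernel [kap], so that their difference carries the full kernel. *)
Definition Fp (p : nat) (i j : int) : W :=
  zsum (fun i' : int => if i < i' then kap p (i' - i) *: G i' (i + j + p%:Z - i') else 0).
Definition Fm (p : nat) (i j : int) : W :=
  - zsum (fun i' : int => if i' <= i then kap p (i' - i) *: G i' (i + j + p%:Z - i') else 0).

Lemma Gfin (c : int -> K) (m : int) : zfin (fun i' : int => c i' *: G i' (m - i')).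
Proof.
exists (absz m + absz N + absz N)%N.+1 => i hi; rewrite hG ?scaler0 //; lia.
Qed.
Lemma Gfin_if (P : int -> bool) (c : int -> K) (m : int) :
  zfin (fun i' : int => if P i' then c i' *: G i' (m - i') else 0).
Proof. by have [n h] := Gfin c m; exists n => i hi; rewrite h //; case: ifP. Qed.

Lemma Fpm p i j : Fp p i j - Fm p i j =
  zsum (fun i' : int => kap p (i' - i) *: G i' (i + j + p%:Z - i')).
Proof.
rewrite /Fp /Fm opprK -zsumD; try exact: (Gfin_if _ (fun i' => kap p (i' - i))).
apply: eq_zsum => i'; rewrite ltNge; case: (i' <= i); rewrite ?addr0 ?add0r //.
Qed.

Lemma zsum_sub (f h : int -> W) : zfin f -> zfin h ->
  zsum f - zsum h = zsum (fun i => f i - h i).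
Proof.
move=> hf hh.
have e : - zsum h = zsum (fun i => - h i).
  by apply: (zsum_raddf (g := -%R)); rewrite ?oppr0 // => x y; rewrite opprD.
by rewrite e -zsumD //; case: hh => n h'; exists n => i hi; rewrite h' ?oppr0.
Qed.

Lemma Sop_Fp p i j : Sop (Fp p.+1) i j = if p is 0%N then G i j else Fp p i j.
Proof.
have ea : i - 1 + j + p.+1%:Z = i + j + p%:Z by lia.
have eb : i + (j - 1) + p.+1%:Z = i + j + p%:Z by lia.
rewrite /Sop /Fp ea eb zsum_sub;
  try exact: (Gfin_if _ (fun i' => kap p.+1 (i' - _))).
have E i' : (if i - 1 < i' then kap p.+1 (i' - (i - 1)) *: G i' (i + j + p%:Z - i') else 0)
  - (if i < i' then kap p.+1 (i' - i) *: G i' (i + j + p%:Z - i') else 0)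
  = if i' == i then kap p.+1 1 *: G i (j + p%:Z)
    else if i < i' then kap p (i' - i) *: G i' (i + j + p%:Z - i') else 0.
  have [->|ne] := eqVneq i' i.
    rewrite ltxx subr0 (_ : i - 1 < i); last by lia.
    have -> : i - (i - 1) = 1 by lia.
    by have -> : i + j + p%:Z - i = j + p%:Z by lia.
  case: (ltP i i') => h.
    have -> : i - 1 < i' by lia.
    have -> : i' - (i - 1) = i' - i + 1 by lia.
    by rewrite -scalerBl kapS.
  by rewrite (_ : (i - 1 < i') = false) ?subr0 //; lia.
under eq_zsum do rewrite E.
case: p E {ea eb} => [|p] E.
  rewrite (zsum1 (j := i)) => [|i' /negbTE ->]; first by rewrite eqxx kap11 scale1r addr0.
  by case: ifP => // _; rewrite kap0 scale0r.
apply: eq_zsum => i'; have [->|//] := eqVneq i' i; by rewrite ltxx kap1 scale0r.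
Qed.

Lemma Sop_Fm p i j : Sop (Fm p.+1) i j = if p is 0%N then G i j else Fm p i j.
Proof.
have H : Sop (fun i j => Fp p.+1 i j - Fm p.+1 i j) i j =
    if p is 0%N then 0 else Fp p i j - Fm p i j.
  have ea : i - 1 + j + p.+1%:Z = i + j + p%:Z by lia.
  have eb : i + (j - 1) + p.+1%:Z = i + j + p%:Z by lia.
  rewrite /Sop !Fpm ea eb zsum_sub; try exact: (Gfin (fun i' => kap p.+1 (i' - _))).
  transitivity (zsum (fun i' : int => kap p (i' - i) *: G i' (i + j + p%:Z - i'))).
    by apply: eq_zsum => i'; rewrite -scalerBl -(kapS p) (_ : i' - (i - 1) = i' - i + 1) //; lia.
  by case: p {ea eb} => [|p]; [apply: zsum0 => i'; rewrite kap0 scale0r|].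
have := H; rewrite -[Sop _ i j]/(Sit 1 _ i j) (Sit_sub 1) /= Sop_Fp.
case: p H => [|p] _ /eqP; first by rewrite subr_eq0 => /eqP.
by rewrite (inj_eq (addrI _)) eqr_opp => /eqP.
Qed.

Lemma Sit_Fp p : (0 < p)%N -> Sit p (Fp p) =2 G.
Proof.
case: p => // p _; elim: p => [|p IH] i j; first by rewrite /= Sop_Fp.
rewrite SitSr (@Sit_ext _ _ (Fp p.+1)); first exact: IH.
by move=> i' j'; rewrite Sop_Fp.
Qed.
Lemma Sit_Fm p : (0 < p)%N -> Sit p (Fm p) =2 G.
Proof.
case: p => // p _; elim: p => [|p IH] i j; first by rewrite /= Sop_Fm.
rewrite SitSr (@Sit_ext _ _ (Fm p.+1)); first exact: IH.
by move=> i' j'; rewrite Sop_Fm.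
Qed.
Lemma Fp_van p i j : j < N - p%:Z -> Fp p i j = 0.
Proof.
move=> hj; apply: zsum0 => i'; case: ifP => // h; rewrite hG ?scaler0 //; lia.
Qed.
Lemma Fm_van p i j : i < N -> Fm p i j = 0.
Proof.
move=> hj; rewrite /Fm zsum0 ?oppr0 // => i'; case: ifP => // h; rewrite hG ?scaler0 //; lia.
Qed.

End Expansions.
End Division.

(** The argument of [cont_ext] for a family with a leading term in each degree: subtracting
    multiples of its members raises the order of h until it reaches N. *)
Lemma cont_ext_lead (K : numFieldType) (M : lmodType K) (Lam : laurent K -> M) (N : int)
    (u : int -> laurent K) : is_linear Lam ->
  (forall h, lord N h -> Lam h = 0) ->
  (forall n, lord n (u n)) -> (forall n, u n n != 0) -> (forall n, Lam (u n) = 0) ->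
  forall h, Lam h = 0.
Proof.
move=> hl hN ou lu hu h; have [a ha] := lord_exists h.
have [le|lt] := leP N a; first by apply: hN; apply: (lordW le ha).
have {lt} [n hn] : exists n : nat, a + n%:Z = N by exists (absz (N - a)); lia.
elim: n a h ha hn => [|n IH] a h ha hn; first by apply: hN; apply: (lordW _ ha); lia.
rewrite -[h](subrK ((h a / u a a) *: u a)) (is_linearD hl) (is_linearZ hl) hu scaler0 addr0.
apply: (IH (a + 1)); last by lia.
move=> i hi; rewrite lcoB lcoZ; have [->|ne] := eqVneq i a; first by rewrite divfK ?subrr.
by rewrite (ha i) ?(ou a i) ?mulr0 ?subrr //; lia.
Qed.

(** * Twisted modules and associativity *)
Section Twisted.
Variable K : numFieldType.
Variable V : lmodType K.
Variable A : vertex_algebra V.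
Variable T : nat.
Hypothesis T0 : (0 < T)%N.
Local Notation L := (laurent K).
Local Notation vac := (vac A).
Local Notation D := (vaD A).
Local Notation mo := (vmode A).
Local Notation q_ s := (s%:~R / T%:R : K).
Variable cls : int -> V -> Prop.
Variable pj : nat -> V -> V.
Hypothesis pj_cls : forall r v, cls r%:Z (pj r v).
Hypothesis pj_sum : forall v, v = \sum_(r < T) pj r v.
Hypothesis cls_D : forall r v, cls r v -> cls r (D v).

Lemma TK0 : T%:R != 0 :> K. Proof. by rewrite pnatr_eq0 -lt0n. Qed.
Lemma q_inj : injective (fun s : int => q_ s).
Proof. by move=> s s' /(mulIf (invr_neq0 TK0)) /intr_inj. Qed.
Lemma q_D s s' : q_ (s + s') = q_ s + q_ s'.
Proof. by rewrite intrD mulrDl. Qed.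
Lemma q_N s : q_ (- s) = - q_ s.
Proof. by rewrite mulrNz mulNr. Qed.
Lemma q_T i : q_ (T%:Z * i) = i%:~R.
Proof. by rewrite intrM mulrAC mulfV ?mul1r // -pmulrn TK0. Qed.

(* [md v s] is the coefficient of x^{s/T} in Y_W(v,x) *)
Record tmod (W : lmodType K) (md : V -> int -> W -> W) : Prop := Tmod {
  tm_linl : forall s w, is_linear (fun v => md v s w);
  tm_linr : forall v s, is_linear (md v s);
  tm_trunc : forall v w, exists N : int, forall s, s < N -> md v s w = 0;
  tm_vac : forall s w, md vac s w = if s == 0 then w else 0;
  tm_cls : forall r v s w, cls r v -> ~~ (T%:Z %| s + r)%Z -> md v s w = 0
}.

Section Module.
Variable W : lmodType K.
Variable md : V -> int -> W -> W.
Hypothesis tm : tmod md.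
Implicit Types (u v b d : V) (w : W).

Lemma md0l s w : md 0 s w = 0. Proof. exact: is_linear0 (tm_linl tm s w). Qed.
Lemma md0r v s : md v s 0 = 0. Proof. exact: is_linear0 (tm_linr tm v s). Qed.

Lemma ubd_md b d M w : ubd (fun l => md (mo b l d) M w).
Proof. by have [N h] := ubd_vm A b d; exists N => l /h ->; apply: md0l. Qed.

Lemma pr_md h b d M w : pr h (fun l => md (mo b l d) M w) = md (vm A b h d) M w.
Proof. by rewrite /vm (pr_raddf _ (tm_linl tm M w)) //; apply: ubd_vm. Qed.

(* coefficient of x_1^{s/T} x_2^{t/T} in (x_1 - x_2)^k Y_W(u,x_1) Y_W(v,x_2) w *)
Definition tF u v (k : nat) w (s t : int) : W :=
  \sum_(a < k.+1) ('C(k, a)%:R * (-1) ^+ a) *: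
     md u (s - T%:Z * (k%:Z - a%:Z)) (md v (t - T%:Z * a%:Z) w).

(* the associativity axiom, tested against an arbitrary Laurent series *)
Definition hform u v (k : nat) := forall w, exists N : int,
  (forall s t, (s < N) || (t < N) -> tF u v k w s t = 0) /\
  (forall M (h : L), pr (h * ly K ^+ k) (fun l => md (mo u l v) M w) =
     zsum (fun s : int => lres (h * lE (q_ s)) *: tF u v k w s (M + T%:Z * k%:Z - s))).

Lemma tF_Sit u v k w s t i j : tF u v k w (T%:Z * i + s) (T%:Z * j + t) =
  Sit k (fun i j => md u (T%:Z * i + s) (md v (T%:Z * j + t) w)) i j.
Proof.
rewrite Sit_binom; apply: eq_bigr => a _; congr (_ *: md u _ (md v _ w)); lia.
Qed.

Lemma tF_S u v k w s t : tF u v k.+1 w s t = tF u v k w (s - T%:Z) t - tF u v k w s (t - T%:Z).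
Proof.
have := tF_Sit u v k.+1 w s t 0 0; rewrite mulr0 !add0r => -> /=; rewrite /Sop -!tF_Sit.
by rewrite !add0r !mulr0 !add0r !mulrN1 ![- _ + _]addrC.
Qed.

Lemma tF_sym d b k w s t : (-1) ^+ k *: tF d b k w t s =
  \sum_(a < k.+1) ('C(k, a)%:R * (-1) ^+ a) *:
     md d (t - T%:Z * a%:Z) (md b (s - T%:Z * (k%:Z - a%:Z)) w).
Proof.
rewrite /tF scaler_sumr (reindex_inj rev_ord_inj) /=; apply: eq_bigr => a _.
have ha : (a <= k)%N by rewrite -ltnS.
have ek : Posz (k - a) = k%:Z - a%:Z by lia.
rewrite scalerA subSS bin_sub // mulrCA -exprD ek.
have -> : k%:Z - (k%:Z - a%:Z) = a%:Z by lia.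
congr ((_ * _) *: _); have -> : (k + (k - a) = a + (k - a).*2)%N by rewrite -addnn; lia.
by rewrite exprD -mul2n exprM sqrrN expr1n expr1n mulr1.
Qed.

Lemma hform_fin N u v k w (c : int -> K) M :
  (forall s t, (s < N) || (t < N) -> tF u v k w s t = 0) ->
  zfin (fun s => c s *: tF u v k w s (M - s)).
Proof.
move=> h; exists (absz M + absz N + absz N)%N.+1 => s hs; rewrite h ?scaler0 //; lia.
Qed.

(** With x_1 = x_2 e^x, multiplying the test function by e^x - 1 amounts to multiplying the product
    by (x_1 - x_2)/x_2. *)
Lemma hform_S u v k : hform u v k -> hform u v k.+1.
Proof.
move=> h w; have [N [h1 h2]] := h w; exists N; split.
  by move=> s t hst; rewrite tF_S !h1 ?subrr //; lia.
move=> M g; rewrite exprS mulrA h2.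
rewrite (eq_zsum (f' := fun s => lres (g * lE (q_ (s + T%:Z))) *: tF u v k w s (M + T%:Z * k%:Z - s) -
   lres (g * lE (q_ s)) *: tF u v k w s (M + T%:Z * k%:Z - s))); last first.
  move=> s; rewrite -scalerBl -lresB -mulrBr; congr (lres _ *: _).
  rewrite -mulrA; congr (_ * _); rewrite q_D lED -[T%:Z]mulr1 q_T /ly; ring.
rewrite -zsum_sub; try exact: (hform_fin (fun s => _) _ h1).
rewrite [X in X - _](zsum_shift (- T%:Z)); last exact: (hform_fin (fun s => _) _ h1).
rewrite zsum_sub; last exact: (hform_fin (fun s => _) _ h1); last first.
  have [n hn] := hform_fin (fun s => lres (g * lE (q_ (s + T%:Z)))) (M + T%:Z * k%:Z) h1.
  by exists (n + T)%N => s hs; apply: hn; lia.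
apply: eq_zsum => s; rewrite tF_S scalerBr subrK.
by congr (_ *: tF _ _ _ _ _ _ - _ *: tF _ _ _ _ _ _); lia.
Qed.

Lemma hform_le u v k k' : (k <= k')%N -> hform u v k -> hform u v k'.
Proof.
move=> le h; rewrite -(subnK le); elim: (k' - k)%N => [|n IH] //; rewrite addSn; exact: hform_S.
Qed.

Lemma tF_vac v k w s t : tF v vac k w s t =
  \sum_(a < k.+1) if t == T%:Z * a%:Z then ('C(k, a)%:R * (-1) ^+ a) *:
     md v (s - T%:Z * (k%:Z - a%:Z)) w else 0.
Proof.
apply: eq_bigr => a _; rewrite (tm_vac tm) subr_eq0; case: ifP => // _.
by rewrite md0r scaler0.
Qed.

Section Assoc.
Hypothesis assoc : forall u v, exists k, hform u v k.

(** Associativity for v and the vacuum gives Y_W(Y(v,x_0)1, x_2) = Y_W(v, x_2 e^{x_0}). The test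
    function x^{-1-i} y^{-k} cancels the factor y^k, and only k + 1 terms of the product with the
    vacuum are non-zero. *)
Lemma md_cr v (i : nat) M w :
  md (mo v (-1 - i%:Z) vac) M w = ((q_ M) ^+ i / (i`!)%:R) *: md v M w.
Proof.
have [k hk] := assoc v vac; have [N [h1 h2]] := hk w.
have := h2 M (lmon K (-1 - i%:Z) * ly K ^ (- k%:Z)).
rewrite -mulrA -[ly K ^+ k]/(ly K ^ k%:Z) -lyzD addNr expr0z mulr1 pr_mon => ->.
pose c (a : nat) := 'C(k, a)%:R * (-1) ^+ a : K.
pose sa (a : nat) := M + T%:Z * (k%:Z - a%:Z).
rewrite (eq_zsum (f' := fun s => \sum_(a < k.+1) if s == sa a then
    (lres (lmon K (-1 - i%:Z) * ly K ^ (- k%:Z) * lE (q_ (sa a))) * c a) *: md v M w else 0)).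
  rewrite zsum_sum; last first.
    move=> a; exists (absz (sa a)).+1 => s hs; rewrite (_ : (s == sa a) = false) //.
    by apply/negbTE/eqP => e; rewrite e ltnn in hs.
  transitivity (\sum_(a < k.+1) (lres (lmon K (-1 - i%:Z) * ly K ^ (- k%:Z) * lE (q_ (sa a))) * c a) *: md v M w).
    apply: eq_bigr => a _; rewrite (zsum1 (j := sa a)) ?eqxx // => s /negbTE -> //.
  rewrite -scaler_suml; congr (_ *: _).
  transitivity (lres (lmon K (-1 - i%:Z) * lE (q_ M))); last first.
    by rewrite /lres lco_monM (_ : -1 - (-1 - i%:Z) = i%:Z) ?lcoE //; lia.
  have -> : lmon K (-1 - i%:Z) * lE (q_ M) =
     lmon K (-1 - i%:Z) * ly K ^ (- k%:Z) * lE (q_ M) * ly K ^+ k.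
    rewrite -[ly K ^+ k]/(ly K ^ k%:Z) mulrAC -[_ * _ * ly K ^ _]mulrA -lyzD addNr expr0z.
    by rewrite mulr1.
  rewrite lyX_sum mulr_sumr /lres lco_sum [RHS](reindex_inj rev_ord_inj); apply: eq_bigr => a _ /=.
  have ha : (a <= k)%N by rewrite -ltnS.
  rewrite -scalerAr lcoZ subSS subKn // bin_sub // mulrC /c; congr (_ * lco _ _).
  rewrite -!mulrA -lED /sa q_D q_T; congr (_ * (_ * lE (_ + _))).
  by rewrite -[RHS]/((k - a)%N%:Z%:~R); congr (_%:~R); lia.
move=> s; rewrite tF_vac scaler_sumr; apply: eq_bigr => a _.
rewrite (_ : (M + T%:Z * k%:Z - s == T%:Z * a%:Z) = (s == sa a)); last first.
  by rewrite /sa; apply/eqP/eqP; lia.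
case: eqP => [->|_]; last by rewrite scaler0.
by rewrite scalerA /c; congr (_ *: md v _ w); rewrite /sa; lia.
Qed.

Lemma md_D v M w : md (D v) M w = q_ M *: md v M w.
Proof. by have := md_cr v 1 M w; rewrite expr1 divr1. Qed.

(** Weak commutativity follows from associativity for (b,d) and for (d,b), compared through
    skew-symmetry in V. Equality of all pairings gives equality of coefficients because the
    exponentials e^{sx/T} are independent. *)
Lemma tF_comm b d k : hform b d k -> hform d b k -> forall w s t,
  tF b d k w s t = (-1) ^+ k *: tF d b k w t s.
Proof.
move=> hbd hdb w s t; have [N [h1 h2]] := hbd w; have [N' [h1' h2']] := hdb w.
pose M' := s + t; pose M := M' - T%:Z * k%:Z.
have eM : M + T%:Z * k%:Z = M' by rewrite /M subrK.
pose c s := tF b d k w s (M' - s) - (-1) ^+ k *: tF d b k w (M' - s) s.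
have f2 (e : int -> K) : zfin (fun s => e s *: ((-1) ^+ k *: tF d b k w (M' - s) s)).
  exists (absz M' + absz N' + absz N')%N.+1 => s' hs; rewrite h1' ?scaler0 ?scaler0 //; lia.
suff : c s = 0.
  by move/eqP; rewrite /c subr_eq0 (_ : M' - s = t) => [/eqP //|]; rewrite /M'; lia.
apply: (@exp_indep _ _ (fun s => q_ s) c q_inj).
  have [n1 hn1] := hform_fin (fun=> 1) M' h1; have [n2 hn2] := f2 (fun=> 1).
  exists (n1 + n2)%N => s' hs.
  have a1 : (n1 <= absz s')%N by lia.
  have a2 : (n2 <= absz s')%N by lia.
  by have := hn1 s' a1; have := hn2 s' a2; rewrite /c !scale1r => -> ->; rewrite subrr.
move=> h.
have e1 := h2 M h; rewrite eM in e1.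
have hcr c0 (i : nat) : md (mo c0 (-1 - i%:Z) vac) M w = ((q_ M) ^+ i / (i`!)%:R) *: md c0 M w.
  exact: md_cr.
have e2 := @skew_pr _ _ A _ _ (q_ M) d b (h * ly K ^+ k) (tm_linl tm M w) hcr.
(* The reflected y^k is (-1)^k e^{-kx} y^k, and e^{-kx} completes the exponent M/T to M'/T since M'
   = M + T k. *)
have e3 : lsig (h * ly K ^+ k) * lE (- q_ M) =
   ((-1) ^+ k *: (lsig h * lE (- q_ M') )) * ly K ^+ k.
  rewrite lsigM lsigX lsig_y [(- (_ * _)) ^+ _]exprNn exprMn lEX lscale_sign -eM q_D q_T opprD lED.
  rewrite -[_ *+ k]mulr_natr mulN1r -pmulrn; ring.
rewrite e2 e3 h2' eM in e1.
transitivity (zsum (fun s : int => lres (h * lE (q_ s)) *: tF b d k w s (M' - s)) -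
   zsum (fun s : int => lres (h * lE (q_ s)) *: ((-1) ^+ k *: tF d b k w (M' - s) s))).
  rewrite zsum_sub //; last exact: (hform_fin (fun s => _) _ h1).
  by apply: eq_zsum => s'; rewrite -scalerBr.
have -> : zsum (fun s : int => lres (h * lE (q_ s)) *: ((-1) ^+ k *: tF d b k w (M' - s) s)) =
   zsum (fun s : int => lres (h * lE (q_ (M' - s))) *: ((-1) ^+ k *: tF d b k w s (M' - s))).
  rewrite (zsum_shift M') // zsum_opp; last first.
    by have [n hn] := f2 (fun s => lres (h * lE (q_ s))); exists (n + absz M')%N => s' hs; apply: hn; lia.
  apply: eq_zsum => s'; have -> : - s' + M' = M' - s' by lia.
  by have -> : M' - (M' - s') = s' by lia.
rewrite -e1; set S := zsum (fun s => lres (h * lE (q_ (M' - s))) *: _).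
rewrite (_ : - zsum _ = S) ?subrr // /S.
have fz (c0 : int -> K) := hform_fin c0 M' h1'.
rewrite (zsum_raddf (g := -%R)) ?oppr0 //; last by move=> x y; rewrite opprD.
apply: eq_zsum => s'; rewrite scalerA -scaleNr; congr (_ *: _).
rewrite -scalerAl lresZ -mulrA -lED (_ : - q_ M' + q_ s' = - q_ (M' - s')); last first.
  by rewrite q_D q_N opprD opprK.
by rewrite -lsigE -lsigM lres_sig mulrN opprK mulrC.
Qed.
End Assoc.
End Module.
End Twisted.

Lemma zsum_class (M : zmodType) (f : int -> M) (T : nat) (r : int) : (0 < T)%N -> zfin f ->
  (forall s, ~~ (T%:Z %| s + r)%Z -> f s = 0) ->
  zsum f = zsum (fun i => f (T%:Z * i - r)).
Proof.
move=> T0 [N hN] hc.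
have hs s : f s != 0 -> exists2 i, s = T%:Z * i - r & i \in zrange (N + absz r).
  move=> h; have [le|lt] := leqP N (absz s); first by rewrite hN ?eqxx in h.
  case: (boolP (T%:Z %| s + r)%Z) => [/dvdzP [i hi]|/hc e]; last by rewrite e eqxx in h.
  by exists i; [lia|rewrite mem_zrange; nia].
rewrite [RHS](@zsum_seq _ _ (zrange (N + absz r))) ?zrange_uniq // => [|i hi].
  rewrite (@zsum_seq _ _ [seq T%:Z * i - r | i <- zrange (N + absz r)]) ?big_map //.
  - by rewrite map_inj_uniq ?zrange_uniq // => i j; nia.
  - by move=> s /hs [i -> hi]; apply/mapP; exists i.
by have [i' e] := hs _ hi; have -> : i = i' by nia.
Qed.

Section SitLow.
Variable K : numFieldType.
Variable W : lmodType K.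
Implicit Types F : int -> int -> W.
Lemma Sit_low1 q F (N : int) : (forall i j, j < N -> F i j = 0) ->
  forall i j, j < N -> Sit q F i j = 0.
Proof.
move=> h; elim: q => [|q IH] i j hj /=; first exact: h.
by rewrite /Sop !IH ?subrr //; lia.
Qed.
Lemma Sit_low2 q F (N : int) : (forall i j, i < N -> F i j = 0) ->
  forall i j, i < N -> Sit q F i j = 0.
Proof.
move=> h; elim: q => [|q IH] i j hj /=; first exact: h.
by rewrite /Sop !IH ?subrr //; lia.
Qed.
Lemma Sit_shift q F i j : Sit q (fun i j => F (i - 1) j) i j = Sit q F (i - 1) j.
Proof. by elim: q i j => [|q IH] i j //=; rewrite /Sop -!/(Sit q _) !IH. Qed.
(** Leibniz rule for z_1 d/dz_1 and (z_1 - z_2)^q; the constant c accounts for fractional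
    exponents. *)
Lemma Sit_scale q F (c : K) i j : Sit q (fun i j => (i%:~R + c) *: F i j) i j =
  (i%:~R + c) *: Sit q F i j - q%:R *: Sit q.-1 F (i - 1) j.
Proof.
elim: q F i j => [|q IH] F i j; first by rewrite scale0r subr0.
rewrite SitSr (@Sit_ext _ _ q _ (fun i j => (i%:~R + c) *: Sop F i j - F (i - 1) j)).
  rewrite Sit_sub IH Sit_shift -SitSr -addrA; congr (_ + _).
  rewrite -opprD; congr (- _); case: q {IH} => [|q]; first by rewrite scale0r add0r scale1r.
  by rewrite -SitSr /= -/(Sit q.+1 F) -[X in _ + X]scale1r -scalerDl natr1.
move=> i' j'; rewrite /Sop (_ : (i' - 1)%:~R + c = i'%:~R + c - 1); last by rewrite intrB; ring.
by rewrite scalerBl scale1r scalerBr addrAC.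
Qed.
End SitLow.

(** * From associativity to the identities with (z_1 - z_2)^{-q} *)

Section TwistedBorcherds.
Variable K : numFieldType.
Variable V : lmodType K.
Variable A : vertex_algebra V.
Variable T : nat.
Hypothesis T0 : (0 < T)%N.
Local Notation L := (laurent K).
Local Notation vac := (vac A).
Local Notation D := (vaD A).
Local Notation mo := (vmode A).
Local Notation q_ s := (s%:~R / T%:R : K).
Variable cls : int -> V -> Prop.
Variable pj : nat -> V -> V.
Hypothesis pj_cls : forall r v, cls r%:Z (pj r v).
Hypothesis pj_sum : forall v, v = \sum_(r < T) pj r v.
Hypothesis cls_D : forall r v, cls r v -> cls r (D v).

Definition Bf W (md : V -> int -> W -> W) (r : int) b d (t0 : int) w (i j : int) :=
  md b (T%:Z * i - r) (md d (T%:Z * j + t0) w).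
Definition Bf' W (md : V -> int -> W -> W) (r : int) b d (t0 : int) w (i j : int) :=
  md d (T%:Z * j + t0) (md b (T%:Z * i - r) w).

(* z_1^{-s} z_2^{-t} (z_1 - z_2)^{-q} applied to the Jacobi identity:
   C1 and C2 are the expansions of (z_1 - z_2)^{-q} Y(b,z_1) Y(d,z_2) w
   and of (z_1 - z_2)^{-q} Y(d,z_2) Y(b,z_1) w *)
Definition WBq (W : lmodType K) (md : V -> int -> W -> W) (q : nat) :=
  forall r b, cls r b -> forall d w t0, exists C1 C2 : int -> int -> W,
  [/\ Sit q C1 =2 Bf md r b d t0 w, Sit q C2 =2 Bf' md r b d t0 w,
     forall j, (forall j', j' <= j -> md d (T%:Z * j' + t0) w = 0) -> forall i, C1 i j = 0,
     forall i, (forall i', i' <= i -> md b (T%:Z * i' - r) w = 0) -> forall j, C2 i j = 0 &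
     forall i j, C1 i j - C2 i j = md (vm A b (lE (q_ r - i%:~R) * ly K ^ (- q%:Z)) d)
        (T%:Z * (i + j + q%:Z) - r + t0) w].

Section Module.
Variable W : lmodType K.
Variable md : V -> int -> W -> W.
Hypothesis tm : tmod A T cls md.
Implicit Types (u v b d : V) (w : W).

Lemma Bf_low r b d t0 w : exists N : int, forall i j, j < N -> Bf md r b d t0 w i j = 0.
Proof.
have [N hN] := tm_trunc tm d w; exists (- (absz N + absz t0)%N%:Z) => i j hj.
by rewrite /Bf hN ?(md0r tm) //; nia.
Qed.
Lemma Bf'_low r b d t0 w : exists N : int, forall i j, i < N -> Bf' md r b d t0 w i j = 0.
Proof.
have [N hN] := tm_trunc tm b w; exists (- (absz N + absz r)%N%:Z) => i j hj.
by rewrite /Bf' hN ?(md0r tm) //; nia.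
Qed.

Lemma Sit_Bf k r b d t0 w i j :
  Sit k (Bf md r b d t0 w) i j = tF T md b d k w (T%:Z * i - r) (T%:Z * j + t0).
Proof. by rewrite tF_Sit. Qed.

Lemma vmM b h d M w : md (vm A b h d) M w = pr h (fun l => md (mo b l d) M w).
Proof. by rewrite (pr_md tm). Qed.

Lemma tF_cls r b d k w s t : cls r b -> ~~ (T%:Z %| s + r)%Z -> tF T md b d k w s t = 0.
Proof.
move=> hb hs; apply: big1 => a _; rewrite (tm_cls tm _ hb) ?scaler0 //.
apply: contra hs => /dvdzP [x hx]; apply/dvdzP.
by exists (x + (k%:Z - a%:Z)); rewrite mulrDl -hx; lia.
Qed.

(** Multiplied by (z_1 - z_2)^k, both orders of the product become one array G bounded below in both
    variables. Its two quotients by (z_1 - z_2)^{q+k} are C1 and C2, and their difference is the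
    residue sum given by associativity. *)
Lemma hform_WB : (forall u v, exists k, hform A T md u v k) -> forall q, WBq md q.
Proof.
move=> assoc q r b hb d w t0.
(* One k for both orders; the successor keeps q + k positive when q = 0, as [Sit_Fp] and [Sit_Fm]
   require. *)
have [k1 h1] := assoc b d; have [k2 h2] := assoc d b; pose k := (k1 + k2).+1.
have {h1} hbd : hform A T md b d k by apply: (hform_le T0 _ h1); rewrite /k; lia.
have {h2} hdb : hform A T md d b k by apply: (hform_le T0 _ h2); rewrite /k; lia.
have [N1 [hN hf]] := hbd w.
pose G i j := tF T md b d k w (T%:Z * i - r) (T%:Z * j + t0).
pose N := - (absz N1 + absz r + absz t0)%N%:Z.
have hG i j : (i < N) || (j < N) -> G i j = 0.
  move=> h; apply: hN; rewrite /N in h.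
  by case/orP: h => h; apply/orP; [left|right]; nia.
have GB : Sit k (Bf md r b d t0 w) =2 G by move=> i j; rewrite Sit_Bf.
have GB' : Sit k (Bf' md r b d t0 w) =2 G.
  move=> i j; rewrite Sit_binom /G (tF_comm T0 tm assoc hbd hdb) tF_sym //.
  by apply: eq_bigr => a _; congr (_ *: md d _ (md b _ w)); lia.
have kq : (0 < q + k)%N by rewrite /k; lia.
have [M1 hM1] := Bf_low r b d t0 w; have [M2 hM2] := Bf'_low r b d t0 w.
have e1 : Sit q (Fp G (q + k)) =2 Bf md r b d t0 w.
  apply: (@Sit_inj1 _ _ k _ _ (Num.min M1 (N - (q + k)%N%:Z))).
  - by move=> i j; rewrite -SitD addnC (Sit_Fp hG kq) GB.
  - apply: Sit_low1 => i j hj; apply: (Fp_van hG); lia.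
  - move=> i j hj; apply: hM1; lia.
have e2 : Sit q (Fm G (q + k)) =2 Bf' md r b d t0 w.
  apply: (@Sit_inj2 _ _ k _ _ (Num.min M2 N)).
  - by move=> i j; rewrite -SitD addnC (Sit_Fm hG kq) GB'.
  - apply: Sit_low2 => i j hj; apply: (Fm_van hG); lia.
  - move=> i j hj; apply: hM2; lia.
exists (Fp G (q + k)), (Fm G (q + k)); split=> //.
- move=> j hj i; apply: (@Sit_van1 _ _ q _ j (N - (q + k)%N%:Z)) => // [i' j' hj'|i' j' hj'].
    by rewrite e1 /Bf hj ?(md0r tm).
  exact: (Fp_van hG).
- move=> i hi j; apply: (@Sit_van2 _ _ q _ i N) => // [i' j' hj'|i' j' hj'].
    by rewrite e2 /Bf' hi ?(md0r tm).
  exact: (Fm_van hG).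
- move=> i j; rewrite (Fpm hG) vmM.
  set M := _ - r + t0.
  have -> : lE (q_ r - i%:~R) * ly K ^ (- q%:Z) =
     (lE (q_ r - i%:~R) * ly K ^ (- (q + k)%N%:Z)) * ly K ^+ k.
    by rewrite -[ly K ^+ k]/(ly K ^ k%:Z) -mulrA -lyzD; congr (_ * _ ^ _); lia.
  rewrite hf (@zsum_class _ _ T r T0 (hform_fin T0 _ _ hN)); last first.
    by move=> s hs; rewrite (tF_cls _ _ _ _ hb) ?scaler0.
  apply: eq_zsum => i'; congr (_ *: _).
    rewrite /kap mulrAC -lED; congr (lres (lE _ * _)).
    by rewrite (q_D K T) q_N (q_T K T0) intrB; ring.
  by rewrite /G; congr (tF _ _ _ _ _ _ _ _); rewrite /M; lia.
Qed.

End Module.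
End TwistedBorcherds.

Section SitMore.
Variable K : numFieldType.
Variable W : lmodType K.
Implicit Types F : int -> int -> W.
Lemma Sit_shiftS q F i j : Sit q (fun i j => F (i + 1) j) i j = Sit q F (i + 1) j.
Proof.
elim: q i j => [|q IH] i j //=; rewrite /Sop -!/(Sit q _) !IH.
by congr (Sit q F _ _ - _); lia.
Qed.
Lemma SitZ q F c i j : Sit q (fun i j => c *: F i j) i j = c *: Sit q F i j.
Proof. by elim: q i j => [|q IH] i j //=; rewrite /Sop -!/(Sit q _) !IH scalerBr. Qed.
End SitMore.

Lemma subr_scaler (K : numFieldType) (W : lmodType K) (s : K) (x y x' y' : W) :
  x - s *: y - (x' - s *: y') = (x - x') - s *: (y - y').
Proof. by rewrite scalerBr !opprB addrACA [RHS]addrACA [X in _ = _ + X]addrC. Qed.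

(** * From the identities with (z_1 - z_2)^{-q} back to associativity *)

Section TwistedBorcherds.
Variable K : numFieldType.
Variable V : lmodType K.
Variable A : vertex_algebra V.
Variable T : nat.
Hypothesis T0 : (0 < T)%N.
Local Notation L := (laurent K).
Local Notation vac := (vac A).
Local Notation D := (vaD A).
Local Notation mo := (vmode A).
Local Notation q_ s := (s%:~R / T%:R : K).
Variable cls : int -> V -> Prop.
Variable pj : nat -> V -> V.
Hypothesis pj_cls : forall r v, cls r%:Z (pj r v).
Hypothesis pj_sum : forall v, v = \sum_(r < T) pj r v.
Hypothesis cls_D : forall r v, cls r v -> cls r (D v).

Section Module.
Variable W : lmodType K.
Variable md : V -> int -> W -> W.
Hypothesis tm : tmod A T cls md.
Implicit Types (u v b d : V) (w : W).
Local Notation WBq := (WBq A T cls).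

(** Put E = z_1 d/dz_1 and F = (z_1 - z_2)^{-q-1} B. Then (z_1 - z_2)^{-q-1} E B - E F = (q+1) z_1
    (z_1 - z_2)^{-q-2} B, and E B is the product in which b is replaced by Db. *)
Lemma WB_step q : (forall v s w, md (D v) s w = q_ s *: md v s w) ->
  WBq md q.+1 -> WBq md q.+2.
Proof.
move=> hD H r b hb d w t0.
have [C1 [C2 [e1 e2 v1 v2 e3]]] := H r b hb d w t0.
have [C1d [C2d [e1d e2d v1d v2d e3d]]] := H r (D b) (cls_D hb) d w t0.
pose c := - q_ r.
have qc i : q_ (T%:Z * i - r) = i%:~R + c by rewrite (q_D K T) q_N (q_T K T0).
have q0 : q.+1%:R != 0 :> K by rewrite pnatr_eq0.
(* This solves the identity for (z_1 - z_2)^{-q-2} B; reading row i + 1 is the division by z_1. *)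
pose N F Fd : int -> int -> W := fun i j =>
  q.+1%:R^-1 *: (Fd (i + 1) j - ((i + 1)%:~R + c) *: F (i + 1) j).
have key F Fd (B : int -> int -> W) : Sit q.+1 F =2 B ->
    Sit q.+1 Fd =2 (fun i j => (i%:~R + c) *: B i j) -> Sit q.+2 (N F Fd) =2 B.
  move=> hF hFd i j; rewrite /N SitZ.
  rewrite (Sit_shiftS _ (fun i j => Fd i j - (i%:~R + c) *: F i j)) Sit_sub Sit_scale.
  have hS (G G' : int -> int -> W) : Sit q.+1 G =2 G' -> Sit q.+2 G =2 Sop G'.
    by move=> hG i' j'; rewrite -[Sit q.+2 G]/(Sop (Sit q.+1 G)); apply: Sop_ext.
  rewrite (hS _ _ hF) (hS _ _ hFd) -[Sop (fun _ _ => _)]/(Sit 1 (fun i j => _)) Sit_scale ![_.-1]/= hF addrK.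
  rewrite -[Sit 1 B _ _]/(Sop B (i + 1) j) -[Sit 0 B i j]/(B i j) opprB.
  rewrite [X in _ *: X]addrC addrA subrK.
  by rewrite -scalerBl -[q.+2%:R]natr1 addrK scalerA mulVf ?scale1r.
have B1d : Sit q.+1 C1d =2 (fun i j => (i%:~R + c) *: Bf T md r b d t0 w i j).
  by move=> i j; rewrite e1d /Bf hD qc.
have B2d : Sit q.+1 C2d =2 (fun i j => (i%:~R + c) *: Bf' T md r b d t0 w i j).
  by move=> i j; rewrite e2d /Bf' hD qc (is_linearZ (tm_linr tm _ _)).
have k1 := key _ _ _ e1 B1d; have k2 := key _ _ _ e2 B2d.
exists (N C1 C1d), (N C2 C2d); split=> //.
- by move=> j hj i; rewrite /N v1 // v1d // scaler0 subrr scaler0.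
(* The construction reads row i + 1, on which the hypothesis gives nothing. Vanishing therefore
   holds far below at once, and injectivity of (z_1 - z_2)^{q+2} carries it up to row i. *)
- have [N0 hN0] := tm_trunc tm b w.
  move=> i hi j; pose N1 := - (absz N0 + absz r + 1)%N%:Z.
  apply: (@Sit_van2 _ _ q.+2 _ i N1) => // [i' j' hi'|i' j' hi'].
    by rewrite k2 /Bf' hi ?(md0r tm).
  rewrite /N v2; last by move=> i2 h2; apply: hN0; rewrite /N1 in hi'; nia.
  rewrite v2d ?scaler0 ?subrr ?scaler0 // => i2 h2; rewrite hD hN0 ?scaler0 //.
  by rewrite /N1 in hi'; nia.
- move=> i j; rewrite /N -scalerBr subr_scaler e3d e3.
  rewrite !(vmM tm); set M := _ - r + t0.
  rewrite (_ : _ - r + t0 = M); last by rewrite /M; lia.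
  rewrite -!(vmM tm) vm_D.
  have hl := is_linear_comp (vm_linh A b d) (tm_linl tm M w).
  rewrite -scaleN1r (is_linearZ (tm_linl tm M w)) scaleN1r.
  rewrite -(is_linearZ hl) -(is_linearN hl) -(is_linearB hl) -(is_linearZ hl).
  congr (md (vm A b _ d) M w); rewrite lderM lderE lder_yz.
  rewrite (_ : - q.+1%:Z - 1 = - q.+2%:Z); last by lia.
  rewrite -scalerAl -scalerAr [ly K ^ _ * lE 1]mulrC mulrA -lED.
  rewrite (_ : q_ r - (i + 1)%:~R + 1 = q_ r - i%:~R); last by rewrite intrD; ring.
  rewrite opprD -addrA [X in _ + X]addrC addrA -opprD -scalerDl.
  rewrite (_ : q_ r - (i + 1)%:~R + ((i + 1)%:~R + c) = 0); last by rewrite /c; ring.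
  rewrite scale0r oppr0 add0r -scaleNr.
  have -> : - ((- q.+1%:Z)%:~R) = q.+1%:R :> K by rewrite mulrNz opprK.
  by rewrite scalerA mulVf ?scale1r.
Qed.

Lemma WB_all : (forall v s w, md (D v) s w = q_ s *: md v s w) ->
  WBq md 1 -> forall q, (0 < q)%N -> WBq md q.
Proof. by move=> hD h1; case=> // q _; elim: q => [|q IH] //; apply: WB_step. Qed.

Lemma vm_ordK b d (k : nat) h : (forall l, k%:Z <= l -> mo b l d = 0) -> lord k%:Z h ->
  vm A b h d = 0.
Proof. by move=> hk hh; apply: (pr_ord hh). Qed.

Lemma Sit_R q b d r t0 w (R := fun p i j => md (vm A b (lE (q_ r - i%:~R) * ly K ^ p) d)
    (T%:Z * (i + j - p) - r + t0) w) p i j :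
  Sit q (R p) i j = R (p + q%:Z) i j.
Proof.
elim: q i j => [|q IH] i j; first by rewrite addr0.
rewrite [LHS]/= /Sop -/(Sit q _) !IH /R.
set M := T%:Z * (i + j - (p + q.+1%:Z)) - r + t0.
rewrite (_ : T%:Z * (i - 1 + j - (p + q%:Z)) - r + t0 = M); last by rewrite /M; lia.
rewrite (_ : T%:Z * (i + (j - 1) - (p + q%:Z)) - r + t0 = M); last by rewrite /M; lia.
have hl := is_linear_comp (vm_linh A b d) (tm_linl tm M w).
rewrite -(is_linearB hl); congr (md (vm A b _ d) M w).
rewrite (_ : q_ r - (i - 1)%:~R = q_ r - i%:~R + 1); last by rewrite intrB; ring.
rewrite lED -mulrBl -[X in (_ - X) * _]mulr1 -mulrBr -mulrA; congr (_ * _).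
by rewrite -[lE 1 - 1]/(ly K) -lyzS; congr (_ ^ _); lia.
Qed.

(** Locality: applying (z_1 - z_2)^{k+1} to C1 - C2 puts a series of order k in front of Y(b,x)d,
    which does not reach the modes below k, while those from k on vanish. *)
Lemma WB_Bf k r b d t0 w : WBq md 1 -> cls r b -> (forall l, k%:Z <= l -> mo b l d = 0) ->
  Sit k (Bf T md r b d t0 w) =2 Sit k (Bf' T md r b d t0 w).
Proof.
move=> h1 hb hk i j; have [C1 [C2 [e1 e2 v1 v2 e3]]] := h1 r b hb d w t0.
apply/eqP; rewrite -subr_eq0 -(Sit_ext _ e1) -(Sit_ext _ e2) -!SitD -Sit_sub.
rewrite (Sit_ext _ e3); have := Sit_R (k + 1) b d r t0 w (- 1) i j => /= ->.
rewrite (@vm_ordK b d k) ?(md0l tm) //.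
have := lordM (@lord_E K (q_ r - i%:~R)) (@lord_yz K (-1 + (k + 1)%N%:Z)).
by rewrite add0r => h; apply: (lordW _ h); lia.
Qed.

(** For small t the mode of d kills w; for small s locality brings b next to w. One bound thus
    serves both variables, as the axiom demands. *)
Lemma tF_van b d k r w N : WBq md 1 -> cls r b -> (forall l, k%:Z <= l -> mo b l d = 0) ->
  (forall s, s < N -> md b s w = 0) -> (forall s, s < N -> md d s w = 0) ->
  forall s t, (s < N) || (t < N) -> tF T md b d k w s t = 0.
Proof.
move=> h1 hb hk nb nd s t; have [lt _|ge /= hs] := ltP t N.
  by apply: big1 => a _; rewrite nd ?(md0r tm) ?scaler0 //; nia.
case: (boolP (T%:Z %| s + r)%Z) => [/dvdzP [i hi]|hn]; last exact: (tF_cls T0 tm _ _ _ _ hb hn).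
have es : s = T%:Z * i - r by lia.
have -> : t = T%:Z * 0 + t by lia.
rewrite es -(Sit_Bf T0) (WB_Bf _ _ h1 hb hk) Sit_binom big1 // => a _.
by rewrite /Bf' nb ?(md0r tm) ?scaler0 //; have := ltn_ord a; nia.
Qed.

(** Both sides are continuous in h, so it is enough to test z^{r/T} y^n. For n < -k this is the
    identity with q = -n - k, whose expansions must be [Fp] and [Fm] of G by injectivity. Larger n
    reduce to y^{-k-1} by expanding a positive power of y into exponentials. *)
Lemma WB_hform_cls r b d (k : nat) :
  (forall q, (0 < q)%N -> WBq md q) -> cls r b -> (forall l, k%:Z <= l -> mo b l d = 0) ->
  hform A T md b d k.
Proof.
move=> hW hb hk w; have h1 := hW 1%N isT.
have [Nb hNb] := tm_trunc tm b w; have [Nd hNd] := tm_trunc tm d w.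
pose N := Num.min Nb Nd.
have hN : forall s t, (s < N) || (t < N) -> tF T md b d k w s t = 0.
  by apply: (tF_van h1 hb hk) => s hs; [apply: hNb|apply: hNd]; rewrite /N in hs; lia.
exists N; split=> // M; pose M' := M + T%:Z * k%:Z.
have fz (c : int -> K) := hform_fin T0 c M' hN.
have uM := ubd_md tm b d M w.
pose Lam h := pr (h * ly K ^+ k) (fun l => md (mo b l d) M w) -
  zsum (fun s : int => lres (h * lE (q_ s)) *: tF T md b d k w s (M' - s)).
have lLam : is_linear Lam.
  apply: is_linear_sub; first by move=> a x y; rewrite mulrDl -scalerAl (pr_lin uM).
  move=> a x y; rewrite (zsum_raddf (g := fun z => a *: z)) ?scaler0 //; last first.
    by move=> z z'; rewrite scalerDr.
  rewrite -zsumD //; last first.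
    have [n hn] := fz (fun s => a * lres (x * lE (q_ s))); exists n => s /hn.
    by rewrite scalerA.
  apply: eq_zsum => s; rewrite mulrDl lresD -scalerAl lresZ scalerDl scalerA //.
have cLam h : lord 0 h -> Lam h = 0.
  move=> hh; rewrite /Lam zsum0 => [|s]; last first.
    by rewrite lres_ord ?scale0r //; have := lordM hh (@lord_E K (q_ s)); rewrite addr0.
  rewrite (pr_ord (N := k%:Z)) ?subrr // => [|l hl]; last by rewrite hk ?(md0l tm).
  by have := lordM hh (@lord_yX K k); rewrite add0r.
have base i p : (k < p)%N -> Lam (lE (q_ r - i%:~R) * ly K ^ (- p%:Z)) = 0.
  move=> hp; pose q := (p - k)%N; have q0 : (0 < q)%N by rewrite /q; lia.
  pose t0 := M + r; pose j := - i - q%:Z.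
  have [C1 [C2 [e1 e2 v1 v2 e3]]] := hW q q0 r b hb d w t0.
  pose G i j := tF T md b d k w (T%:Z * i - r) (T%:Z * j + t0).
  pose N' := - (absz N + absz r + absz t0)%N%:Z.
  have hG i' j' : (i' < N') || (j' < N') -> G i' j' = 0.
    move=> h; apply: hN; rewrite /N' in h.
    by case/orP: h => h; apply/orP; [left|right]; nia.
  have GB : Sit k (Bf T md r b d t0 w) =2 G by move=> i' j'; rewrite Sit_Bf.
  have kq : (0 < q + k)%N by lia.
  have f1 : C1 =2 Fp G (q + k).
    apply: (@Sit_inj1 _ _ (k + q) _ _ (N' - (q + k)%N%:Z)).
    - by move=> i' j'; rewrite SitD (Sit_ext _ e1) GB addnC (Sit_Fp hG kq).
    - move=> i' j' hj; apply: v1 => j2 hj2; apply: hNd; rewrite /N' /N in hj; nia.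
    - move=> i' j'; exact: (Fp_van hG).
  have f2 : C2 =2 Fm G (q + k).
    apply: (@Sit_inj2 _ _ (k + q) _ _ N').
    - move=> i' j'; rewrite SitD (Sit_ext _ e2) -(WB_Bf _ _ h1 hb hk) GB addnC.
      by rewrite (Sit_Fm hG kq).
    - move=> i' j' hj; apply: v2 => j2 hj2; apply: hNb; rewrite /N' /N in hj; nia.
    - move=> i' j'; exact: (Fm_van hG).
  have := e3 i j; rewrite f1 f2 (Fpm hG).
  rewrite (_ : T%:Z * (i + j + q%:Z) - r + t0 = M); last by rewrite /j /t0; lia.
  rewrite (vmM tm) => e4; rewrite /Lam -mulrA -[ly K ^+ k]/(ly K ^ k%:Z) -lyzD.
  rewrite (_ : - p%:Z + k%:Z = - q%:Z); last by rewrite /q; lia.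
  rewrite -e4 (@zsum_class _ _ T r T0 (fz _)); last first.
    by move=> s hs; rewrite (tF_cls T0 tm _ _ _ _ hb) ?scaler0.
  apply/eqP; rewrite subr_eq0; apply/eqP; apply: eq_zsum => i'; congr (_ *: _).
    rewrite /kap mulrAC -lED (_ : (q + k)%N = p); last by rewrite /q; lia.
    by congr (lres (lE _ * _)); rewrite (q_D K T) q_N (q_T K T0) intrB; ring.
  by rewrite /G; congr (tF _ _ _ _ _ _ _ _); rewrite /M' /t0 /j /q; lia.
have all n : Lam (lE (q_ r) * ly K ^ n) = 0.
  have [lt|ge] := ltP n (- k%:Z).
    have := base 0 (absz n); rewrite subr0 (_ : - Posz (absz n) = n); last by lia.
    by apply; lia.
  have -> : n = - k.+1%:Z + (absz (n + k.+1%:Z))%:Z by lia.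
  set m := absz _; rewrite lyzD -[ly K ^ m%:Z]/(ly K ^+ m) lyX_sum !mulr_sumr.
  rewrite (is_linear_sum lLam) big1 // => a _.
  rewrite -!scalerAr (is_linearZ lLam) mulrA mulrAC -lED.
  have := base (- a%:Z) k.+1 (leqnn _); rewrite mulrNz opprK -pmulrn => ->.
  by rewrite scaler0.
move=> h; apply/eqP; rewrite -subr_eq0; apply/eqP.
apply: (@cont_ext_lead _ _ Lam 0 (fun n => lE (q_ r) * ly K ^ n)) => // n.
  by have := lordM (@lord_E K (q_ r)) (@lord_yz K n); rewrite add0r.
have := lordM_co (@lord_E K (q_ r)) (@lord_yz K n); rewrite add0r => ->.
rewrite (lcoE _ 0) expr0 divr1 mul1r.
have := lordM_co (@lord_yz K n) (@lord_yz K (- n)); rewrite -lyzD subrr expr0z lco1 /=.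
by move=> e; apply/eqP => h0; move/eqP: e; rewrite h0 mul0r; apply/negP/oner_neq0.
Qed.

Lemma hformD u1 u2 d k : hform A T md u1 d k -> hform A T md u2 d k ->
  hform A T md (u1 + u2) d k.
Proof.
move=> h1 h2 w; have [N1 [a1 b1]] := h1 w; have [N2 [a2 b2]] := h2 w.
have tD s t : tF T md (u1 + u2) d k w s t = tF T md u1 d k w s t + tF T md u2 d k w s t.
  rewrite -big_split /=; apply: eq_bigr => a _.
  by rewrite (is_linearD (tm_linl tm _ _)) scalerDr.
exists (Num.min N1 N2); split=> [s t hst|M h].
  by rewrite tD a1 ?a2 ?addr0 //; lia.
transitivity (pr (h * ly K ^+ k) (fun l => md (mo u1 l d) M w) +
  pr (h * ly K ^+ k) (fun l => md (mo u2 l d) M w)).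
  rewrite -prDr; try exact: (ubd_md tm).
  apply: eq_pr => l; rewrite (is_linearD (vmode_linl A l d)).
  by rewrite (is_linearD (tm_linl tm M w)).
rewrite b1 b2 -(zsumD (hform_fin T0 _ _ a1) (hform_fin T0 _ _ a2)).
by apply: eq_zsum => s; rewrite tD scalerDr.
Qed.

Lemma WB_hform : (forall q, (0 < q)%N -> WBq md q) ->
  forall b d, exists k, hform A T md b d k.
Proof.
move=> hW b d; rewrite (pj_sum b).
have hr (r : nat) : exists k, hform A T md (pj r b) d k.
  have [N hN] := ubd_vm A (pj r b) d; exists (absz N).
  apply: (WB_hform_cls hW (pj_cls r b)) => l hl; apply: hN; lia.
elim: (index_enum _) => [|r s [k2 h2]]; last first.
  rewrite big_cons; have [k1 h1] := hr r; exists (k1 + k2)%N.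
  by apply: hformD; [apply: (hform_le T0 _ h1)|apply: (hform_le T0 _ h2)]; lia.
rewrite big_nil; exists 0%N => w; exists 0.
have t0 s t : tF T md 0 d 0 w s t = 0.
  by apply: big1 => a _; rewrite (md0l tm) scaler0.
split=> [s t _|M h]; first exact: t0.
rewrite zsum0 => [|s]; last by rewrite t0 scaler0.
by apply: pr0 => l; rewrite vm0l (md0l tm).
Qed.

End Module.
End TwistedBorcherds.

(** * Products of modes and the space of vacuum vectors *)

Section Products.
Variable K : numFieldType.
Variable V : lmodType K.
Variable A : vertex_algebra V.
Variable T : nat.
Hypothesis T0 : (0 < T)%N.
Local Notation mo := (vmode A).
Local Notation D := (vaD A).
Local Notation q_ s := (s%:~R / T%:R : K).
Variable cls : int -> V -> Prop.
Variable pj : nat -> V -> V.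
Hypothesis pj_cls : forall r v, cls r%:Z (pj r v).
Hypothesis pj_sum : forall v, v = \sum_(r < T) pj r v.
Local Notation WBq := (WBq A T cls).
Implicit Types (b d v : V).

(* the r with V^r supporting the modes of exponent s/T *)
Definition cl (s : int) : nat := absz ((- s) %% T%:Z)%Z.

Lemma cl_lt s : (cl s < T)%N.
Proof. by rewrite /cl; have := ltz_pmod (- s) (_ : 0 < T%:Z); have := modz_ge0 (- s) (_ : T%:Z != 0); lia. Qed.
Lemma cl_dvd s : (T%:Z %| s + (cl s)%:Z)%Z.
Proof.
apply/dvdzP; exists (- (divz (- s) T%:Z)).
have := divz_eq (- s) T%:Z; have := modz_ge0 (- s) (_ : T%:Z != 0); rewrite /cl; lia.
Qed.
Lemma cl_eq s (r : nat) : (r < T)%N -> (T%:Z %| s + r%:Z)%Z -> r = cl s.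
Proof.
move=> hr /dvdzP [x hx]; have /dvdzP [x' hx'] := cl_dvd s; have := cl_lt s.
move=> h; have : x = x' by nia.
by move=> e; rewrite e in hx; lia.
Qed.
Lemma cl0 : cl 0 = 0%N.
Proof. by rewrite /cl oppr0 mod0z. Qed.

Lemma md_pj (W : lmodType K) (md : V -> int -> W -> W) : tmod A T cls md -> forall v s w,
  md v s w = md (pj (cl s) v) s w.
Proof.
move=> tm v s w; rewrite {1}(pj_sum v) (is_linear_sum (tm_linl tm s w)).
rewrite (bigD1 (Ordinal (cl_lt s))) //= big1 ?addr0 // => r hr.
apply: (tm_cls tm _ (pj_cls r v)); apply: contra hr => /cl_eq h.
by apply/eqP/val_inj/h.
Qed.

(** The quantifier order is the point: Q depends only on b, d, s, t and N, so relations between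
    modes transfer from one module to another. *)
Lemma product_span_cls r b d s t (N : int) : cls r b -> exists Q, forall (W : lmodType K) (md : V -> int -> W -> W),
  tmod A T cls md -> (forall q, (0 < q)%N -> WBq md q) -> forall w,
  (forall s', s' < N -> md b s' w = 0) -> (forall s', s' < N -> md d s' w = 0) ->
  md b s (md d t w) = md Q (s + t) w.
Proof.
move=> hb; case: (boolP (T%:Z %| s + r)%Z) => [/dvdzP [i hi]|hn]; last first.
  by exists 0 => W md tm _ w _ _; rewrite (tm_cls tm _ hb hn) (md0l tm).
have es : s = T%:Z * i - r by lia.
(* In the binomial expansion of (z_1 - z_2)^q C1, terms with a >= a0 have such a low exponent in z_2
   that C1 vanishes. By the size of q, those with a < a0 have such a low exponent in z_1 that C2
   vanishes, so C1 equals the residue term. *)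
pose a0 := (absz t + absz N)%N.+1; pose q := (a0 + absz s + absz N)%N.+1.
pose g a := vm A b (lE (q_ r - (i - (q%:Z - a%:Z))%:~R) * ly K ^ (- q%:Z)) d.
exists (\sum_(a < q.+1) if (a < a0)%N then ('C(q, a)%:R * (-1) ^+ a) *: g a else 0).
move=> W md tm hW w nb nd; have [C1 [C2 [e1 e2 v1 v2 e3]]] := hW q isT r b hb d w t.
have -> : md b s (md d t w) = Bf T md r b d t w i 0.
  by rewrite /Bf mulr0 add0r es.
rewrite -e1 Sit_binom (is_linear_sum (tm_linl tm _ _)); apply: eq_bigr => a _.
have [lt|ge] := ltnP a a0; last first.
  rewrite v1 ?scaler0 ?(md0l tm) // => j hj; apply: nd; rewrite /a0 in ge; nia.
rewrite (is_linearZ (tm_linl tm _ _)); congr (_ *: _).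
rewrite -[C1 _ _](subrK (C2 (i - (q%:Z - a%:Z)) (0 - a%:Z))) e3 v2 ?addr0.
  congr (md _ _ w); rewrite es; lia.
move=> i' hi'; apply: nb; rewrite /q /a0 in hi' lt; nia.
Qed.

Lemma product_span b d s t (N : int) : exists Q, forall (W : lmodType K) (md : V -> int -> W -> W),
  tmod A T cls md -> (forall q, (0 < q)%N -> WBq md q) -> forall w,
  (forall s', s' < N -> md b s' w = 0) -> (forall s', s' < N -> md d s' w = 0) ->
  md b s (md d t w) = md Q (s + t) w.
Proof.
have [Q hQ] := @product_span_cls _ (pj (cl s) b) d s t N (pj_cls _ _).
exists Q => W md tm hW w nb nd; rewrite (md_pj tm) (hQ _ _ tm hW) // => s' hs'.
case: (boolP (T%:Z %| s' + (cl s)%:Z)%Z) => h; last exact: (tm_cls tm _ (pj_cls _ _) h).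
by rewrite (cl_eq (cl_lt s) h) -(md_pj tm) nb.
Qed.

Section Vacuum.
Variable W : lmodType K.
Variable md : V -> int -> W -> W.
Hypothesis tm : tmod A T cls md.
Hypothesis hW : forall q, (0 < q)%N -> WBq md q.

(** Intrinsic to the action, hence preserved by isomorphisms. For an irreducible graded module it is
    the bottom component, by [gr_Om] and [Om_gr]. *)
Definition Om (w : W) := forall v s, s < 0 -> md v s w = 0.

(** The identity with q = 1 at i = -1, j = 0: there C2 vanishes, and C1 is the product of zero modes
    because (z_1 - z_2) C1 at (0,0) has only one non-zero term. *)
Lemma Om_product b d w : cls 0 b -> Om w ->
  md (vm A b (lE 1 * ly K ^ (-1)) d) 0 w = md b 0 (md d 0 w).
Proof.
move=> hb hw; have [C1 [C2 [e1 e2 v1 v2 e3]]] := @hW 1%N isT _ _ hb d w 0.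
have := e3 (-1) 0; rewrite v2 => [|i hi]; last by apply: hw; nia.
rewrite subr0 mul0r sub0r mulrN1z opprK.
rewrite (_ : T%:Z * (-1 + 0 + 1%:Z) - 0 + 0 = 0) ?mulr0 // => <-.
have := e1 0 0; rewrite /Bf !mulr0 ?subr0 ?addr0 => <-.
by rewrite /= /Sop (v1 (0 - 1)) ?subr0 // => j hj; apply: hw; nia.
Qed.

Lemma Om_zero0 b d w : cls 0 b -> Om w -> md (vm A b (lE 1 * ly K ^ (-2)) d) 0 w = 0.
Proof.
move=> hb hw; have [C1 [C2 [e1 e2 v1 v2 e3]]] := @hW 2%N isT _ _ hb d w 0.
have := e3 (-1) (-1); rewrite v2 => [|i hi]; last by apply: hw; nia.
rewrite v1 => [|i hi]; last by apply: hw; nia.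
rewrite subr0 mul0r sub0r mulrN1z opprK.
by rewrite (_ : T%:Z * (-1 + -1 + 2%:Z) - 0 + 0 = 0) ?mulr0.
Qed.

(** With t0 = r - T both exponents -r and t0 are negative, so C1 and C2 vanish at i = j = 0, while
    the residue term has total exponent T - r + t0 = 0. *)
Lemma Om_zero (r : nat) b d w : (0 < r < T)%N -> cls r%:Z b -> Om w ->
  md (vm A b (lE (q_ r%:Z) * ly K ^ (-1)) d) 0 w = 0.
Proof.
move=> hr hb hw; have [C1 [C2 [e1 e2 v1 v2 e3]]] := @hW 1%N isT _ _ hb d w (r%:Z - T%:Z).
have := e3 0 0; rewrite v2 => [|i hi]; last by apply: hw; nia.
rewrite v1 => [|i hi]; last by apply: hw; nia.
by rewrite subr0 subr0 (_ : T%:Z * (0 + 0 + 1%:Z) - r%:Z + (r%:Z - T%:Z) = 0) //; lia.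
Qed.

Lemma Om_stable v w : Om w -> Om (md v 0 w).
Proof.
move=> hw b s hs; have [Q hQ] := product_span b v s 0 0.
by rewrite (hQ _ _ tm hW) => [|s' hs'|s' hs']; rewrite hw ?addr0.
Qed.

End Vacuum.
End Products.

(** * Rational test functions *)
Lemma dvdz_eqD (d a b c : int) : (d %| a)%Z -> (d %| b)%Z -> c = a + b -> (d %| c)%Z.
Proof. by move=> /dvdzP [x hx] /dvdzP [x' hx'] ->; apply/dvdzP; exists (x + x'); lia. Qed.

Section TestFunctions.
Variable K : numFieldType.
Variable T : nat.
Hypothesis T0 : (0 < T)%N.
Local Notation L := (laurent K).
Local Notation q_ s := (s%:~R / T%:R : K).
Local Notation y := (ly K).

(* expansions at z = 1 of elements of z^{r/T} C[z, 1/z, 1/(z-1)] with exponents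
   at least a/T at z = 0 and at most c/T at z = oo *)
Inductive Tf (r a c : int) : L -> Prop :=
| Tf0 : Tf r a c 0
| TfS k h1 h2 : Tf r a c h1 -> Tf r a c h2 -> Tf r a c (k *: h1 + h2)
| Tfg s (p : nat) : (T%:Z %| s - r)%Z -> a <= s -> s - T%:Z * p%:Z <= c ->
    Tf r a c (lE (q_ s) * y ^ (- p%:Z)).

Lemma TfD r a c h1 h2 : Tf r a c h1 -> Tf r a c h2 -> Tf r a c (h1 + h2).
Proof. by move=> h h'; rewrite -[h1]scale1r; apply: TfS. Qed.
Lemma TfZ r a c k h : Tf r a c h -> Tf r a c (k *: h).
Proof. by move=> hh; rewrite -[k *: h]addr0; apply: TfS => //; apply: Tf0. Qed.
Lemma TfN r a c h : Tf r a c h -> Tf r a c (- h).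
Proof. by move=> hh; rewrite -scaleN1r; apply: TfZ. Qed.
Lemma TfB r a c h1 h2 : Tf r a c h1 -> Tf r a c h2 -> Tf r a c (h1 - h2).
Proof. by move=> h h'; apply: TfD => //; apply: TfN. Qed.
Lemma Tf_sum r a c (I : Type) (s : seq I) (F : I -> L) :
  (forall i, Tf r a c (F i)) -> Tf r a c (\sum_(i <- s) F i).
Proof.
move=> h; elim: s => [|i s IH]; first by rewrite big_nil; apply: Tf0.
by rewrite big_cons; apply: TfD.
Qed.
Lemma TfW r a c r' a' c' h : (T%:Z %| r - r')%Z -> a' <= a -> c <= c' ->
  Tf r a c h -> Tf r' a' c' h.
Proof.
move=> hr ha hc; elim=> [|k h1 h2 _ IH1 _ IH2|s p e1 e2 e3]; first exact: Tf0.
  exact: TfS.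
apply: Tfg; [|lia|lia].
by apply: (dvdz_eqD e1 hr); lia.
Qed.

Lemma TfM r a c r' a' c' h h' : Tf r a c h -> Tf r' a' c' h' ->
  Tf (r + r') (a + a') (c + c') (h * h').
Proof.
elim=> [|k h1 h2 _ IH1 _ IH2|s p e1 e2 e3] hh'; first by rewrite mul0r; apply: Tf0.
  by rewrite mulrDl -scalerAl; apply: TfS; [apply: IH1|apply: IH2].
elim: hh' => [|k h1 h2 _ IH1 _ IH2|s' p' e1' e2' e3']; first by rewrite mulr0; apply: Tf0.
  by rewrite mulrDr -scalerAr; apply: TfS.
rewrite mulrACA -lED -lyzD -(q_D K T) (_ : - p%:Z - p'%:Z = - (p + p')%N%:Z); last by lia.
apply: Tfg; [|lia|lia].
by apply: (dvdz_eqD e1 e1'); lia.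
Qed.

Lemma Tf_der r a c h : Tf r a c h -> Tf r a c (lder h).
Proof.
elim=> [|k h1 h2 _ IH1 _ IH2|s p e1 e2 e3]; first by rewrite linear0; apply: Tf0.
  by rewrite linearP; apply: TfS.
rewrite lderM lderE lder_yz -scalerAl -scalerAr; apply: TfS; first exact: Tfg.
apply: TfZ; rewrite [_ ^ _ * lE 1]mulrC mulrA -lED.
rewrite (_ : q_ s + 1 = q_ (s + T%:Z)); last by rewrite (q_D K T) -[T%:Z]mulr1 (q_T K T0).
rewrite (_ : - p%:Z - 1 = - p.+1%:Z); last by lia.
apply: Tfg; [|lia|lia].
by apply: (dvdz_eqD e1 (dvdzz T%:Z)); lia.
Qed.
Lemma Tf_iter_der (i : nat) r a c h : Tf r a c h -> Tf r a c (iter i (@lder K) h).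
Proof. by move=> hh; elim: i => //= i IH; apply: Tf_der. Qed.

Lemma Tf_E s : Tf s s s (lE (q_ s)).
Proof.
rewrite -[lE _]mulr1 -(expr0z y) -[0]/(- 0%N%:Z); apply: Tfg; rewrite ?subrr ?dvdz0 //; lia.
Qed.
Lemma Tf_yV : Tf 0 0 (- T%:Z) (y ^ (- 1)).
Proof.
have e : (0 : K) = q_ 0 by rewrite mul0r.
rewrite -[y ^ _]mul1r -lE0 {1}e.
by apply: (@Tfg 0 0 _ 0 1%N); rewrite ?subrr ?dvdz0 //; lia.
Qed.
Lemma Tf_zyV : Tf 0 T%:Z 0 (lE 1 * y ^ (- 1)).
Proof.
have {1}-> : 1 = q_ T%:Z by rewrite -[T%:Z]mulr1 (q_T K T0).
by apply: (@Tfg 0 T%:Z 0 T%:Z 1%N); rewrite ?subr0 ?dvdzz //; lia.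
Qed.
Lemma Tf_1 : Tf 0 0 0 1.
Proof. by have := Tf_E 0; rewrite mul0r lE0. Qed.
Lemma TfX r a c h n : Tf r a c h -> Tf (r * n%:Z) (a * n%:Z) (c * n%:Z) (h ^+ n).
Proof.
move=> hh; elim: n => [|n IH]; first by rewrite expr0 !mulr0; apply: Tf_1.
by rewrite exprS !intS !mulrDr !mulr1; apply: TfM.
Qed.

(* equal to 1 to order n at z = 0 and to 0 to order n at z = oo *)
Definition chi (n : nat) : L := \sum_(i < n.+1)
  ((- y ^ (-1)) ^+ (n + n - i) * (lE 1 * y ^ (- 1)) ^+ i) *+ 'C(n + n, i).

Lemma chi_term (i j : nat) c : Tf 0 (T%:Z * i%:Z) (- (T%:Z * j%:Z))
  (((- y ^ (-1)) ^+ j * (lE 1 * y ^ (- 1)) ^+ i) *+ c).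
Proof.
rewrite -scaler_nat; apply: TfZ.
have := TfM (TfX j (TfN Tf_yV)) (TfX i Tf_zyV); rewrite !mul0r addr0.
by apply: TfW; rewrite ?subrr ?dvdz0 //; lia.
Qed.

Lemma chi_inf n : Tf 0 0 (- (T%:Z * n%:Z)) (chi n).
Proof.
apply: Tf_sum => i; have h := chi_term i (n + n - i) 'C(n + n, i).
apply: TfW h; rewrite ?subrr ?dvdz0 //; have := ltn_ord i; nia.
Qed.
Lemma chi_zero n : Tf 0 (T%:Z * n%:Z) 0 (1 - chi n).
Proof.
have -> : (1 : L) = \sum_(i < (n.+1 + n)%N)
   ((- y ^ (-1)) ^+ (n + n - i) * (lE 1 * y ^ (- 1)) ^+ i) *+ 'C(n + n, i).
  rewrite -[LHS](expr1n L (n + n)); have {1}-> : (1 : L) = - y ^ (-1) + lE 1 * y ^ (-1).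
    by rewrite lE1y mulrDl mul1r lyV addrA addNr add0r.
  by rewrite exprDn addSn.
rewrite big_split_ord /= -/(chi n) [X in X - _]addrC addrK.
apply: Tf_sum => i; have h := chi_term (n.+1 + i) (n + n - (n.+1 + i)) 'C(n + n, n.+1 + i).
by apply: TfW h; rewrite ?subrr ?dvdz0 //; nia.
Qed.

(** Split h = h chi + h (1 - chi): the cutoff corrects the order at oo in the first summand and the
    order at 0 in the second. *)
Lemma Tf_cap r a c a' c' h : Tf r a c h -> Tf r a' c' h -> Tf r a c' h.
Proof.
move=> h1 h2; pose n := (absz c + absz c' + absz a + absz a')%N.
have -> : h = h * chi n + h * (1 - chi n) by rewrite -mulrDr addrC subrK mulr1.
apply: TfD.
  by apply: TfW (TfM h1 (chi_inf n)); rewrite ?addr0 ?subrr ?dvdz0 // /n; nia.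
by apply: TfW (TfM h2 (chi_zero n)); rewrite ?addr0 ?subrr ?dvdz0 // /n; nia.
Qed.

Lemma chi_sub n m : (n <= m)%N -> Tf 0 (T%:Z * n%:Z) (- (T%:Z * n%:Z)) (chi m - chi n).
Proof.
move=> le; apply: (@Tf_cap 0 _ 0 0).
  rewrite (_ : chi m - chi n = (1 - chi n) - (1 - chi m)); last by ring.
  apply: TfB; first exact: chi_zero.
  by apply: TfW (chi_zero m); rewrite ?subrr ?dvdz0 //; nia.
apply: TfB; last exact: chi_inf.
by apply: TfW (chi_inf m); rewrite ?subrr ?dvdz0 //; nia.
Qed.
Lemma chi_der n : Tf 0 (T%:Z * n%:Z) (- (T%:Z * n%:Z)) (lder (chi n)).
Proof.
apply: (@Tf_cap 0 _ 0 0); last exact/Tf_der/chi_inf.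
have -> : lder (chi n) = - lder (1 - chi n) by rewrite raddfB /= lder1 sub0r opprK.
exact/TfN/Tf_der/chi_zero.
Qed.
Lemma chi_sq n : Tf 0 (T%:Z * n%:Z) (- (T%:Z * n%:Z)) (chi n * chi n - chi n).
Proof.
have := TfM (TfN (chi_inf n)) (chi_zero n); rewrite !addr0 add0r.
by rewrite (_ : - chi n * (1 - chi n) = chi n * chi n - chi n); last ring.
Qed.

Lemma lres_Ey (i p : nat) : (0 < i < p)%N -> lres (lE i%:R * y ^ (- p%:Z)) = 0.
Proof.
case: i => // i; elim: i p => [|i IH] p hp; first by rewrite lres_E1y //; lia.
rewrite -[i.+2%:R]natr1 lED lE1y [_ * (1 + y)]mulrDr mulr1 mulrDl lresD IH; last by lia.
rewrite -mulrA -lyzS (_ : - p%:Z + 1 = - p.-1%:Z); last by lia.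
by rewrite IH ?addr0 //; lia.
Qed.
(** Residue theorem: h dz/z is regular at 0 and at oo, so it has no residue at its only possible
    pole z = 1. *)
Lemma lres_Tf a c h : 0 < a -> c < 0 -> Tf 0 a c h -> lres h = 0.
Proof.
move=> ha hc; elim=> [//|k h1 h2 _ IH1 _ IH2|s p]; first by rewrite lresD lresZ IH1 IH2 mulr0 addr0.
rewrite subr0 => /dvdzP [i ei] e2 e3; rewrite ei [i * _]mulrC (q_T K T0).
have -> : i = (absz i)%:Z by nia.
by apply: lres_Ey; nia.
Qed.
Lemma chi_yV n : (0 < n)%N -> Tf 0 T%:Z (- T%:Z) (chi n - (- y ^ (-1))).
Proof.
move=> hn; apply: (@Tf_cap 0 _ 0 0).
  rewrite (_ : _ - _ = lE 1 * y ^ (-1) - (1 - chi n)).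
    apply: TfB; first exact: Tf_zyV.
    by apply: TfW (chi_zero n); rewrite ?subrr ?dvdz0 //; nia.
  by rewrite lE1y mulrDl mul1r lyV; ring.
apply: TfB; last exact/TfN/Tf_yV.
by apply: TfW (chi_inf n); rewrite ?subrr ?dvdz0 //; nia.
Qed.
(** The function -1/(z-1) also tends to 1 at 0 and to 0 at oo, so it has the same residue as chi by
    [lres_Tf]. *)
Lemma lres_chi n : (0 < n)%N -> lres (chi n) = -1.
Proof.
move=> hn; rewrite -[chi n](subrK (- y ^ (-1))) lresD lresN lres_yV.
by rewrite (lres_Tf _ _ (chi_yV hn)) ?add0r //; lia.
Qed.
(** The derivative of z^i chi has no residue. It equals i z^i chi plus z^i chi', and the latter
    still vanishes at both ends because |i| < n. *)
Lemma lres_Echi (i : int) n : i != 0 -> (absz i < n)%N -> lres (lE i%:~R * chi n) = 0.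
Proof.
move=> ni hn; have := res_der (lE i%:~R * chi n).
rewrite lderM lderE lcoD -scalerAl lcoZ -!/(lres _).
rewrite [X in _ + X](@lres_Tf (T%:Z * n%:Z + T%:Z * i) (- (T%:Z * n%:Z) + T%:Z * i)); try nia.
  by rewrite addr0 => /eqP; rewrite mulf_eq0 intr_eq0 (negbTE ni) => /eqP.
have := TfM (Tf_E (T%:Z * i)) (chi_der n); rewrite (q_T K T0).
by apply: TfW; rewrite ?addr0 ?subr0 ?dvdz_mulr //; lia.
Qed.

End TestFunctions.

(** * Telescoping the division by z_1 - z_2 *)

Section Telescope.
Variable K : numFieldType.
Variable V : lmodType K.
Variable A : vertex_algebra V.
Variable M : lmodType K.
Variable f : V -> M.
Hypothesis hf : is_linear f.
Variable u : V.
Implicit Types (b d : V) (h : laurent K).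
Local Notation y := (ly K).

Lemma lyV1 : y * y ^ (-1) = 1 :> laurent K.
Proof. by rewrite exprN1 mulrV // ly_unit. Qed.

Lemma Xf_step1 q h1 h2 : @abd3 K M q -> Srel q ->
  Xf q h1 h2 = Xf q (y ^ (-1) * h1) (y * h2) + pr (y ^ (-1) * h1) (fun m => pr h2 (q 0 m)).
Proof. by move=> a s; rewrite -Xf_y // mulrA lyV1 mul1r. Qed.
Lemma Xf_step2 q h1 h2 : @abd3 K M q -> Srel q ->
  Xf q h1 h2 = Xf q (y * h1) (y ^ (-1) * h2) - pr h1 (fun m => pr (y ^ (-1) * h2) (q 0 m)).
Proof. by move=> a s; rewrite Xf_y // addrK mulrA lyV1 mul1r. Qed.

(** Each step moves a factor y from h1 to h2, at the cost of a term killed by the hypothesis. Once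
    h2 has large order in x_2, the array [q12] pairs to zero with it. *)
Lemma Xf12_van b d h1 h2 : (forall (k : nat) g, f (vm A b (y ^ (- k%:Z) * h1) g) = 0) ->
  Xf (q12 A f u b d) h1 h2 = 0.
Proof.
move=> h; have [J hJ] := q12_n A hf u b d; have [n0 hn0] := lord_exists h2.
have hs (P : nat) : Xf (q12 A f u b d) h1 h2 =
    Xf (q12 A f u b d) (y ^ (- P%:Z) * h1) (y ^+ P * h2).
  elim: P => [|P ->]; first by rewrite expr0 !mul1r.
  rewrite Xf_step1; [|exact: q12_abd|exact: q12_S].
  rewrite pr_q12 // !mulrA -exprS -lyzD (_ : -1 - P%:Z = - P.+1%:Z); last by lia.
  by rewrite h addr0.
rewrite (hs (absz J + absz n0)%N) /Xf /tp; apply: pr0 => l; apply: pr0 => m.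
apply: (pr_ord (N := J)) => [|n hn]; last exact: hJ.
apply: (lordW _ (lordM (lord_E (-1)) (lordM (lordX (n := absz J + absz n0) (lord_y K)) hn0))); lia.
Qed.

Lemma Xf21_van b d h1 h2 : (forall (k : nat) g, f (vm A d (y ^ (- k%:Z) * h2) g) = 0) ->
  Xf (q21 A f u b d) h1 h2 = 0.
Proof.
move=> h; have [J hJ] := q21_m A hf u b d; have [n0 hn0] := lord_exists h1.
have hs (P : nat) : Xf (q21 A f u b d) h1 h2 =
    Xf (q21 A f u b d) (y ^+ P * h1) (y ^ (- P%:Z) * h2).
  elim: P => [|P ->]; first by rewrite expr0 !mul1r.
  rewrite Xf_step2; [|exact: q21_abd|exact: q21_S].
  rewrite pr_q21 // !mulrA -exprS -lyzD (_ : -1 - P%:Z = - P.+1%:Z); last by lia.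
  by rewrite h subr0.
rewrite (hs (absz J + absz n0)%N) /Xf /tp; apply: pr0 => l.
apply: (pr_ord (N := J)) => [|m hm]; last by apply: pr0 => n; apply: hJ.
apply: (lordW _ (lordM (lordX (n := absz J + absz n0) (lord_y K)) hn0)); lia.
Qed.

Lemma pr_E al (I : nat) (psi : int -> M) : (forall l, I%:Z <= l -> psi l = 0) ->
  pr (lE al) psi = \sum_(a < I) (al ^+ a / (a`!)%:R) *: psi a%:Z.
Proof.
move=> h; have [r -> hr] := lE_trunc al I; have up : ubd psi by exists I%:Z.
rewrite prDl // (pr_ord hr h) addr0 (is_linear_sum (pr_lin up)).
by apply: eq_bigr => a _; rewrite prZl // pr_mon.
Qed.

(** When h1 behaves like z^{al} under derivation, Taylor's formula reads h1(x_2 + x_0) = e^{al x_0}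
    h1(x_2), and the iterate collapses to a single vector. Only l >= -1 matters, since y^{-1} has
    order -1. *)
Lemma tp_q0 b d al h1 h2 (N : nat) : (forall l, N%:Z <= l -> vmode A b l d = 0) ->
  (forall (a : nat) l, -1 <= l -> f (vm A (vmode A b l d) (iter a (@lder K) h1 * h2) u) =
     al ^+ a *: f (vm A (vmode A b l d) (h1 * h2) u)) ->
  tp (q0 A f u b d) (y ^ (-1)) h1 h2 = f (vm A (vm A b (lE al * y ^ (-1)) d) (h1 * h2) u).
Proof.
move=> hN ha; pose phi c := f (vm A c (h1 * h2) u).
have hphi : is_linear phi by apply: is_linear_comp hf => a x x'; rewrite (vm_linb A).
have up : ubd (fun l => phi (vmode A b l d)).
  by exists N%:Z => l /hN ->; apply: is_linear0.
transitivity (pr (y ^ (-1)) (fun l => pr (lE al) (fun a => phi (vmode A b (l + a) d)))); last first.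
  apply: etrans (pr_mul _ _ up) _.
  rewrite -[RHS]/(phi _) /vm (pr_raddf _ hphi) 1?mulrC //; exact: ubd_vm.
apply: eq_zsum => l; have [lt|le] := ltP l (-1).
  by rewrite (@lord_yz K (-1)) ?scale0r.
congr (_ *: _); rewrite (@q0_eval _ _ _ _ _ hf _ _ _ _ _ _ N.+1); last by move=> k hk; apply: hN; lia.
rewrite (@pr_E _ N.+1); last by move=> k hk; rewrite hN ?(is_linear0 hphi) //; lia.
by apply: eq_bigr => a _; rewrite ha ?scalerA 1?mulrC //; lia.
Qed.
End Telescope.

Lemma fin_unif (P : nat -> nat -> Prop) : (forall i, exists N, forall n, (N <= n)%N -> P i n) ->
  forall m, exists N, forall n, (N <= n)%N -> forall i, (i < m)%N -> P i n.
Proof.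
move=> h; elim=> [|m [N hN]]; first by exists 0%N.
have [N' hN'] := h m; exists (maxn N N') => n hn i; rewrite ltnS leq_eqVlt => /orP[/eqP ->|hi].
  by apply: hN'; lia.
by apply: hN => //; lia.
Qed.

(** * The coinduced module *)
Section Coinduced.
Variable K : numFieldType.
Variable V : lmodType K.
Variable A : vertex_algebra V.
Variable T : nat.
Hypothesis T0 : (0 < T)%N.
Local Notation L := (laurent K).
Local Notation vac := (vac A).
Local Notation D := (vaD A).
Local Notation mo := (vmode A).
Local Notation q_ s := (s%:~R / T%:R : K).
Local Notation Tf := (@Tf K T).
Variable cls : int -> V -> Prop.
Variable pj : nat -> V -> V.
Hypothesis pj_cls : forall r v, cls r%:Z (pj r v).
Hypothesis pj_sum : forall v, v = \sum_(r < T) pj r v.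
Hypothesis pj_lin : forall r, is_linear (pj r).
Hypothesis pj_id : forall r v (r' : nat), cls r v -> (r' < T)%N ->
  pj r' v = if (T%:Z %| r - r'%:Z)%Z then v else 0.
Hypothesis cls_sub : forall r, is_subspace (cls r).
Hypothesis cls_vac : cls 0 vac.
Hypothesis cls_mode : forall r r' b d l, cls r b -> cls r' d -> cls (r + r') (mo b l d).
Variable M : lmodType K.
Implicit Types (b d u v : V) (h : L) (f : V -> M).

Lemma cls_D r v : cls r v -> cls r (D v).
Proof. by move=> hv; rewrite -[r]addr0; apply: cls_mode. Qed.
Lemma cls_0 r : cls r 0. Proof. by have [] := cls_sub r. Qed.
Lemma cls_add r v w : cls r v -> cls r w -> cls r (v + w).
Proof. by move=> hv hw; have [_ h] := cls_sub r; rewrite -[v]scale1r; apply: h. Qed.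
Lemma cls_scale r a v : cls r v -> cls r (a *: v).
Proof. by move=> hv; have [z h] := cls_sub r; rewrite -[_ *: _]addr0; apply: h. Qed.
Lemma cls_sum r (I : Type) (s : seq I) (F : I -> V) : (forall i, cls r (F i)) ->
  cls r (\sum_(i <- s) F i).
Proof.
move=> h; elim: s => [|i s IH]; first by rewrite big_nil; apply: cls_0.
by rewrite big_cons; apply: cls_add.
Qed.
Lemma cls_vm r r' b d h : cls r b -> cls r' d -> cls (r + r') (vm A b h d).
Proof. by move=> hb hd; apply: cls_sum => i; apply/cls_scale/cls_mode. Qed.

Lemma pj_D r v : (r < T)%N -> pj r (D v) = D (pj r v).
Proof.
move=> hr; rewrite {1}(pj_sum v) (is_linear_sum (vaD_lin A)) (is_linear_sum (pj_lin r)).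
rewrite (bigD1 (Ordinal hr)) //= big1 => [|i hi].
  by rewrite (pj_id (cls_D (pj_cls r v)) hr) subrr dvdz0 addr0.
rewrite (pj_id (cls_D (pj_cls i v)) hr); case: ifP => // /dvdzP [x hx].
case/negP: hi; apply/eqP/val_inj => /=; have := ltn_ord i; have : x = 0 by have := ltn_ord i; nia.
by move=> x0; rewrite x0 in hx; lia.
Qed.

(* f kills the modes b[h] v with h of order at least N at z = 0 and z = oo *)
Definition kl f (r : int) b (N : nat) := forall r' a c h u,
  (T%:Z %| r' - r)%Z -> N%:Z <= a -> c <= - N%:Z -> Tf r' a c h -> f (vm A b h u) = 0.

(** The order N depends on f and b but not on u; this uniformity lets one cutoff serve all
    arguments. *)
Definition Co f := is_linear f /\
  forall r b, cls r b -> exists N : int, forall h u, Tf r N (- N) h -> f (vm A b h u) = 0.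

Lemma Co_kl f r b : Co f -> cls r b -> exists N, forall n, (N <= n)%N -> kl f r b n.
Proof.
move=> [_ hf] /hf [N hN]; exists (absz N) => n hn r' a c h u h1 h2 h3 hh; apply: hN.
by apply: (TfW T0 h1 _ _ hh); lia.
Qed.
Lemma Co_pj f d : Co f -> exists N, forall n, (N <= n)%N -> forall r, (r < T)%N ->
  kl f r%:Z (pj r d) n.
Proof. by move=> hf; apply: fin_unif => r; apply: (Co_kl hf). Qed.

Lemma vm_subh b h1 h2 u : vm A b (h1 - h2) u = vm A b h1 u - vm A b h2 u.
Proof. exact: (is_linearB (vm_linh A b u)). Qed.

Definition dm_ev d s f (n : nat) u := - f (vm A (pj (cl T s) d) (lE (q_ (- s)) * chi K n) u).

Lemma dm_stab d s f N : is_linear f -> kl f (cl T s)%:Z (pj (cl T s) d) N ->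
  forall m n, (N + absz s <= n)%N -> (n <= m)%N -> forall u, dm_ev d s f m u = dm_ev d s f n u.
Proof.
move=> hl k m n hn hm u; apply/eqP; rewrite -subr_eq0 opprK addrC -(is_linearB hl) -vm_subh -mulrBr.
rewrite -[chi K n - _]opprB mulrN.
apply/eqP/(k (- s + 0) (- s + T%:Z * n%:Z) (- s - T%:Z * n%:Z)); [|nia|nia|].
  have := cl_dvd T0 s => /dvdzP [x hx]; apply/dvdzP; exists (- x); lia.
apply/TfN/(TfM T0); [exact: (Tf_E K T0)|exact: (chi_sub K T0)].
Qed.

(* the mode d_(s) of the coinduced module:
   - f (d[z^{-s/T} chi] u), independently of the order of the cutoff chi *)
Definition dm d s f u : M := dm_ev d s f (epsilon (inhabits 0%N)
  (fun n => forall m, (n <= m)%N -> forall u, dm_ev d s f m u = dm_ev d s f n u)) u.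

Lemma dmE d s f N : is_linear f -> kl f (cl T s)%:Z (pj (cl T s) d) N ->
  forall n, (N + absz s <= n)%N -> forall u, dm d s f u = dm_ev d s f n u.
Proof.
move=> hl k n hn u; rewrite /dm; set P := fun n => _; set e := epsilon _ _.
have he : P e by apply: epsilon_spec; exists (N + absz s)%N => m hm u'; apply: (dm_stab hl k).
rewrite -(he (maxn e n)) ?leq_maxl // (dm_stab hl k hn) // leq_maxr //.
Qed.

Lemma dmP f d : Co f -> exists N, forall s n, (N + absz s <= n)%N -> forall u,
  dm d s f u = dm_ev d s f n u.
Proof.
move=> hf; have [N hN] := Co_pj d hf; exists N => s n hn u.
by apply: (dmE (proj1 hf) (hN N _ _ _)) => //; apply: cl_lt.
Qed.

Lemma dm_linf d s u (a : K) f f' : Co f -> Co f' ->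
  dm d s (fun u => a *: f u + f' u) u = a *: dm d s f u + dm d s f' u.
Proof.
move=> hf hf'; have [N h] := Co_pj d hf; have [N' h'] := Co_pj d hf'.
set n := maxn N N'; have kf := h n (leq_maxl _ _) _ (cl_lt T0 s).
have kf' := h' n (leq_maxr _ _) _ (cl_lt T0 s).
rewrite (dmE (proj1 hf) kf (leqnn _)) (dmE (proj1 hf') kf' (leqnn _)).
rewrite (@dmE _ _ _ n _ _ _ (leqnn _)) /dm_ev ?opprD ?scalerN //.
  move=> c x y; rewrite (proj1 hf) (proj1 hf') !scalerDr !scalerA addrACA.
  by rewrite [a * c]mulrC.
by move=> r' a' c h0 u0 e1 e2 e3 e4; rewrite (kf r' a' c) // (kf' r' a' c) // scaler0 addr0.
Qed.

Lemma dm_lind s f u : Co f -> is_linear (fun d => dm d s f u).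
Proof.
move=> hf a x y; have [N h] := dmP x hf; have [N' h'] := dmP y hf.
have [N3 h3] := dmP (a *: x + y) hf; pose n := (N + N' + N3 + absz s)%N.
rewrite (h s n) ?(h' s n) ?(h3 s n); try by rewrite /n; lia.
by rewrite /dm_ev pj_lin (vm_linb A) (proj1 hf) opprD scalerN.
Qed.

Lemma dm_linu d s f : is_linear f -> is_linear (dm d s f).
Proof. by move=> hf a x y; rewrite /dm /dm_ev (vm_linv A) hf opprD scalerN. Qed.

Lemma dm_trunc f d : Co f -> exists N : int, forall s, s < N -> forall u, dm d s f u = 0.
Proof.
move=> hf; have [N hN] := Co_pj d hf; exists (- N%:Z) => s hs u.
have k := hN N (leqnn _) _ (cl_lt T0 s).
rewrite (dmE (proj1 hf) k (leqnn _)) /dm_ev; set n := (N + _)%N.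
rewrite (k (- s + 0) (- s + 0) (- s - T%:Z * n%:Z)) ?oppr0 //; try by rewrite /n; nia.
  have := cl_dvd T0 s => /dvdzP [x hx]; apply/dvdzP; exists (- x); lia.
by apply: (TfM T0); [exact: (Tf_E K T0)|exact: (chi_inf K T0)].
Qed.

Lemma dm_cls r v s f u : Co f -> cls r v -> ~~ (T%:Z %| s + r)%Z -> dm v s f u = 0.
Proof.
move=> hf hv hn; rewrite /dm /dm_ev (pj_id hv (cl_lt T0 s)); case: ifP => h.
  case/negP: hn; apply: (dvdz_eqD h (cl_dvd T0 s)); lia.
by rewrite (is_linear0 (vm_linb A _ u)) (is_linear0 (proj1 hf)) oppr0.
Qed.

Lemma pj_cl r v s : cls r v -> (T%:Z %| s + r)%Z -> pj (cl T s) v = v.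
Proof.
move=> hv hd; rewrite (pj_id hv (cl_lt T0 s)) ifT //.
have /dvdzP [x hx] := cl_dvd T0 s; have /dvdzP [x' hx'] := hd.
by apply/dvdzP; exists (x' - x); lia.
Qed.

(** The vacuum reduces the action to the residues of z^i chi dz/z at z = 1, which are -1 for i = 0
    and 0 otherwise; this fixes the sign in [dm_ev]. *)
Lemma dm_vac s f u : Co f -> dm vac s f u = if s == 0 then f u else 0.
Proof.
move=> hf; case: (boolP (T%:Z %| s)%Z) => [/dvdzP [i hi]|hn]; last first.
  rewrite (dm_cls u hf cls_vac) ?addr0 //; case: eqP => // s0.
  by rewrite s0 dvdz0 in hn.
have [N h] := dmP vac hf; rewrite (h s (N + absz s).+1) // /dm_ev.
rewrite (pj_cl cls_vac) ?addr0; last by apply/dvdzP; exists i.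
rewrite vac_vm (is_linearZ (proj1 hf)) -scaleNr.
rewrite hi (_ : - (i * T%:Z) = T%:Z * - i) ?(q_T K T0); last by lia.
have -> : (i * T%:Z == 0) = (i == 0) by apply/eqP/eqP; nia.
case: eqP => [->|/eqP i0]; first by rewrite mulr0z lE0 mul1r (lres_chi K T0) ?opprK ?scale1r.
by rewrite (lres_Echi K T0) ?oppr0 ?scale0r //; nia.
Qed.

(** D differentiates the test function. The derivative of the cutoff vanishes to high order at both
    ends and is killed by f, so only z^{-s/T} contributes. *)
Lemma dm_D d s f u : Co f -> dm (D d) s f u = q_ s *: dm d s f u.
Proof.
move=> hf; have [N h] := dmP (D d) hf; have [N' h'] := Co_pj d hf.
set n := (N + N' + absz s)%N; have k := h' N' (leqnn _) _ (cl_lt T0 s).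
rewrite (h s n); last by rewrite /n; lia.
rewrite (dmE (proj1 hf) k (n := n)); last by rewrite /n; lia.
rewrite /dm_ev (pj_D _ (cl_lt T0 s)) vm_D lderM lderE -scalerAl.
rewrite (vm_linh A) opprD (is_linearB (proj1 hf)) (is_linearN (proj1 hf)) (is_linearZ (proj1 hf)).
rewrite (k (- s + 0) (- s + T%:Z * n%:Z) (- s - T%:Z * n%:Z) (lE _ * lder _)).
- by rewrite subr0 opprK (q_N K T) scaleNr scalerN.
- have := cl_dvd T0 s => /dvdzP [x hx]; apply/dvdzP; exists (- x); lia.
- by rewrite /n; nia.
- by rewrite /n; nia.
- by apply: (TfM T0); [exact: (Tf_E K T0)|exact: (chi_der K T0)].
Qed.

Lemma mode_fin b d : exists I : nat, forall k, I%:Z <= k -> mo b k d = 0.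
Proof. by have [N hN] := ubd_vm A b d; exists (absz N) => k hk; apply: hN; lia. Qed.

Lemma Tf_Echi s n : Tf s s s (lE (q_ s) * chi K n).
Proof.
rewrite -{1}[s]addr0 -{2}[s]addr0 -{3}[s]addr0; apply: (TfM T0); first exact: (Tf_E K T0).
by apply: (TfW T0 _ _ _ (chi_inf K T0 n)); rewrite ?subrr ?dvdz0 //; nia.
Qed.

(** A test function for b is commuted past d[z^{-s/T} chi]. The commutator has finitely many terms,
    built on the vectors d_i b, and each is killed once the order is large compared with s. *)
Lemma Co_dm d s f : Co f -> Co (dm d s f).
Proof.
move=> hf; split; first exact/dm_linu/(proj1 hf).
move=> r b hb; have [N0 h0] := dmP d hf; pose n := (N0 + absz s)%N.
pose d' := pj (cl T s) d; have [I hI] := mode_fin d' b.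
have [N1 h1] := Co_kl hf hb.
have [N2 h2] := @fin_unif (fun i n => kl f ((cl T s)%:Z + r) (mo d' i%:Z b) n)
  (fun i => Co_kl hf (cls_mode i%:Z (pj_cls _ d) hb)) I.
exists (N1 + N2 + absz s)%N%:Z => h u hh; rewrite (h0 s n) // /dm_ev -/d'.
apply/eqP; rewrite oppr_eq0; apply/eqP.
have := vm_commutator (proj1 hf) u (lE (q_ (- s)) * chi K n) h hI.
rewrite [f (vm A b h _)](h1 N1 (leqnn _) r _ _ _ _ _ _ _ hh) ?subrr ?dvdz0 ?subr0; try lia.
move=> ->; apply: big1 => i _.
rewrite (h2 N2 (leqnn _) i (ltn_ord i) (- s + r) _ _ _ _ _ _ _
   (TfM T0 (Tf_iter_der T0 i (Tf_Echi (- s) n)) hh)) ?scaler0 //; try lia.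
have := cl_dvd T0 s => /dvdzP [x hx]; apply/dvdzP; exists (- x); lia.
Qed.

(** Up to functions of high order at both ends the cutoff is invisible to d/dx, so a truncated power
    meets the hypothesis of [tp_q0]. *)
Lemma iter_der_Echi s n (a : nat) : Tf s (s + T%:Z * n%:Z) (s - T%:Z * n%:Z)
  (iter a (@lder K) (lE (q_ s) * chi K n) - q_ s ^+ a *: (lE (q_ s) * chi K n)).
Proof.
elim: a => [|a IH] /=; first by rewrite expr0 scale1r subrr; apply: Tf0.
set X := iter _ _ _ in IH *; rewrite -[X](subrK (q_ s ^+ a *: (lE (q_ s) * chi K n))).
set Z := X - _ in IH *; rewrite raddfD /= linearZ /= lderM lderE -scalerAl scalerDr scalerA -exprSr.
rewrite addrA addrAC addrK; apply: TfD; first exact: Tf_iter_der T0 1%N _ _ _ _ IH.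
rewrite -[s in Tf s]addr0; apply/TfZ/(TfM T0); [exact: (Tf_E K T0)|exact: (chi_der K T0)].
Qed.

Lemma Tf_yVn (k : nat) : Tf 0 0 0 (ly K ^ (- k%:Z)).
Proof.
have e : (0 : K) = q_ 0 by rewrite mul0r.
by rewrite -[_ ^ _]mul1r -lE0 {1}e; apply: Tfg; rewrite ?subrr ?dvdz0 //; nia.
Qed.

Lemma kl_far f r b s N n (k : nat) u : kl f r b N -> (T%:Z %| s - r)%Z -> N%:Z <= s ->
  (N + absz s <= n)%N -> f (vm A b (ly K ^ (- k%:Z) * (lE (q_ s) * chi K n)) u) = 0.
Proof.
move=> kf hs h1 h2; apply: (kf _ _ _ _ _ _ _ _ (TfM T0 (Tf_yVn k) (TfM T0 (Tf_E K T0 s) (chi_inf K T0 n)))).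
- by rewrite add0r addr0.
- lia.
- nia.
Qed.

(** * Comparing the two orders of a product of coinduced modes *)

Section Locality.
Variable f : V -> M.
Hypothesis hf : Co f.
Variables (r r' : int) (b d : V) (N : nat).
Hypotheses (kb : kl f r b N) (kd : kl f r' d N).
Local Notation H n s := (lE (q_ s) * chi K n).
Local Notation y := (ly K).

Lemma lE1H n s : lE 1 * H n s = H n (s + T%:Z).
Proof. by rewrite mulrA -lED addrC (q_D K T) -[T%:Z]mulr1 (q_T K T0). Qed.

Lemma X12_step n s t u : Xf (q12 A f u b d) (H n s) (H n t) =
  Xf (q12 A f u b d) (H n (s + T%:Z)) (H n (t - T%:Z)) - f (vm A b (H n s) (vm A d (H n (t - T%:Z)) u)).
Proof.
have a := q12_abd A (proj1 hf) u b d; have S := q12_S A (proj1 hf) u b d.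
have := XfP (H n s) (H n (t - T%:Z)) a S; rewrite !lE1H subrK pr_q12; last exact: (proj1 hf).
by move=> <-; rewrite subKr.
Qed.
Lemma X21_step n s t u : Xf (q21 A f u b d) (H n s) (H n t) =
  Xf (q21 A f u b d) (H n (s - T%:Z)) (H n (t + T%:Z)) + f (vm A d (H n t) (vm A b (H n (s - T%:Z)) u)).
Proof.
have a := q21_abd A (proj1 hf) u b d; have S := q21_S A (proj1 hf) u b d.
have := XfP (H n (s - T%:Z)) (H n t) a S; rewrite !lE1H subrK pr_q21; last exact: (proj1 hf).
by move=> <-; rewrite addrC subrK.
Qed.

Lemma X12_sum (C : nat) n s t u : (T%:Z %| s - r)%Z -> N%:Z <= s + T%:Z * C%:Z ->
  (N + absz s + T * C <= n)%N ->
  Xf (q12 A f u b d) (H n s) (H n t) =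
  - \sum_(a < C) f (vm A b (H n (s + T%:Z * a%:Z)) (vm A d (H n (t - T%:Z * (a%:Z + 1))) u)).
Proof.
move=> hs; elim: C s t hs => [|C IH] s t hs h1 h2.
  rewrite big_ord0 oppr0; apply: (Xf12_van (proj1 hf)) => k g.
  by apply: (kl_far _ _ kb hs); nia.
rewrite X12_step (IH (s + T%:Z)) ?big_ord_recl ?opprD /=; [|by apply: (dvdz_eqD hs (dvdzz T%:Z)); lia|nia|nia].
rewrite mulr0 addr0 add0r mulr1 addrC; congr (_ - _); apply: eq_bigr => a _.
have e1 : s + T%:Z + T%:Z * a%:Z = s + T%:Z * (bump 0 a)%:Z by rewrite /bump; nia.
have e2 : t - T%:Z - T%:Z * (a%:Z + 1) = t - T%:Z * ((bump 0 a)%:Z + 1) by rewrite /bump; nia.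
by rewrite e1 e2.
Qed.
Lemma X21_sum (C : nat) n s t u : (T%:Z %| t - r')%Z -> N%:Z <= t + T%:Z * C%:Z ->
  (N + absz t + T * C <= n)%N ->
  Xf (q21 A f u b d) (H n s) (H n t) =
  \sum_(a < C) f (vm A d (H n (t + T%:Z * a%:Z)) (vm A b (H n (s - T%:Z * (a%:Z + 1))) u)).
Proof.
move=> ht; elim: C s t ht => [|C IH] s t ht h1 h2.
  rewrite big_ord0; apply: (Xf21_van (proj1 hf)) => k g.
  by apply: (kl_far _ _ kd ht); nia.
rewrite X21_step (IH _ (t + T%:Z)) ?big_ord_recl /=; [|by apply: (dvdz_eqD ht (dvdzz T%:Z)); lia|nia|nia].
rewrite mulr0 addr0 add0r mulr1 addrC; congr (_ + _); apply: eq_bigr => a _.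
have e1 : t + T%:Z + T%:Z * a%:Z = t + T%:Z * (bump 0 a)%:Z by rewrite /bump; nia.
have e2 : s - T%:Z - T%:Z * (a%:Z + 1) = s - T%:Z * ((bump 0 a)%:Z + 1) by rewrite /bump; nia.
by rewrite e1 e2.
Qed.

(** The Jacobi identity paired with 1/(z_1 - z_2). The iterate is evaluated by [tp_q0], and chi^2
    may be replaced by chi. The factor e^{-x_2} in [Xf] lowers the exponent of z_2 by one, whence T
    - s - t. *)
Lemma X_diff s t : cls r b -> cls r' d -> (T%:Z %| s - r)%Z -> (T%:Z %| t - r')%Z ->
  exists n0, forall n, (n0 <= n)%N -> forall u,
  Xf (q21 A f u b d) (H n s) (H n t) - Xf (q12 A f u b d) (H n s) (H n t) =
  dm (vm A b (lE (q_ s) * y ^ (-1)) d) (T%:Z - s - t) f u.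
Proof.
move=> cb cd hs ht; set Q := vm A b _ d; have cQ : cls (r + r') Q by apply: cls_vm.
have [I hI] := mode_fin b d; have [N1 h1] := Co_kl hf cQ.
have [N2 h2] := @fin_unif (fun i n => kl f (r + r') (mo b (i%:Z - 1) d) n)
  (fun i => Co_kl hf (cls_mode (i%:Z - 1) cb cd)) I.+1.
have [N3 h3] := dmP Q hf.
have hd : (T%:Z %| s + (t - T%:Z) - (r + r'))%Z.
  apply: (dvdz_eqD (dvdz_eqD hs ht (erefl _)) (dvdz_mulr (-1) (dvdzz T%:Z))); lia.
exists (N1 + N2 + N3 + absz s + absz t + absz (T%:Z - s - t)%R)%N => n hn u.
have hTn : n%:Z <= T%:Z * n%:Z by clear -T0; nia.
rewrite -opprB /Xf (tp_jacobi A (proj1 hf)).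
have e1 : lE (-1) * H n t = H n (t - T%:Z).
  by rewrite -{1}[t](subrK T%:Z) -lE1H mulrA -lED addNr lE0 mul1r.
rewrite e1 (@tp_q0 _ _ _ _ _ (proj1 hf) u b d (q_ s) _ _ I hI) => [|a l hl].
  rewrite -/Q (h3 _ n); last lia.
  rewrite /dm_ev (pj_cl cQ); last first.
    by move/dvdzP: hd => [x hx]; apply/dvdzP; exists (- x); lia.
  congr (- _); apply/eqP; rewrite -subr_eq0 -(is_linearB (proj1 hf)) -vm_subh; apply/eqP.
  have -> : H n s * H n (t - T%:Z) - lE (q_ (- (T%:Z - s - t))) * chi K n =
     lE (q_ (s + (t - T%:Z))) * (chi K n * chi K n - chi K n).
    have -> : - (T%:Z - s - t) = s + (t - T%:Z) by lia.
    by rewrite mulrACA -lED -(q_D K T) mulrBr.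
  apply: (h1 N1 (leqnn _) _ _ _ _ _ _ _ _ (TfM T0 (Tf_E K T0 (s + (t - T%:Z))) (chi_sq K T0 n))); rewrite ?addr0 //; lia.
have [hi|hi] := leP I%:Z l.
  by rewrite hI // !(is_linear0 (vm_linb A _ _)) (is_linear0 (proj1 hf)) scaler0.
apply/eqP; rewrite -subr_eq0 -(is_linearZ (proj1 hf)) -(is_linearB (proj1 hf)).
rewrite -(is_linearZ (vm_linh A _ _)) -vm_subh scalerAl -mulrBl; apply/eqP.
have -> : l = (absz (l + 1))%:Z - 1 by lia.
apply: (h2 N2 (leqnn _) _ _ (s + (t - T%:Z)) _ _ _ _ _ _ _
  (TfM T0 (iter_der_Echi s n a) (Tf_Echi (t - T%:Z) n))) => //; lia.
Qed.
End Locality.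

(** * Modules embedded in spaces of functionals *)

Section Embedded.
Variable W : lmodType K.
Variable md : V -> int -> W -> W.
Variable vl : W -> V -> M.
Hypothesis vl_lin : forall u, is_linear (fun w => vl w u).
Hypothesis vl_inj : forall w, (forall u, vl w u = 0) -> w = 0.
Hypothesis vl_Co : forall w, Co (vl w).
Hypothesis vl_md : forall v s w u, vl (md v s w) u = dm v s (vl w) u.
Local Notation H n s := (lE (q_ s) * chi K n).

Lemma vl_eq w w' : (forall u, vl w u = vl w' u) -> w = w'.
Proof.
move=> h; apply/eqP; rewrite -subr_eq0; apply/eqP/vl_inj => u.
by rewrite (is_linearB (vl_lin u)) h subrr.
Qed.

Lemma emb_tmod : tmod A T cls md.
Proof.
split.
- move=> s w a x x'; apply: vl_eq => u.
  by rewrite vl_lin !vl_md (dm_lind s u (vl_Co w)).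
- move=> v s a x x'; apply: vl_eq => u; rewrite vl_lin !vl_md -(dm_linf _ _ _ _ (vl_Co x) (vl_Co x')).
  by congr (dm v s _ u); apply: funext => u'; rewrite vl_lin.
- move=> v w; have [N hN] := dm_trunc v (vl_Co w); exists N => s hs.
  by apply: vl_inj => u; rewrite vl_md hN.
- move=> s w; apply: vl_eq => u; rewrite vl_md (dm_vac _ _ (vl_Co w)).
  by case: eqP => // _; rewrite (is_linear0 (vl_lin u)).
- by move=> r v s w hv hn; apply: vl_inj => u; rewrite vl_md (dm_cls u (vl_Co w) hv hn).
Qed.

Lemma emb_D v s w : md (D v) s w = q_ s *: md v s w.
Proof. by apply: vl_eq => u; rewrite (is_linearZ (vl_lin u)) !vl_md (dm_D _ _ _ (vl_Co w)). Qed.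

Lemma vl_mode v s w : exists n0, forall n, (n0 <= n)%N -> forall u,
  vl (md v s w) u = - vl w (vm A (pj (cl T s) v) (H n (- s)) u).
Proof.
have [N hN] := dmP v (vl_Co w); exists (N + absz s)%N => n hn u.
by rewrite vl_md (hN _ n).
Qed.

Lemma cl_shift i s : cl T (T%:Z * i + s) = cl T s.
Proof.
apply/esym/(cl_eq T0); first exact: cl_lt.
by apply: (dvdz_eqD (dvdz_mulr i (dvdzz T%:Z)) (cl_dvd T0 s)); lia.
Qed.

Section WB.
Variables (r : int) (b d : V) (w : W) (t0 : int).
Hypothesis hb : cls r b.
Local Notation d' := (pj (cl T t0) d).
Local Notation s_ i := (- (T%:Z * i - r)).
Local Notation t_ j := (- (T%:Z * j + t0)).
Local Notation f := (vl w).

Lemma s_dvd i : (T%:Z %| s_ i - r)%Z.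
Proof. by apply/dvdzP; exists (- i); lia. Qed.
Lemma t_dvd j : (T%:Z %| t_ j - (cl T t0)%:Z)%Z.
Proof. by have /dvdzP [x hx] := cl_dvd T0 t0; apply/dvdzP; exists (- j - x); lia. Qed.

Lemma Bf_eval i j : exists n0, forall n, (n0 <= n)%N -> forall u,
  vl (Bf T md r b d t0 w i j) u = f (vm A d' (H n (t_ j)) (vm A b (H n (s_ i)) u)).
Proof.
have [n1 h1] := vl_mode b (T%:Z * i - r) (md d (T%:Z * j + t0) w).
have [n2 h2] := vl_mode d (T%:Z * j + t0) w.
exists (n1 + n2)%N => n hn u; rewrite /Bf (h1 n) ?(h2 n); try lia.
rewrite opprK (cl_shift j t0) (pj_cl hb) //; apply/dvdzP; exists i; lia.
Qed.
Lemma Bf'_eval i j : exists n0, forall n, (n0 <= n)%N -> forall u,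
  vl (Bf' T md r b d t0 w i j) u = f (vm A b (H n (s_ i)) (vm A d' (H n (t_ j)) u)).
Proof.
have [n1 h1] := vl_mode d (T%:Z * j + t0) (md b (T%:Z * i - r) w).
have [n2 h2] := vl_mode b (T%:Z * i - r) w.
exists (n1 + n2)%N => n hn u; rewrite /Bf' (h1 n) ?(h2 n); try lia.
rewrite opprK (cl_shift j t0) (pj_cl hb) //; apply/dvdzP; exists i; lia.
Qed.

(** The expansion of 1/(z_1 - z_2) in |z_1| > |z_2|, cut once the test function for d vanishes at
    both ends; [C2] is the opposite expansion. Modes act on functionals in reverse order, so [C1] is
    evaluated by [q21] and [C2] by [q12]. *)
Definition C1 N i j := \sum_(a < (N + absz j + absz t0)%N)
  Bf T md r b d t0 w (i + 1 + a%:Z) (j - a%:Z).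
Definition C2 N i j := - \sum_(a < (N + absz i + absz r)%N)
  Bf' T md r b d t0 w (i - a%:Z) (j + 1 + a%:Z).

Lemma C1_eval N i j : kl f (cl T t0)%:Z d' N -> exists n0, forall n, (n0 <= n)%N -> forall u,
  vl (C1 N i j) u = Xf (q21 A f u b d') (H n (s_ i)) (H n (t_ j)).
Proof.
move=> kd; set C := (N + absz j + absz t0)%N.
have [n1 h1] := @fin_unif (fun a n => forall u, _) (fun a => Bf_eval (i + 1 + a%:Z) (j - a%:Z)) C.
exists (n1 + N + absz (t_ j) + T * C)%N => n hn u.
rewrite (X21_sum (vl_Co w) b kd (C := C) _ _ (t_dvd j)); [|rewrite /C; nia|lia].
rewrite (is_linear_sum (vl_lin u)); apply: eq_bigr => a _; rewrite (h1 n) ?ltn_ord //; last lia.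
have -> : t_ (j - a%:Z) = t_ j + T%:Z * a%:Z by lia.
by have -> : s_ (i + 1 + a%:Z) = s_ i - T%:Z * (a%:Z + 1) by lia.
Qed.
Lemma C2_eval N i j : kl f r b N -> exists n0, forall n, (n0 <= n)%N -> forall u,
  vl (C2 N i j) u = Xf (q12 A f u b d') (H n (s_ i)) (H n (t_ j)).
Proof.
move=> kb; set C := (N + absz i + absz r)%N.
have [n1 h1] := @fin_unif (fun a n => forall u, _) (fun a => Bf'_eval (i - a%:Z) (j + 1 + a%:Z)) C.
exists (n1 + N + absz (s_ i) + T * C)%N => n hn u.
rewrite (X12_sum (vl_Co w) d' kb (C := C) _ _ (s_dvd i)); [|rewrite /C; nia|lia].
rewrite (is_linearN (vl_lin u)) (is_linear_sum (vl_lin u)); congr (- _).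
apply: eq_bigr => a _; rewrite (h1 n) ?ltn_ord //; last lia.
have -> : s_ (i - a%:Z) = s_ i + T%:Z * a%:Z by lia.
by have -> : t_ (j + 1 + a%:Z) = t_ j - T%:Z * (a%:Z + 1) by lia.
Qed.
End WB.

Lemma emb_WB1 : WBq A T cls md 1.
Proof.
move=> r b hb d w t0; pose d' := pj (cl T t0) d; have hd : cls _ d' := pj_cls (cl T t0) d.
have [N1 h1] := Co_kl (vl_Co w) hb; have [N2 h2] := Co_kl (vl_Co w) hd.
pose N := (N1 + N2)%N; have kb := h1 N (leq_addr _ _); have kd := h2 N (leq_addl _ _).
exists (C1 r b d w t0 N), (C2 r b d w t0 N); split.
- move=> i j; apply: vl_eq => u; rewrite /= /Sop (is_linearB (vl_lin u)).
  have [n1 e1] := C1_eval hb (i - 1) j kd; have [n2 e2] := C1_eval hb i (j - 1) kd.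
  have [n3 e3] := Bf_eval d w t0 hb i j; pose n := (n1 + n2 + n3)%N.
  rewrite (e1 n) ?(e2 n) ?(e3 n); try by rewrite /n; lia.
  rewrite (X21_step (vl_Co w)) (_ : - (T%:Z * (i - 1) - r) - T%:Z = - (T%:Z * i - r)); last lia.
  by rewrite (_ : - (T%:Z * (j - 1) + t0) = - (T%:Z * j + t0) + T%:Z); [rewrite addrC addKr|lia].
- move=> i j; apply: vl_eq => u; rewrite /= /Sop (is_linearB (vl_lin u)).
  have [n1 e1] := C2_eval d t0 hb (i - 1) j kb; have [n2 e2] := C2_eval d t0 hb i (j - 1) kb.
  have [n3 e3] := Bf'_eval d w t0 hb i j; pose n := (n1 + n2 + n3)%N.
  rewrite (e1 n) ?(e2 n) ?(e3 n); try by rewrite /n; lia.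
  rewrite [X in _ - X](X12_step (vl_Co w)).
  rewrite (_ : - (T%:Z * i - r) + T%:Z = - (T%:Z * (i - 1) - r)); last lia.
  by rewrite (_ : - (T%:Z * (j - 1) + t0) - T%:Z = - (T%:Z * j + t0)) ?subKr //; lia.
- move=> j hj i; apply: big1 => a _; rewrite /Bf hj ?(md0r emb_tmod) //; lia.
- move=> i hi j; rewrite /C2 big1 ?oppr0 // => a _; rewrite /Bf' hi ?(md0r emb_tmod) //; lia.
(* A mode of this exponent sees only one eigencomponent of d, namely d', so d may be replaced by d'
   in the residue term. *)
move=> i j; rewrite (_ : md _ _ w = md (vm A b (lE (q_ (- (T%:Z * i - r))) * ly K ^ (- 1)) d')
    (T%:Z - - (T%:Z * i - r) - - (T%:Z * j + t0)) w).
  apply: vl_eq => u; rewrite (is_linearB (vl_lin u)).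
  have [n1 e1] := C1_eval hb i j kd; have [n2 e2] := C2_eval d t0 hb i j kb.
  have [n3 e3] := X_diff (vl_Co w) hb hd (s_dvd r i) (t_dvd t0 j); pose n := (n1 + n2 + n3)%N.
  by rewrite vl_md -(e3 n) ?(e1 n) ?(e2 n) //; rewrite /n; lia.
have -> : T%:Z - - (T%:Z * i - r) - - (T%:Z * j + t0) = T%:Z * (i + j + 1%N%:Z) - r + t0 by lia.
have -> : q_ (- (T%:Z * i - r)) = q_ r - i%:~R by rewrite opprB (q_D K T) (q_N K T) (q_T K T0).
set h := lE _ * _; set S := _ + t0.
rewrite {1}(pj_sum d) (is_linear_sum (vm_linv A b h)) (is_linear_sum (tm_linl emb_tmod S w)).
rewrite (bigD1 (Ordinal (cl_lt T0 t0))) //= big1 ?addr0 // => c hc.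
apply: (tm_cls emb_tmod _ (cls_vm h hb (pj_cls c d))); apply: contra hc => hc.
apply/eqP/val_inj/(cl_eq T0) => //=.
apply: (dvdz_eqD hc (dvdz_mulr (- (i + j + 1)) (dvdzz T%:Z))); rewrite /S; lia.
Qed.

Lemma emb_WB q : (0 < q)%N -> WBq A T cls md q.
Proof. apply: (WB_all T0 cls_D emb_tmod emb_D emb_WB1). Qed.

End Embedded.
End Coinduced.

(** * Subspaces as vector spaces, and independence of eigenvectors *)

Section Subspaces.
Variable K : fieldType.
Variable U : lmodType K.
Variable S : U -> Prop.
Hypothesis hS : is_subspace S.

Lemma subs0 : S 0. Proof. by have [] := hS. Qed.
Lemma subsP a x x' : S x -> S x' -> S (a *: x + x'). Proof. by have [_ h] := hS; apply: h. Qed.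
Lemma subsD x x' : S x -> S x' -> S (x + x').
Proof. by move=> h h'; rewrite -[x]scale1r; apply: subsP. Qed.
Lemma subsZ a x : S x -> S (a *: x).
Proof. by move=> h; rewrite -[a *: x]addr0; apply/subsP/subs0. Qed.
Lemma subsN x : S x -> S (- x).
Proof. by rewrite -scaleN1r; apply: subsZ. Qed.
Lemma subsB x x' : S x -> S x' -> S (x - x').
Proof. by move=> h h'; apply/subsD/subsN. Qed.
Lemma subs_sum (I : Type) (r : seq I) (P : pred I) (F : I -> U) : (forall i, P i -> S (F i)) ->
  S (\sum_(i <- r | P i) F i).
Proof. by move=> h; elim/big_ind: _ => //; [exact: subs0|exact: subsD]. Qed.

Definition subs_pred : {pred U} := fun x => `[< S x >].

Record sublm (h : is_subspace S) := SubLm { slval :> U; _ : slval \in subs_pred }.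
End Subspaces.

Section SubspaceType.
Variable K : fieldType.
Variable U : lmodType K.
Variable S : U -> Prop.
Variable hS : is_subspace S.
HB.instance Definition _ := [isSub of sublm hS for @slval _ _ _ hS].
HB.instance Definition _ := [Choice of sublm hS by <:].
Lemma subs_closed : GRing.subsemimod_closed (subs_pred S).
Proof.
split; first split.
- exact/asboolP/(subs0 hS).
- by move=> x x' /asboolP h /asboolP h'; apply/asboolP/(subsD hS).
- by move=> a x /asboolP h; apply/asboolP/(subsZ hS).
Qed.
HB.instance Definition _ := GRing.SubChoice_isSubLmodule.Build K U (subs_pred S) (sublm hS) subs_closed.

Lemma slvalP (x : sublm hS) : S (slval x).
Proof. by case: x => x /= /asboolP. Qed.
Definition slmk x (hx : S x) : sublm hS := SubLm hS (introT (asboolP _) hx).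
Lemma slval_lin : is_linear (@slval _ _ _ hS).
Proof. by move=> a x x'; exact: (linearP (val : sublm hS -> U)). Qed.
Lemma slval_inj : injective (@slval _ _ _ hS).
Proof. exact: val_inj. Qed.
End SubspaceType.

(** Lagrange interpolation: the relations combine to sum_a p(al a) c a = 0 for the polynomial p
    vanishing at all eigenvalues but one. *)
Lemma eigen_indep (K : fieldType) (U : lmodType K) (al : nat -> K) (n : nat) (c : nat -> U) :
  injective al -> (forall k, \sum_(a < n) al a ^+ k *: c a = 0) -> forall a, (a < n)%N -> c a = 0.
Proof.
move=> inj h a0 ha0; pose p : {poly K} := \prod_(a < n | a != Ordinal ha0) ('X - (al a)%:P).
have hp : \sum_(a < n) p.[al a] *: c a = 0.
  under eq_bigr do rewrite horner_coef scaler_suml.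
  rewrite exchange_big big1 //= => k _; under eq_bigr do rewrite -scalerA.
  by rewrite -scaler_sumr h scaler0.
have p0 a : p.[al a] = \prod_(i < n | i != Ordinal ha0) (al a - al i).
  by rewrite horner_prod; apply: eq_bigr => i _; rewrite hornerXsubC.
move: hp; rewrite (bigD1 (Ordinal ha0)) //= big1 ?addr0 => [|i hi]; last first.
  by rewrite p0 (bigD1 i) //= subrr mul0r scale0r.
move=> /eqP; rewrite scaler_eq0 => /orP[|/eqP //]; rewrite p0 => /eqP/eqP/prodf_eq0 [i hi].
rewrite subr_eq0 => /eqP /inj e; case/negP: hi; apply/eqP/val_inj; exact/esym.
Qed.

Section FunModule.
Variables (K : fieldType) (V M : lmodType K).
Lemma fct_linP (a : K) (f g : V -> M) u : (a *: f + g) u = a *: f u + g u.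
Proof. by []. Qed.
End FunModule.

(** * Graded modules and their bottom components *)
Section Graded.
Variable K : numFieldType.
Variable V : lmodType K.
Variable A : vertex_algebra V.
Variable T : nat.
Hypothesis T0 : (0 < T)%N.
Variable cls : int -> V -> Prop.
Variable pj : nat -> V -> V.
Hypothesis pj_cls : forall r v, cls r%:Z (pj r v).
Hypothesis pj_sum : forall v, v = \sum_(r < T) pj r v.
Local Notation vac := (vac A).

Record grading (W : lmodType K) (md : V -> int -> W -> W) (Wn : nat -> W -> Prop) : Prop := Grading {
  gr_sub : forall a, is_subspace (Wn a);
  gr_sum : forall w, exists (n : nat) (ws : nat -> W),
    (forall a, Wn a (ws a)) /\ w = \sum_(a < n) ws a;
  gr_ind : forall (n : nat) (ws : nat -> W), (forall a, Wn a (ws a)) ->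
    \sum_(a < n) ws a = 0 -> forall a, (a < n)%N -> ws a = 0;
  gr_md : forall v s a w, Wn a w ->
    if 0 <= a%:Z + s then Wn (absz (a%:Z + s)) (md v s w) else md v s w = 0;
  gr_nz : exists w, Wn 0%N w /\ w <> 0
}.

Definition irr (W : lmodType K) (md : V -> int -> W -> W) := (exists w : W, w <> 0) /\
  forall S : W -> Prop, is_subspace S -> (forall v s w, S w -> S (md v s w)) ->
    (forall w, S w -> w = 0) \/ (forall w, S w).

Definition proj0 (W : lmodType K) (Wn : nat -> W -> Prop) (p : W -> W) :=
  [/\ is_linear p, forall w, Wn 0%N (p w) &
      forall a w, Wn a w -> p w = if a == 0%N then w else 0].

Section Module.
Variable W : lmodType K.
Variable md : V -> int -> W -> W.
Hypothesis tm : tmod A T cls md.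
Hypothesis hW : forall q, (0 < q)%N -> WBq A T cls md q.

(** Single modes suffice for the submodule generated by m, because [product_span] rewrites a product
    of two modes; scalars are absorbed in V. *)
Definition gen (m w : W) := exists l : seq (V * int), w = \sum_(x <- l) md x.1 x.2 m.

Lemma gen_md1 m v s : gen m (md v s m).
Proof. by exists [:: (v, s)]; rewrite big_seq1. Qed.
Lemma gen_self m : gen m m.
Proof. by have := gen_md1 m vac 0; rewrite (tm_vac tm) eqxx. Qed.
Lemma gen_sub m : is_subspace (gen m).
Proof.
split; first by exists [::]; rewrite big_nil.
move=> a x x' [l ->] [l' ->]; exists ([seq (a *: z.1, z.2) | z <- l] ++ l').
rewrite big_cat big_map /= scaler_sumr; congr (_ + _).
by apply: eq_bigr => z _; rewrite (is_linearZ (tm_linl tm _ _)).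
Qed.
Lemma gen_md m v s w : gen m w -> gen m (md v s w).
Proof.
move=> [l ->]; rewrite (is_linear_sum (tm_linr tm v s)); apply: (subs_sum (gen_sub m)) => x _.
have [N1 h1] := tm_trunc tm v m; have [N2 h2] := tm_trunc tm x.1 m.
have [Q hQ] := product_span A T0 pj_cls pj_sum v x.1 s x.2 (Num.min N1 N2).
rewrite (hQ _ _ tm hW) => [|s' hs'|s' hs']; [exact: gen_md1|apply: h1; lia|apply: h2; lia].
Qed.

Lemma gen_all m : irr md -> m <> 0 -> forall w, gen m w.
Proof.
move=> [_ h] m0; have [z|//] := h _ (gen_sub m) (fun v s w => @gen_md m v s w).
by have := z _ (gen_self m).
Qed.

Section Grading.
Variable Wn : nat -> W -> Prop.
Hypothesis gr : grading md Wn.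

Definition comp0 (w m : W) := exists (n : nat) (ws : nat -> W),
  [/\ forall a, Wn a (ws a), forall n', (n <= n')%N -> w = \sum_(a < n'.+1) ws a & m = ws 0%N].

Lemma comp0_ex w : exists m, comp0 w m.
Proof.
have [n [ws [h1 h2]]] := gr_sum gr w; pose ws' a := if (a < n)%N then ws a else 0.
exists (ws' 0%N), n, ws'; split=> // [a|n' hn'].
  by rewrite /ws'; case: ifP => // _; apply: subs0 (gr_sub gr a).
rewrite h2 (big_ord_widen_cond n'.+1 xpredT (fun a => ws a)); last by lia.
by rewrite big_mkcond.
Qed.
Lemma comp0_lin c w m w' m' : comp0 w m -> comp0 w' m' -> comp0 (c *: w + w') (c *: m + m').
Proof.
move=> [n [ws [h1 h2 h3]]] [n' [ws' [h1' h2' h3']]].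
exists (n + n')%N, (fun a => c *: ws a + ws' a); split=> [a|n2 hn2|]; last by rewrite h3 h3'.
  by apply: (subsP (gr_sub gr a)).
by rewrite big_split /= -scaler_sumr -h2 -?h2' //; lia.
Qed.
Lemma comp0_0 m : comp0 0 m -> m = 0.
Proof.
move=> [n [ws [h1 h2 ->]]]; exact: (gr_ind gr h1 (esym (h2 n (leqnn n)))).
Qed.
Lemma comp0_hom a w : Wn a w -> comp0 w (if a == 0%N then w else 0).
Proof.
move=> hw; exists a, (fun b => if b == a then w else 0); split=> [b|n' hn'|]; last by rewrite eq_sym.
  by case: eqP => [->|_] //; apply: subs0 (gr_sub gr b).
have ha : (a < n'.+1)%N by lia.
rewrite (bigD1 (Ordinal ha)) //= eqxx big1 ?addr0 // => i hi.
by rewrite ifF //; apply: contraNF hi => /eqP e; apply/eqP/val_inj.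
Qed.

Lemma proj0_ex : exists p, proj0 Wn p.
Proof.
pose p w := epsilon (inhabits (0 : W)) (comp0 w).
have hp w : comp0 w (p w) by apply: epsilon_spec; apply: comp0_ex.
have hu w m : comp0 w m -> m = p w.
  move=> h; apply/eqP; rewrite -subr_eq0 addrC; apply/eqP/comp0_0.
  by have := comp0_lin (-1) (hp w) h; rewrite !scaleN1r addNr.
exists p; split=> [a x x'|w|a w hw].
- by apply/esym/hu/comp0_lin.
- by have [n [ws [h1 _ ->]]] := hp w.
- exact/esym/hu/comp0_hom.
Qed.

Lemma gr_Om w : Wn 0%N w -> Om md w.
Proof.
by move=> hw v s hs; have := gr_md gr v s hw; rewrite ifF // add0r; apply/negbTE; rewrite -ltNge.
Qed.
Lemma gr_md0 v w : Wn 0%N w -> Wn 0%N (md v 0 w).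
Proof. by move=> hw; have := gr_md gr v 0 hw; rewrite addr0. Qed.

Variable p : W -> W.
Hypothesis hp : proj0 Wn p.

Lemma proj0_lin : is_linear p. Proof. by have [] := hp. Qed.
Lemma proj0_in w : Wn 0%N (p w). Proof. by have [_ h _] := hp. Qed.
Lemma proj0_id w : Wn 0%N w -> p w = w.
Proof. by have [_ _ h] := hp => /h. Qed.
Lemma proj0_0 a w : Wn a.+1 w -> p w = 0.
Proof. by have [_ _ h] := hp => /h. Qed.

Lemma proj0_md u t w : 0 <= t -> p (md u t w) = if t == 0 then md u 0 (p w) else 0.
Proof.
move=> ht; have [n [ws [h1 ->]]] := gr_sum gr w.
rewrite !(is_linear_sum (tm_linr tm _ _), is_linear_sum proj0_lin).
transitivity (\sum_(a < n) if t == 0 then md u 0 (p (ws a)) else 0); last first.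
  by case: eqP => _ //; rewrite big1.
apply: eq_bigr => a _; have := gr_md gr u t (h1 a); rewrite ifT; last by lia.
have := h1 a; case: (nat_of_ord a) => [|b] hb hm.
  case: eqP => [e|ne]; first by rewrite e in hm *; rewrite (proj0_id hb); apply: proj0_id hm.
  apply: (@proj0_0 (absz t).-1); move: hm; by have <- : absz (0%N%:Z + t) = (absz t).-1.+1 by lia.
rewrite (proj0_0 hb) (md0r tm) if_same.
apply: (@proj0_0 (b + absz t)%N); move: hm; by have <- : absz (b.+1%:Z + t) = (b + absz t)%N.+1 by lia.
Qed.

Lemma proj0_Om v s m : Wn 0%N m -> p (md v s m) = if s == 0 then md v 0 m else 0.
Proof.
move=> hm; have [lt|le] := ltP s 0.
  by rewrite (gr_Om hm v lt) (is_linear0 proj0_lin) ifF //; apply/negbTE; lia.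
by rewrite proj0_md // (proj0_id hm).
Qed.

Hypothesis ir : irr md.

(** A non-zero x would generate W by single modes, and the projection would then vanish on the
    non-zero bottom component. *)
Lemma nondeg x : (forall u t, p (md u t x) = 0) -> x = 0.
Proof.
move=> h; case: (pselect (x = 0)) => // /(gen_all ir) hx.
have [w [hw w0]] := gr_nz gr; case: w0; rewrite -(proj0_id hw).
have [l ->] := hx w; rewrite (is_linear_sum proj0_lin) big1 // => y _; exact: h.
Qed.

(** The difference between w and its bottom component is invisible to all p(u_(t) .), for t < 0 by
    the vacuum condition and for t >= 0 by degree; [nondeg] concludes. *)
Lemma Om_gr w : Om md w -> Wn 0%N w.
Proof.
move=> hw; have -> : w = p w; last exact: proj0_in.
apply/eqP; rewrite -subr_eq0; apply/eqP/nondeg => u t.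
have [lt|le] := ltP t 0.
  rewrite (is_linearB (tm_linr tm u t)) hw // (gr_Om (proj0_in w)) // subr0.
  exact: is_linear0 proj0_lin.
rewrite proj0_md // (is_linearB proj0_lin) (proj0_id (proj0_in w)) subrr.
by rewrite (md0r tm) if_same.
Qed.

(** Write w through single modes of m and project onto the bottom: only zero modes of m survive, and
    S is stable under these. *)
Lemma Om_simple (S : W -> Prop) : is_subspace S -> (forall m, S m -> Om md m) ->
  (forall v m, S m -> S (md v 0 m)) -> forall m, S m -> m <> 0 -> forall w, Om md w -> S w.
Proof.
move=> hS h1 h2 m hm m0 w /Om_gr hw; rewrite -(proj0_id hw).
have [l ->] := gen_all ir m0 w; rewrite (is_linear_sum proj0_lin); apply: (subs_sum hS) => x _.
by rewrite (proj0_Om _ _ (Om_gr (h1 _ hm))); case: eqP => _; [apply: h2|apply: (subs0 hS)].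
Qed.
End Grading.
End Module.

(** * Lifting an isomorphism of bottom components *)

Section Lift.
Variables W1 W2 : lmodType K.
Variable md1 : V -> int -> W1 -> W1.
Variable md2 : V -> int -> W2 -> W2.
Hypothesis tm1 : tmod A T cls md1.
Hypothesis tm2 : tmod A T cls md2.
Hypothesis hW1 : forall q, (0 < q)%N -> WBq A T cls md1 q.
Hypothesis hW2 : forall q, (0 < q)%N -> WBq A T cls md2 q.
Variable G1 : nat -> W1 -> Prop.
Variable G2 : nat -> W2 -> Prop.
Hypothesis gr1 : grading md1 G1.
Hypothesis gr2 : grading md2 G2.
Hypothesis ir1 : irr md1.
Hypothesis ir2 : irr md2.
Variable phi : W1 -> W2.
Hypothesis phi_lin : is_linear phi.
Hypothesis phi_in : forall m, G1 0%N m -> G2 0%N (phi m).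
Hypothesis phi_md : forall v m, G1 0%N m -> phi (md1 v 0 m) = md2 v 0 (phi m).
Hypothesis phi_inj : forall m, G1 0%N m -> phi m = 0 -> m = 0.

(** The candidate graph of the extension of phi. That it is single-valued needs proof, since
    different lists of modes may give the same vector. *)
Definition lft (w : W1) (x : W2) := exists (m : W1) (l : seq (V * int)),
  [/\ G1 0%N m, w = \sum_(z <- l) md1 z.1 z.2 m & x = \sum_(z <- l) md2 z.1 z.2 (phi m)].

(** The vector Q of [product_span] is the same for both modules, and phi intertwines the zero modes
    of Q on the bottom. *)
Lemma lft_proj w x p1 p2 u t : lft w x -> proj0 G1 p1 -> proj0 G2 p2 ->
  p2 (md2 u t x) = phi (p1 (md1 u t w)).
Proof.
move=> [m [l [hm -> ->]]] hp1 hp2.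
rewrite (is_linear_sum (tm_linr tm1 u t)) (is_linear_sum (tm_linr tm2 u t)).
rewrite (is_linear_sum (proj0_lin hp1)) (is_linear_sum (proj0_lin hp2)) (is_linear_sum phi_lin).
apply: eq_bigr => z _.
have [Q hQ] := product_span A T0 pj_cls pj_sum u z.1 t z.2 0.
rewrite (hQ _ _ tm1 hW1 m (fun s' => @gr_Om _ _ _ gr1 _ hm _ s') (fun s' => @gr_Om _ _ _ gr1 _ hm _ s')).
rewrite (hQ _ _ tm2 hW2 (phi m) (fun s' => @gr_Om _ _ _ gr2 _ (phi_in hm) _ s') (fun s' => @gr_Om _ _ _ gr2 _ (phi_in hm) _ s')).
rewrite (proj0_Om tm1 gr1 hp1) // (proj0_Om tm2 gr2 hp2 _ _ (phi_in hm)).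
by case: eqP => _; rewrite ?phi_md // (is_linear0 phi_lin).
Qed.

Lemma lft_eq0 w x : lft w x -> (w = 0 <-> x = 0).
Proof.
have [p1 hp1] := proj0_ex gr1; have [p2 hp2] := proj0_ex gr2.
move=> h; split=> e.
  apply: (nondeg tm2 hW2 gr2 hp2 ir2) => u t; rewrite (lft_proj u t h hp1 hp2) e.
  by rewrite (md0r tm1) (is_linear0 (proj0_lin hp1)) (is_linear0 phi_lin).
apply: (nondeg tm1 hW1 gr1 hp1 ir1) => u t; apply: phi_inj; first exact: (proj0_in hp1).
by rewrite -(lft_proj u t h hp1 hp2) e (md0r tm2) (is_linear0 (proj0_lin hp2)).
Qed.

Lemma lft_iso : exists F : W1 -> W2, is_linear F /\ bijective F /\
  forall v s w, F (md1 v s w) = md2 v s (F w).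
Proof.
have [m [hm m0]] := gr_nz gr1.
have p0 : phi m <> 0 by move/(phi_inj hm).
pose R w x := exists l : seq (V * int),
  w = \sum_(z <- l) md1 z.1 z.2 m /\ x = \sum_(z <- l) md2 z.1 z.2 (phi m).
have Rl w x : R w x -> lft w x by move=> [l [e1 e2]]; exists m, l.
have Rlin a w x w' x' : R w x -> R w' x' -> R (a *: w + w') (a *: x + x').
  move=> [l [-> ->]] [l' [-> ->]]; exists ([seq (a *: z.1, z.2) | z <- l] ++ l').
  rewrite !big_cat !big_map /= !scaler_sumr; split; congr (_ + _); apply: eq_bigr => z _.
    by rewrite (is_linearZ (tm_linl tm1 _ _)).
  by rewrite (is_linearZ (tm_linl tm2 _ _)).
pose F w := epsilon (inhabits (0 : W2)) (R w).
have hF w : R w (F w).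
  apply: epsilon_spec; have [l hl] := gen_all tm1 hW1 ir1 m0 w.
  by exists (\sum_(z <- l) md2 z.1 z.2 (phi m)), l.
have Fu w x : R w x -> x = F w.
  move=> h; apply/eqP; rewrite -subr_eq0 addrC; apply/eqP.
  have [h1 _] := lft_eq0 (Rl _ _ (Rlin (-1) _ _ _ _ (hF w) h)).
  by move: h1; rewrite !scaleN1r addNr; apply.
have Flin : is_linear F by move=> a w w'; apply/esym/Fu/Rlin.
exists F; split=> //; split; last first.
  move=> v s w; apply/esym/Fu; have [l [e1 e2]] := hF w.
  rewrite {1}e1 e2 (is_linear_sum (tm_linr tm1 v s)) (is_linear_sum (tm_linr tm2 v s)).
  elim: l {e1 e2} => [|z l IH]; first by exists [::]; rewrite !big_nil.
  rewrite !big_cons -[md1 v s (md1 _ _ _)]scale1r -[md2 v s (md2 _ _ _)]scale1r; apply: Rlin => //.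
  have [Q hQ] := product_span A T0 pj_cls pj_sum v z.1 s z.2 0.
  exists [:: (Q, s + z.2)]; rewrite !big_seq1 /=.
  rewrite (hQ _ _ tm1 hW1 m (fun s' => @gr_Om _ _ _ gr1 _ hm _ s') (fun s' => @gr_Om _ _ _ gr1 _ hm _ s')).
  by rewrite (hQ _ _ tm2 hW2 (phi m) (fun s' => @gr_Om _ _ _ gr2 _ (phi_in hm) _ s') (fun s' => @gr_Om _ _ _ gr2 _ (phi_in hm) _ s')).
have Fs x : exists w, F w = x.
  have [l hl] := gen_all tm2 hW2 ir2 p0 x.
  exists (\sum_(z <- l) md1 z.1 z.2 m); apply/esym/Fu; by exists l.
pose Fi x := epsilon (inhabits (0 : W1)) (fun w => F w = x).
have hFi x : F (Fi x) = x := epsilon_spec (inhabits (0 : W1)) (fun w => F w = x) (Fs x).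
have Fin : injective F.
  move=> w w' e; apply/eqP; rewrite -subr_eq0; apply/eqP.
  apply: (proj2 (lft_eq0 (Rl _ _ (hF (w - w'))))).
  by rewrite (is_linearB Flin) e subrr.
by exists Fi => // w; apply: Fin.
Qed.
End Lift.
End Graded.

(** * The module generated by a Zhu module *)
Section FromZhu.
Variable K : numFieldType.
Variable V : lmodType K.
Variable A : vertex_algebra V.
Variable T : nat.
Hypothesis T0 : (0 < T)%N.
Local Notation L := (laurent K).
Local Notation vac := (vac A).
Local Notation D := (vaD A).
Local Notation mo := (vmode A).
Local Notation q_ s := (s%:~R / T%:R : K).
Local Notation Tf := (@Tf K T).
Local Notation y := (ly K).
Variable cls : int -> V -> Prop.
Variable pj : nat -> V -> V.
Hypothesis pj_cls : forall r v, cls r%:Z (pj r v).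
Hypothesis pj_sum : forall v, v = \sum_(r < T) pj r v.
Hypothesis pj_lin : forall r, is_linear (pj r).
Hypothesis pj_id : forall r v (r' : nat), cls r v -> (r' < T)%N ->
  pj r' v = if (T%:Z %| r - r'%:Z)%Z then v else 0.
Hypothesis cls_sub : forall r, is_subspace (cls r).
Hypothesis cls_vac : cls 0 vac.
Hypothesis cls_mode : forall r r' b d l, cls r b -> cls r' d -> cls (r + r') (mo b l d).
Variable M : lmodType K.
Local Notation dm := (dm A T pj (M := M)).
Local Notation Co := (Co A T cls (M := M)).
Local Notation kl := (kl A T (M := M)).
Implicit Types (b d u v : V) (h : L) (f : V -> M) (m : M).

Let Co_dm d s f : Co f -> Co (dm d s f).
Proof. exact: (@Co_dm _ _ _ _ T0 cls pj). Qed.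
Let dmP f d : Co f -> exists N, forall s n, (N + absz s <= n)%N -> forall u,
  dm d s f u = dm_ev A T pj d s f n u.
Proof. exact: (@dmP _ _ _ _ T0 cls pj). Qed.
Let dmE d s f N : is_linear f -> kl f (cl T s)%:Z (pj (cl T s) d) N ->
  forall n, (N + absz s <= n)%N -> forall u, dm d s f u = dm_ev A T pj d s f n u.
Proof. exact: (@dmE _ _ _ _ T0 pj). Qed.
Let pj_cl r v s : cls r v -> (T%:Z %| s + r)%Z -> pj (cl T s) v = v.
Proof. exact: (@pj_cl _ _ _ T0 cls pj). Qed.
Let Co_kl f r b : Co f -> cls r b -> exists N, forall n, (N <= n)%N -> kl f r b n.
Proof. exact: (@Co_kl _ _ _ _ T0 cls). Qed.

Lemma cls_nat r (r' : nat) v : cls r v -> (r' < T)%N -> (T%:Z %| r - r'%:Z)%Z -> cls r'%:Z v.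
Proof. by move=> hv hr hd; have := pj_cls r' v; rewrite (pj_id hv hr) hd. Qed.

Section Degree.

(** The degree is detected by the eigenvalue of D, which a mode of exponent s/T shifts by -s/T; the
    eigenspace condition accounts for a modulo T. *)
Definition deg f (a : int) := (forall u, f (D u) = - q_ a *: f u) /\
  (forall r u, cls r u -> ~~ (T%:Z %| r - a)%Z -> f u = 0).

Lemma deg_dm b s f a : Co f -> deg f a -> deg (dm b s f) (a + s).
Proof.
move=> hf [h1 h2]; have [N hN] := dmP b hf; have [N' hN'] := Co_kl hf (pj_cls (cl T s) b).
pose n := (N + N' + absz s)%N; have hn : (N + absz s <= n)%N by rewrite /n; lia.
have hTn : n%:Z <= T%:Z * n%:Z by nia.
split=> [u|r u hu hr]; rewrite !(hN s n hn) /dm_ev; set b' := pj _ _; last first.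
  rewrite (h2 ((cl T s)%:Z + r)) ?oppr0 //; first by apply: (cls_vm cls_sub cls_mode _ (pj_cls _ b) hu).
  apply: contra hr => hd; apply: (dvdz_eqD hd (dvdz_mulr (-1) (cl_dvd T0 s))); lia.
set h := lE _ * _.
have -> : vm A b' h (D u) = D (vm A b' h u) + vm A b' (lder h) u.
  by rewrite D_vm vm_D addrAC addNr add0r.
rewrite (is_linearD hf.1) h1 lderM lderE -scalerAl (vm_linh A) hf.1.
rewrite (hN' N' (leqnn _) (- s + 0) (- s + T%:Z * n%:Z) (- s - T%:Z * n%:Z)
  (lE (q_ (- s)) * lder (chi K n)) u).
- by rewrite -/h addr0 (q_D K T) (q_N K T) !scaleNr !scalerN !opprD !opprK scalerDl.
- have := cl_dvd T0 s => /dvdzP [x hx]; apply/dvdzP; exists (- x); lia.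
- by rewrite /n in hTn *; lia.
- by rewrite /n in hTn *; lia.
- by apply: (TfM T0); [exact: (Tf_E K T0)|exact: (chi_der K T0)].
Qed.

Lemma deg_pj f a u : is_linear f -> deg f a -> f (pj (cl T (- a)) u) = f u.
Proof.
move=> hf [_ h2]; rewrite [in RHS](pj_sum u) (is_linear_sum hf).
rewrite (bigD1 (Ordinal (cl_lt T0 (- a)))) //= big1 ?addr0 // => r hr.
apply: (h2 _ _ (pj_cls r u)); apply: contra hr => hd.
apply/eqP/val_inj/(cl_eq T0) => //=; apply: (dvdz_eqD hd (dvdz0 _)); lia.
Qed.

Lemma creation_eig f (mu : K) : is_linear f -> (forall u, f (D u) = mu *: f u) ->
  forall b (i : nat), f (mo b (-1 - i%:Z) vac) = (mu ^+ i / (i`!)%:R) *: f b.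
Proof.
move=> hf hD b i; elim: i b => [|i IH] b; first by rewrite subr0 creation_m1 expr0 divr1 scale1r.
have := IH (D b); rewrite vaD_cr hD (is_linearZ hf) scalerA => /(congr1 (fun x => i.+1%:R^-1 *: x)).
have n0 : i.+1%:R != 0 :> K by rewrite pnatr_eq0.
rewrite !scalerA mulVf // scale1r => ->; congr (_ *: _).
by rewrite factS natrM exprSr invfM; ring.
Qed.

Lemma vm_vac f mu b h : is_linear f -> (forall u, f (D u) = mu *: f u) ->
  f (vm A b h vac) = lres (h * lE mu) *: f b.
Proof.
move=> hf hmu; rewrite /vm (pr_raddf _ hf); last exact: ubd_vm.
rewrite (skew_pr vac b h hf (creation_eig hf hmu)) -(pr_raddf _ hf); last exact: ubd_vm.
rewrite -/(vm A vac _ b) vac_vm (is_linearZ hf) -scaleNr; congr (_ *: _).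
by rewrite -lsigE -lsigM lres_sig opprK.
Qed.

(** Y(u,x)1 = e^{xD} u, and the exponent -a cancels the eigenvalue of D under f. What remains is the
    residue of chi, which is -1. *)
Lemma dm_vac_ev f a u : Co f -> deg f a -> dm u (- a) f vac = f u.
Proof.
move=> hf hd; have [N hN] := dmP u hf; rewrite (hN _ (N + absz (- a)).+1); last by lia.
rewrite /dm_ev (vm_vac _ _ hf.1 hd.1) (deg_pj _ hf.1 hd) mulrAC -lED opprK subrr lE0 mul1r.
by rewrite (lres_chi K T0) // scaleN1r opprK.
Qed.

Lemma deg_lin c f g a : deg f a -> deg g a -> deg (fun u => c *: f u + g u) a.
Proof.
move=> [h1 h2] [h1' h2']; split=> [u|r u hu hr].
  by rewrite h1 h1' scalerDr !scalerA [c * _]mulrC.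
by rewrite (h2 r) // (h2' r) // scaler0 addr0.
Qed.
End Degree.

(** * Functionals defined by a Zhu module *)

Section Action.
Variable act : V -> M -> M.
Hypothesis act_linl : forall m, is_linear (fun u => act u m).
Hypothesis act_linr : forall u, is_linear (act u).
Hypothesis act_D : forall v m, act (D v) m = 0.
Hypothesis act_O0 : forall b d m, cls 0 b -> act (vm A b (lE 1 * y ^ (-2)) d) m = 0.
Hypothesis act_Or : forall (r : nat) b d m, (0 < r < T)%N -> cls r%:Z b ->
  act (vm A b (lE (q_ r%:Z) * y ^ (-1)) d) m = 0.
Hypothesis act_mul : forall b d m, cls 0 b ->
  act (vm A b (lE 1 * y ^ (-1)) d) m = act b (act d m).
Hypothesis act_vac : forall m, act vac m = m.

Definition fm m u := act u m.

(** D-images act by zero, so the vanishing for h passes to its derivative. Differentiating z^{s/T}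
    (z-1)^{-p} gives the exponent raised by one at pole order p + 1, and z = 1 + (z - 1) then gives
    the unraised exponent. *)
Lemma act_ladder b m s (p : nat) : (0 < p)%N ->
  (forall u, act (vm A b (lE (q_ s) * y ^ (- p%:Z)) u) m = 0) ->
  (forall u, act (vm A b (lE (q_ s) * y ^ (- p.+1%:Z)) u) m = 0) /\
  (forall u, act (vm A b (lE (q_ (s + T%:Z)) * y ^ (- p.+1%:Z)) u) m = 0).
Proof.
move=> p0 h.
have e1 : q_ (s + T%:Z) = q_ s + 1 by rewrite (q_D K T) -[T%:Z]mulr1 (q_T K T0).
have h2 u : act (vm A b (lE (q_ (s + T%:Z)) * y ^ (- p.+1%:Z)) u) m = 0.
  have := D_vm A b (lE (q_ s) * y ^ (- p%:Z)) u; rewrite vm_D => /(congr1 (fun x => act x m)).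
  rewrite lderM lderE lder_yz -scalerAl -scalerAr.
  rewrite (is_linearD (act_linl m)) h act_D addr0 (is_linearN (act_linl m)) (vm_linh A) act_linl h.
  rewrite scaler0 add0r (is_linearZ (vm_linh A _ _)) (is_linearZ (act_linl m)) => /eqP.
  rewrite eq_sym oppr_eq0 scaler_eq0 intr_eq0 (_ : (- p%:Z == 0) = false) /=; last by lia.
  rewrite e1 lED (_ : - p%:Z - 1 = - p.+1%:Z); last by lia.
  by rewrite mulrAC mulrA => /eqP.
split=> // u; have := h2 u; rewrite e1 lED lE1y [_ * (1 + y)]mulrDr mulr1 mulrDl -mulrA -lyzS.
rewrite (_ : - p.+1%:Z + 1 = - p%:Z); last by lia.
by rewrite (is_linearD (vm_linh A _ _)) (is_linearD (act_linl m)) h addr0.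
Qed.

Lemma act_ladders b m s (p : nat) : (0 < p)%N ->
  (forall u, act (vm A b (lE (q_ s) * y ^ (- p%:Z)) u) m = 0) ->
  forall k i : nat, (i <= k)%N ->
  forall u, act (vm A b (lE (q_ (s + T%:Z * i%:Z)) * y ^ (- (p + k)%N%:Z)) u) m = 0.
Proof.
move=> p0 h; elim=> [|k IH] i.
  by rewrite leqn0 => /eqP ->; rewrite mulr0 addr0 addn0.
rewrite leq_eqVlt addnS => /orP[/eqP ->|hi].
  have [_] := act_ladder (leq_trans p0 (leq_addr k p)) (IH k (leqnn k)).
  by rewrite (_ : s + T%:Z * k.+1%:Z = s + T%:Z * k%:Z + T%:Z); last by lia.
by have [] := act_ladder (leq_trans p0 (leq_addr k p)) (IH i hi).
Qed.

(** Every such function is reached by the ladder from the generators defining the quotient: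
    z/(z-1)^2 for the class 0 and z^{r/T}/(z-1) for 0 < r < T. *)
Lemma act_Tf r b m h : cls r b -> Tf r 1 (-1) h -> forall u, act (vm A b h u) m = 0.
Proof.
move=> hb; elim=> [|k h1 h2 _ IH1 _ IH2|s p e1 e2 e3] u.
- by rewrite (is_linear0 (vm_linh A _ _)) (is_linear0 (act_linl m)).
- by rewrite (vm_linh A) act_linl IH1 IH2 scaler0 addr0.
have hr : (T%:Z %| r - (cl T (- s))%:Z)%Z.
  by have /dvdzP [x hx] := cl_dvd T0 (- s); have /dvdzP [x' hx'] := e1;
     apply/dvdzP; exists (- x - x'); lia.
have := cls_nat hb (cl_lt T0 _) hr; have /dvdzP [i hi] := cl_dvd T0 (- s).
have := cl_lt T0 (- s); move: hi; case: (cl T (- s)) => [|r0] hi hlt hb'.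
  have : forall u, act (vm A b (lE (q_ T%:Z) * y ^ (- 2%N%:Z)) u) m = 0.
    by move=> u'; rewrite -[T%:Z]mulr1 (q_T K T0); apply: act_O0.
  have es : s = T%:Z * - i by lia.
  have i1 : 1 <= - i by nia.
  have ip : - i < p%:Z by nia.
  have -> : s = T%:Z + T%:Z * (absz (- i - 1))%:Z by nia.
  have -> : p = (2 + (p - 2))%N by lia.
  by move=> h0; apply: act_ladders => //; lia.
have h0 : forall u, act (vm A b (lE (q_ r0.+1%:Z) * y ^ (- 1%N%:Z)) u) m = 0.
  by move=> u'; apply: act_Or => //; lia.
have es : s = r0.+1%:Z + T%:Z * - i by lia.
have i1 : 0 <= - i by nia.
have ip : - i < p%:Z by nia.
have -> : s = r0.+1%:Z + T%:Z * (absz i)%:Z by nia.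
have -> : p = (1 + (p - 1))%N by lia.
by apply: act_ladders => //; lia.
Qed.

Lemma fm_kl r b m : cls r b -> kl (fm m) r b 1.
Proof.
move=> hb r' a c h u h1 h2 h3 hh; exact: (act_Tf m hb (TfW T0 h1 h2 h3 hh) u).
Qed.
Lemma fm_Co m : Co (fm m).
Proof.
by split=> [|r b hb]; [exact: act_linl|exists 1 => h u hh; exact: (act_Tf m hb hh)].
Qed.

Lemma lres_EyV a : lres (lE a * y ^ (-1)) = 1.
Proof.
have -> : lE a * y ^ (-1) = y ^ (-1) + (lE a - 1) * y ^ (-1) by rewrite mulrBl mul1r addrC subrK.
rewrite lresD lres_yV lres_ord ?addr0 //.
have h1 : lord 1 (lE a - 1); last by apply: (lordW _ (lordM h1 (@lord_yz K (-1)))).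
move=> i hi; rewrite lcoB lco1; have [i0|i0] := ltP i 0.
  by rewrite (lord_E a i0) sub0r (_ : (i == 0) = false) ?oppr0 //; lia.
have -> : i = 0%N by lia.
by rewrite lcoE expr0 divr1 subrr.
Qed.

(** Taking the vacuum as second vector, u[z^{r/T}/(z-1)]1 equals u modulo D-images, as the residue
    of the test function is 1. *)
Lemma act_cls r u m : cls r u -> ~~ (T%:Z %| r)%Z -> act u m = 0.
Proof.
move=> hu hr; set r' := cl T (- r).
have h1 : (T%:Z %| r - r'%:Z)%Z by have /dvdzP [x hx] := cl_dvd T0 (- r); apply/dvdzP; exists (- x); lia.
have r0 : (0 < r' < T)%N.
  rewrite cl_lt // andbT lt0n; apply: contra hr => /eqP e.
  by rewrite e subr0 in h1.
have := act_Or vac m r0 (cls_nat hu (cl_lt T0 _) h1).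
rewrite (vm_vac (mu := 0) _ _ (act_linl m)) => [|v]; last by rewrite act_D scale0r.
by rewrite lE0 mulr1 lres_EyV scale1r.
Qed.

Lemma act_pj u m : act (pj 0 u) m = act u m.
Proof.
rewrite [in RHS](pj_sum u) (is_linear_sum (act_linl m)).
rewrite (bigD1 (Ordinal T0)) //= big1 ?addr0 // => r hr.
apply: (act_cls _ (pj_cls r u)); apply: contra hr => /dvdzP [x hx].
have lr := ltn_ord r; have x0 : x = 0 by nia.
by apply/eqP/val_inj => /=; rewrite x0 in hx; lia.
Qed.

Lemma fm_deg m : deg (fm m) 0.
Proof.
split=> [u|r u hu hr]; first by rewrite /fm act_D mul0r oppr0 scale0r.
by apply: (act_cls _ hu); rewrite subr0 in hr.
Qed.

Lemma dm_fm_neg b s m u : s < 0 -> dm b s (fm m) u = 0.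
Proof.
move=> hs; have kf := fm_kl m (pj_cls (cl T s) b).
rewrite (dmE (fm_Co m).1 kf (leqnn _)) /dm_ev; set n := (1 + _)%N.
rewrite (kf (- s + 0) (- s + 0) (- s - T%:Z * n%:Z)) ?oppr0 //; try by rewrite /n; nia.
  have := cl_dvd T0 s => /dvdzP [x hx]; apply/dvdzP; exists (- x); lia.
by apply: (TfM T0); [exact: (Tf_E K T0)|exact: (chi_inf K T0)].
Qed.

(** On this functional chi may be replaced by -1/(z-1). Skew-symmetry modulo D-images exchanges the
    two vectors and turns 1/(z-1) into z/(z-1), so the Zhu product of u and b appears in the order
    the action needs. *)
Lemma dm_fm0 b m u : dm b 0 (fm m) u = fm (act b m) u.
Proof.
have kf := fm_kl m (pj_cls (cl T 0) b).
rewrite (dmE (fm_Co m).1 kf (leqnn _)) /dm_ev; set n := (1 + _)%N.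
rewrite cl0 in kf *; set b' := pj 0 b in kf *; rewrite oppr0 mul0r lE0 mul1r.
rewrite -[chi K n](subrK (- y ^ (-1))) (is_linearD (vm_linh A _ _)) (is_linearD (fm_Co m).1).
rewrite [X in X + _](kf 0 T%:Z (- T%:Z)) ?subrr ?dvdz0 ?add0r //; [|lia|exact: chi_yV].
rewrite (is_linearN (vm_linh A _ _)) (is_linearN (fm_Co m).1) opprK /fm.
have act_D' v : act (D v) m = 0 *: act v m by rewrite act_D scale0r.
rewrite /vm (pr_raddf _ (act_linl m)); last exact: ubd_vm.
rewrite (skew_pr u b' _ (act_linl m) (creation_eig (act_linl m) act_D')) -(pr_raddf _ (act_linl m)); last exact: ubd_vm.
rewrite -/(vm A u _ b').
have -> : lsig (y ^ (-1)) * lE (- 0) = - (lE 1 * y ^ (-1)).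
  rewrite oppr0 lE0 mulr1.
  have e1 : lsig (y ^ (-1)) * lsig y = 1 by rewrite -lsigM [y ^ _ * _]mulrC -lyzS addNr expr0z lsig1.
  have e2 : lsig y * - (lE 1 * y ^ (-1)) = 1.
    by rewrite lsig_y mulrNN mulrACA -lED addNr lE0 mul1r -lyzS addNr expr0z.
  by rewrite -[LHS]mulr1 -e2 mulrA e1 mul1r.
rewrite (is_linearN (vm_linh A _ _)) (is_linearN (act_linl m)) opprK.
rewrite (pj_sum u) (is_linear_sum (vm_linb A _ _)) !(is_linear_sum (act_linl _)).
apply: eq_bigr => r _; case: (posnP r) => [->|r0].
  by rewrite act_mul; [rewrite /b' [act (pj 0 b) m]act_pj|exact: (pj_cls 0)].
have hr : ~~ (T%:Z %| r%:Z)%Z.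
  apply/negP => /dvdzP [x hx]; have lr := ltn_ord r.
  have x0 : x = 0 by nia.
  by rewrite x0 in hx; lia.
rewrite (act_cls _ (pj_cls r u) hr) (act_cls _ (cls_vm cls_sub cls_mode _ (pj_cls r u) (pj_cls 0 b))) //.
by rewrite addr0.
Qed.

(** * The irreducible module over a simple Zhu module *)

Section Construction.
Hypothesis simple : (exists m : M, m <> 0) /\ forall S : M -> Prop, is_subspace S ->
  (forall a m, S m -> S (act a m)) -> (forall m, S m -> m = 0) \/ (forall m, S m).

Lemma Co_sub : is_subspace (Co : (V -> M) -> Prop).
Proof.
split.
  split=> [a x x'|r b hb]; first by rewrite /= scaler0 addr0.
  by exists 0.
move=> a f g hf hg; split=> [c x x'|r b hb].
  by rewrite !fct_linP (hf.1 c) (hg.1 c) !scalerDr !scalerA [a * c]mulrC addrACA.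
have [N1 h1] := Co_kl hf hb; have [N2 h2] := Co_kl hg hb; exists (N1 + N2)%N%:Z => h u hh.
rewrite fct_linP (h1 N1 (leqnn _) r _ _ _ _ _ _ _ hh) ?(h2 N2 (leqnn _) r _ _ _ _ _ _ _ hh) ?scaler0 ?addr0 ?subrr ?dvdz0 //; lia.
Qed.

(** The whole coinduced space is made a module before the span of M: stability of that span under
    modes relies on [product_span] in the larger space. *)
Let DD := sublm Co_sub.
Definition mdD v s (w : DD) : DD := slmk Co_sub (Co_dm v s (slvalP w)).

Let vD (w : DD) : V -> M := slval w.
Let vD_lin u : is_linear (fun w : DD => vD w u).
Proof. by move=> a x x'; rewrite /vD (slval_lin a x x'). Qed.
Let vD_inj w : (forall u, vD w u = 0) -> w = 0.
Proof.
move=> h; apply: (@slval_inj _ _ _ Co_sub); rewrite (is_linear0 (@slval_lin _ _ _ Co_sub)).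
by apply: funext => u; apply: h.
Qed.
Let vD_Co w : Co (vD w). Proof. exact: (slvalP w). Qed.
Let vD_md v s w u : vD (mdD v s w) u = dm v s (vD w) u. Proof. by []. Qed.

Lemma mdD_tmod : tmod A T cls mdD.
Proof. by apply: (emb_tmod T0) vD_lin vD_inj vD_Co vD_md. Qed.
Lemma mdD_WB q : (0 < q)%N -> WBq A T cls mdD q.
Proof. by move=> hq; apply: (emb_WB T0) vD_lin vD_inj vD_Co vD_md _ hq. Qed.

Definition FmD m : DD := slmk Co_sub (fm_Co m).

Lemma FmD_Om m : Om mdD (FmD m).
Proof. by move=> v s hs; apply: vD_inj => u; rewrite vD_md dm_fm_neg. Qed.

Definition spanD (w : DD) := exists l : seq (V * int * M),
  w = \sum_(x <- l) mdD x.1.1 x.1.2 (FmD x.2).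

Lemma spanD_sub : is_subspace spanD.
Proof.
split; first by exists [::]; rewrite big_nil.
move=> a x x' [l ->] [l' ->]; exists ([seq (a *: z.1.1, z.1.2, z.2) | z <- l] ++ l').
rewrite big_cat big_map /= scaler_sumr; congr (_ + _).
by apply: eq_bigr => z _; rewrite (is_linearZ (tm_linl mdD_tmod _ _)).
Qed.
Lemma spanD_md v s w : spanD w -> spanD (mdD v s w).
Proof.
move=> [l ->]; rewrite (is_linear_sum (tm_linr mdD_tmod v s)); apply: (subs_sum spanD_sub) => x _.
have [Q hQ] := product_span A T0 pj_cls pj_sum v x.1.1 s x.1.2 0.
exists [:: (Q, s + x.1.2, x.2)]; rewrite big_seq1 /=.
apply: (hQ _ _ mdD_tmod mdD_WB) => s' hs'; exact: FmD_Om.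
Qed.

Let W := sublm spanD_sub.
Definition mdW v s (w : W) : W := slmk spanD_sub (spanD_md v s (slvalP w)).
Definition vl (w : W) : V -> M := vD (slval w).

Lemma vl_lin u : is_linear (fun w : W => vl w u).
Proof. by move=> a x x'; rewrite /vl (slval_lin a x x') vD_lin. Qed.
Lemma vl_inj w : (forall u, vl w u = 0) -> w = 0.
Proof.
move=> /vD_inj h; apply: (@slval_inj _ _ _ spanD_sub).
by rewrite (is_linear0 (@slval_lin _ _ _ spanD_sub)).
Qed.
Lemma vl_Co w : Co (vl w). Proof. exact: vD_Co. Qed.
Lemma vl_md v s w u : vl (mdW v s w) u = dm v s (vl w) u. Proof. by []. Qed.

Lemma mdW_tmod : tmod A T cls mdW.
Proof. by apply: (emb_tmod T0) vl_lin vl_inj vl_Co vl_md. Qed.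
Lemma mdW_WB q : (0 < q)%N -> WBq A T cls mdW q.
Proof. by move=> hq; apply: (emb_WB T0) vl_lin vl_inj vl_Co vl_md _ hq. Qed.

Lemma FmD_span m : spanD (FmD m).
Proof. by exists [:: (vac, 0, m)]; rewrite big_seq1 /= (tm_vac mdD_tmod). Qed.
Definition FW m : W := slmk spanD_sub (FmD_span m).
Lemma FW_val m u : vl (FW m) u = act u m. Proof. by []. Qed.

Lemma vl_ext w w' : (forall u, vl w u = vl w' u) -> w = w'.
Proof.
move=> h; apply/eqP; rewrite -subr_eq0; apply/eqP/vl_inj => u.
by rewrite (is_linearB (vl_lin u)) h subrr.
Qed.
Lemma FW_lin : is_linear FW.
Proof. by move=> a x x'; apply: vl_ext => u; rewrite vl_lin !FW_val act_linr. Qed.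
Lemma FW_inj m : FW m = 0 -> m = 0.
Proof. by move=> e; rewrite -(act_vac m) -FW_val e (is_linear0 (vl_lin _)). Qed.
Lemma FW_0 v m : mdW v 0 (FW m) = FW (act v m).
Proof. by apply: vl_ext => u; rewrite vl_md; apply: dm_fm0. Qed.

Lemma W_span w : exists l : seq (V * int * M), w = \sum_(x <- l) mdW x.1.1 x.1.2 (FW x.2).
Proof.
have [l hl] := slvalP w; exists l; apply: (@slval_inj _ _ _ spanD_sub).
by rewrite hl (is_linear_sum (@slval_lin _ _ _ spanD_sub)).
Qed.

Definition grW (a : nat) w := deg (vl w) a.

Lemma grW_sub a : is_subspace (grW a).
Proof.
have e0 : vl 0 = (fun=> 0) by apply: funext => u; exact: is_linear0 (vl_lin u).
split; first by rewrite /grW e0; split=> [u|r u _ _]; rewrite ?scaler0.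
move=> c x x' hx hx'; rewrite /grW.
have -> : vl (c *: x + x') = (fun u => c *: vl x u + vl x' u) by apply: funext => u; exact: vl_lin.
exact: deg_lin.
Qed.

Lemma grW_gen b s m : 0 <= s -> grW (absz s) (mdW b s (FW m)).
Proof.
move=> hs; rewrite /grW; have -> : (absz s)%:Z = 0 + s by lia.
exact: (deg_dm b s (fm_Co m) (fm_deg m)).
Qed.

(** The last clause records that the degree-zero term comes from M, which is how the bottom
    component is identified with M. *)
Definition decW w := exists (n : nat) (ws : nat -> W) m,
  [/\ forall a, grW a (ws a), forall n', (n <= n')%N -> w = \sum_(a < n') ws a & ws 0%N = FW m].

Lemma decD w w' : decW w -> decW w' -> decW (w + w').
Proof.
move=> [n [ws [m [h1 h2 h3]]]] [n' [ws' [m' [h1' h2' h3']]]].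
exists (n + n')%N, (fun a => ws a + ws' a), (m + m'); split=> [a|n2 hn2|].
- exact: (subsD (grW_sub a)).
- by rewrite big_split /= -h2 -?h2' //; lia.
- by rewrite h3 h3' (is_linearD FW_lin).
Qed.

Lemma dec_hom a w m : grW a w -> (a = 0%N -> w = FW m) -> decW w.
Proof.
move=> hw h0; exists a.+1, (fun i => if i == a then w else 0), (if a == 0%N then m else 0).
split=> [b|n' hn'|].
- by case: eqP => [->|_] //; apply: subs0 (grW_sub b).
- rewrite (bigD1 (Ordinal hn')) //= eqxx big1 ?addr0 // => j hi.
  by rewrite ifF //; apply: contraNF hi => /eqP e; apply/eqP/val_inj.
- rewrite eq_sym; case: eqP => [/h0 //|_]; by rewrite (is_linear0 FW_lin).
Qed.

Lemma decWP w : decW w.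
Proof.
have [l ->] := W_span w; elim: l => [|[[b s] m] l IH].
  by rewrite big_nil; apply: (@dec_hom 0%N _ 0); [exact: subs0 (grW_sub 0)|rewrite (is_linear0 FW_lin)].
rewrite big_cons; apply: decD IH; rewrite /=; have [lt|le] := ltP s 0.
  have -> : mdW b s (FW m) = 0 by apply: vl_inj => u; rewrite vl_md; apply: dm_fm_neg.
  by apply: (@dec_hom 0%N _ 0); [exact: subs0 (grW_sub 0)|rewrite (is_linear0 FW_lin)].
apply: (@dec_hom (absz s) _ (act b m)); first exact: grW_gen.
move=> s0; have -> : s = 0 by lia.
exact: FW_0.
Qed.

Lemma q_inj_nat (c : int) : c < 0 ->
  injective (fun a : nat => - q_ (if a is a'.+1 then a'%:Z else c) : K).
Proof.
move=> hc a b /oppr_inj/(q_inj T0); case: a b => [|a] [|b] //; lia.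
Qed.

Lemma deg_iter f c u k : deg f c -> f (iter k D u) = (- q_ c) ^+ k *: f u.
Proof.
move=> [h _]; elim: k => [|k IH] /=; first by rewrite scale1r.
by rewrite h IH scalerA exprS.
Qed.

(* an element of negative degree would be an eigenvector of D independent
   of the homogeneous components of W *)
Lemma deg_neg w c : c < 0 -> deg (vl w) c -> w = 0.
Proof.
move=> hc hw; have [n [ws [m [h1 h2 _]]]] := decWP w; apply: vl_inj => u.
have := @eigen_indep _ M _ n.+1 (fun a => if a is a'.+1 then vl (ws a') u else - vl w u) (q_inj_nat hc).
move=> h; apply/eqP; rewrite -oppr_eq0; apply/eqP; apply: (h _ 0%N) => // k.
rewrite big_ord_recl /= scalerN -(deg_iter _ _ hw) [in X in - X](h2 n (leqnn n)).
rewrite (is_linear_sum (vl_lin _)) addrC; apply/eqP; rewrite subr_eq0; apply/eqP.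
by apply: eq_bigr => a _; rewrite (deg_iter _ _ (h1 a)).
Qed.

Lemma grW_md v s a w : grW a w ->
  if 0 <= a%:Z + s then grW (absz (a%:Z + s)) (mdW v s w) else mdW v s w = 0.
Proof.
move=> hw; have h := deg_dm v s (vl_Co w) hw; case: ifP => hs.
  by rewrite /grW; have -> : (absz (a%:Z + s))%:Z = a%:Z + s by lia.
by apply: (@deg_neg (mdW v s w) (a%:Z + s) _ h); lia.
Qed.

Lemma grW_ind (n : nat) (ws : nat -> W) : (forall a, grW a (ws a)) ->
  \sum_(a < n) ws a = 0 -> forall a, (a < n)%N -> ws a = 0.
Proof.
move=> h1 h2 a ha; apply: vl_inj => u.
have inj : injective (fun a : nat => - q_ a%:Z : K) by move=> b c /oppr_inj/(q_inj T0); lia.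
apply: (@eigen_indep _ M _ n (fun a => vl (ws a) u) inj) => // k.
under eq_bigr => b _ do rewrite -(deg_iter _ _ (h1 b)).
by rewrite -(is_linear_sum (vl_lin _)) h2 (is_linear0 (vl_lin _)).
Qed.

Lemma W_grading : grading mdW grW.
Proof.
split; [exact: grW_sub| |exact: grW_ind|exact: grW_md|].
  move=> w; have [n [ws [m [h1 h2 _]]]] := decWP w; exists n, ws; split=> //; exact: h2.
have [[m m0] _] := simple; exists (FW m); split; last by move/FW_inj.
exact: fm_deg.
Qed.

(** Replacing the degree-zero term of a decomposition of w by its difference with w gives a
    vanishing homogeneous sum. The element of M is then the value at the vacuum. *)
Lemma grW0 w : grW 0 w -> w = FW (vl w vac).
Proof.
move=> hw; have [n [ws [m [h1 h2 h3]]]] := decWP w.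
have := @grW_ind n.+1 (fun a => if a == 0%N then ws a - w else ws a) _ _ 0%N (ltn0Sn n).
have -> : w = ws 0%N; last by rewrite h3 FW_val act_vac.
apply/eqP; rewrite eq_sym -subr_eq0; apply/eqP.
apply: (@grW_ind n.+1 (fun a => if a == 0%N then ws a - w else ws a) _ _ 0%N) => //.
  by case=> [|a] //=; apply: (subsB (grW_sub 0)).
rewrite big_ord_recl /= addrAC [in X in _ - X](h2 n.+1 (leqnSn n)) big_ord_recl /=.
by rewrite subrr.
Qed.

(** The top non-zero component has a non-zero value at some u. The mode of u of exponent -n kills
    the lower components and sends the top one to the bottom element given by that value. *)
Lemma W_top (S : W -> Prop) : (forall v s w, S w -> S (mdW v s w)) ->
  forall (n : nat) (ws : nat -> W), (forall a, grW a (ws a)) ->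
  S (\sum_(a < n) ws a) -> \sum_(a < n) ws a <> 0 -> exists m, m <> 0 /\ S (FW m).
Proof.
move=> hS; elim=> [|n IH] ws h1 h2 h3; first by rewrite big_ord0 in h3.
case: (pselect (ws n = 0)) => [e|ne].
  by rewrite big_ord_recr /= e addr0 in h2 h3; apply: IH h2 h3.
have [u hu] : exists u, vl (ws n) u <> 0.
  by apply/existsNP => h; apply/ne/vl_inj => u; apply: h.
have hz : mdW u (- n%:Z) (\sum_(a < n.+1) ws a) = mdW u (- n%:Z) (ws n).
  rewrite big_ord_recr /= (is_linearD (tm_linr mdW_tmod _ _)) (is_linear_sum (tm_linr mdW_tmod _ _)).
  rewrite big1 ?add0r // => a _; have := grW_md u (- n%:Z) (h1 a); rewrite ifF //.
  by apply/negbTE; have := ltn_ord a; lia.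
have := grW_md u (- n%:Z) (h1 n); rewrite subrr lexx => /grW0.
have -> : vl (mdW u (- n%:Z) (ws n)) vac = vl (ws n) u.
  by rewrite vl_md; apply: dm_vac_ev; [exact: vl_Co|exact: h1].
by move=> e; exists (vl (ws n) u); split=> //; rewrite -e -hz; apply: hS.
Qed.

Lemma W_irr : irr mdW.
Proof.
split; first by have [w [_ h]] := gr_nz W_grading; exists w.
move=> S hS hmd; case: (pselect (forall w, S w -> w = 0)) => [|h]; [by left|right].
have [w [hw w0]] : exists w, S w /\ w <> 0.
  by apply: contrapT => h'; apply: h => w hw; apply: contrapT => w0; apply: h'; exists w.
have [n [ws [m [h1 h2 _]]]] := decWP w.
have [m' [m0 hm]] : exists m, m <> 0 /\ S (FW m).
  by apply: (@W_top S hmd n ws h1); rewrite -(h2 n (leqnn n)).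
have [||z|z] := simple.2 (fun m => S (FW m)).
- split; first by rewrite (is_linear0 FW_lin); apply: subs0.
  by move=> a x x' hx hx'; rewrite FW_lin; apply: subsP.
- by move=> a x hx; rewrite -FW_0; apply: hmd.
- by case: m0; apply: z.
move=> w'; have [l ->] := W_span w'; apply: (subs_sum hS) => x _; exact/hmd/z.
Qed.

Theorem zhu_module : exists (X : lmodType K) (md : V -> int -> X -> X) (gr : nat -> X -> Prop) (F : M -> X),
  [/\ tmod A T cls md, (forall q, (0 < q)%N -> WBq A T cls md q), grading md gr & irr md] /\
  [/\ is_linear F, forall m, F m = 0 -> m = 0, forall m, Om md (F m),
      forall w, Om md w -> exists m, w = F m & forall v m, md v 0 (F m) = F (act v m)].
Proof.
exists W, mdW, grW, FW; split; split; first exact: mdW_tmod.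
- exact: mdW_WB.
- exact: W_grading.
- exact: W_irr.
- exact: FW_lin.
- exact: FW_inj.
- by move=> m v s hs; apply: vl_inj => u; rewrite vl_md; apply: dm_fm_neg.
- have [p hp] := proj0_ex T0 W_grading => w hw; exists (vl w vac); apply: grW0.
  exact: (Om_gr T0 pj_cls pj_sum mdW_tmod mdW_WB W_grading hp W_irr hw).
- exact: FW_0.
Qed.
End Construction.
End Action.
End FromZhu.

(** * The eigenspaces of g *)
Section RootOfUnity.
Variable R : realType.
Variable T : nat.
Hypothesis T0 : (0 < T)%N.
Local Notation om := (omegaT R T).
Local Notation th := (2%:R * pi / T%:R : R).

Lemma omegaX k : om ^+ k = Complex (cos (k%:R * th)) (- sin (k%:R * th)).
Proof.
elim: k => [|k IH]; first by rewrite expr0 mul0r cos0 sin0 oppr0.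
have -> : k.+1%:R * th = th + k%:R * th by rewrite -natr1; ring.
rewrite exprS IH cosD sinD /omegaT; apply/eqP; rewrite eq_complex /=.
by apply/andP; split; apply/eqP; ring.
Qed.

Lemma omegaT1 : om ^+ T = 1.
Proof.
rewrite omegaX (_ : T%:R * th = pi *+ 2).
  by rewrite cos2pi sin2pi oppr0.
by rewrite mulrC mulfVK ?mulr_natl // pnatr_eq0 -lt0n.
Qed.

(** The real part of omega^k is 1 - 2 sin(k pi/T)^2, and 0 < k pi/T < pi. *)
Lemma omega_prim k : (0 < k < T)%N -> om ^+ k != 1.
Proof.
move=> /andP[k0 kT]; apply/eqP; rewrite omegaX => /(congr1 (@complex.Re R)) /=.
set x := k%:R * pi / T%:R : R.
have TR : 0 < T%:R :> R by rewrite ltr0n.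
have -> : k%:R * th = x *+ 2 by rewrite /x -mulr_natl; ring.
have sx : 0 < sin x.
  apply: sin_gt0_pi; rewrite divr_gt0 ?mulr_gt0 ?pi_gt0 ?ltr0n //=.
  by rewrite ltr_pdivrMr // mulrC ltr_pM2l ?pi_gt0 // ltr_nat.
rewrite cos_mulr2n => e; have := cos2Dsin2 x; have := exprn_gt0 2 sx; lra.
Qed.

Lemma omega_unit : om \is a GRing.unit.
Proof. by rewrite unitfE; apply/eqP => e; have := omegaT1; rewrite e expr0n gtn_eqF // => /eqP; rewrite eq_sym oner_eq0. Qed.

Lemma omega_mod (i j : int) : (T%:Z %| i - j)%Z -> om ^ i = om ^ j.
Proof.
move=> /dvdzP [x hx]; have -> : i = j + T%:Z * x by lia.
by rewrite expfzDr ?exprz_exp -?unitfE ?omega_unit // -exprz_exp -exprnP omegaT1 exp1rz mulr1.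
Qed.

Lemma omega_eq1 (i : int) : (om ^ i == 1) = (T%:Z %| i)%Z.
Proof.
apply/idP/idP => [|h]; last by rewrite (@omega_mod i 0) ?subr0 // expr0z.
rewrite (@omega_mod i (cl T (- i))%:Z); last first.
  by have /dvdzP [x hx] := cl_dvd T0 (- i); apply/dvdzP; exists (- x); lia.
have /dvdzP [x hx] := cl_dvd T0 (- i).
case: (posnP (cl T (- i))) => [e _|c0].
  by apply/dvdzP; exists (- x); rewrite e in hx; lia.
by rewrite -exprnP (negbTE (omega_prim _)) // c0 (cl_lt T0).
Qed.

Lemma omega_sum (i : int) : \sum_(j < T) om ^ (i * j%:Z) = if (T%:Z %| i)%Z then T%:R else 0.
Proof.
under eq_bigr => j _ do rewrite -exprz_exp -exprnP.
case: ifP => h.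
  move: h; rewrite -omega_eq1 => /eqP ->; under eq_bigr do rewrite expr1n.
  by rewrite sumr_const card_ord.
have := subrX1 (om ^ i) T; rewrite exprnP exprz_exp mulrC -exprz_exp -exprnP omegaT1 exp1rz subrr.
move=> /esym/eqP; rewrite mulf_eq0 subr_eq0 omega_eq1 h /=.
by move=> /eqP.
Qed.
End RootOfUnity.

Section Eigenspaces.
Variable R : realType.
Local Notation C := (complex R).
Variable V : lmodType C.
Variable A : vertex_algebra V.
Variable g : V -> V.
Variable T : nat.
Hypothesis T0 : (0 < T)%N.
Hypothesis ga : is_va_automorphism A g.
Hypothesis gT : forall v, iter T g v = v.
Local Notation om := (omegaT R T).

Definition gcls (r : int) (v : V) := g v = om ^ r *: v.

Lemma g_lin : is_linear g. Proof. by have [] := ga. Qed.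
Lemma g_iter_lin j : is_linear (iter j g).
Proof. by elim: j => [|j IH] a x x' //=; rewrite IH g_lin. Qed.

Lemma gcls_iter r v j : gcls r v -> iter j g v = om ^ (r * j%:Z) *: v.
Proof.
move=> hv; elim: j => [|j IH] /=; first by rewrite mulr0 expr0z scale1r.
rewrite IH (is_linearZ g_lin) hv scalerA -expfzDr; last by rewrite -unitfE omega_unit.
by congr (_ ^ _ *: _); lia.
Qed.

Lemma gcls_sub r : is_subspace (gcls r).
Proof.
split; first by rewrite /gcls (is_linear0 g_lin) scaler0.
move=> a x x' hx hx'; rewrite /gcls g_lin hx hx' scalerDr !scalerA; congr (_ *: _ + _).
exact: mulrC.
Qed.

Lemma gcls_vac : gcls 0 (vac A).
Proof. by have [_ [_ [h _]]] := ga; rewrite /gcls h expr0z scale1r. Qed.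

Lemma gcls_mode r r' b d l : gcls r b -> gcls r' d -> gcls (r + r') (vmode A b l d).
Proof.
have [_ [_ [_ h]]] := ga; move=> hb hd; rewrite /gcls h hb hd.
rewrite (is_linearZ (vmode_linl A _ _)) (is_linearZ (vmode_linr A _ _)) scalerA -expfzDr //.
by rewrite -unitfE omega_unit.
Qed.

Lemma gprojE r u : gproj g T r u = (T%:R)^-1 *: \sum_(j < T) om ^ (- r%:Z * j%:Z) *: iter j g u.
Proof.
rewrite /gproj; congr (_ *: _); apply: eq_bigr => j _; congr (_ *: _).
by rewrite exprVn exprnN mulNr -PoszM.
Qed.

(** g shifts the orbit sum cyclically; the two ends agree because g and omega both have T-th power
    1. *)
Lemma gproj_cls r u : gcls r%:Z (gproj g T r u).
Proof.
have u0 : om != 0 by rewrite -unitfE omega_unit.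
rewrite /gcls gprojE (is_linearZ g_lin) (is_linear_sum g_lin) !scalerA mulrC -scalerA.
congr (_ *: _); rewrite scaler_sumr.
pose F (j : nat) := om ^ (r%:Z * (1 - j%:Z)) *: iter j g u.
rewrite (eq_bigr (fun j : 'I_T => F j.+1)) => [|j _]; last first.
  by rewrite (is_linearZ g_lin) /F /=; congr (om ^ _ *: _); lia.
rewrite [RHS](eq_bigr (fun j : 'I_T => F j)) => [|j _]; last first.
  by rewrite scalerA -expfzDr // /F; congr (om ^ _ *: _); lia.
have FT : F T = F 0%N.
  rewrite /F gT; congr (_ *: _); apply: omega_mod => //; apply/dvdzP; exists (- r%:Z); lia.
have e1 : \sum_(j < T.+1) F j = F 0%N + \sum_(j < T) F j.+1 by rewrite big_ord_recl.
have e2 : \sum_(j < T.+1) F j = \sum_(j < T) F j + F T by rewrite big_ord_recr.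
by apply: (addrI (F 0%N)); rewrite -e1 e2 FT addrC.
Qed.

Lemma gproj_lin r : is_linear (gproj g T r).
Proof.
move=> a x x'; rewrite !gprojE scalerA mulrC -scalerA -scalerDr; congr (_ *: _).
rewrite scaler_sumr -big_split /=; apply: eq_bigr => j _.
by rewrite g_iter_lin scalerDr !scalerA [_ * a]mulrC.
Qed.

Lemma TC0 : T%:R != 0 :> C. Proof. by rewrite pnatr_eq0 -lt0n. Qed.

Lemma gproj_sum v : v = \sum_(r < T) gproj g T r v.
Proof.
under eq_bigr do rewrite gprojE.
rewrite -scaler_sumr exchange_big /= (bigD1 (Ordinal T0)) //= [X in _ + X]big1 => [|j j0].
  rewrite addr0; under eq_bigr do rewrite mulr0 expr0z scale1r.
  by rewrite sumr_const card_ord -[_ *+ T in X in _ *: X]scaler_nat scalerA mulVf ?scale1r // TC0.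
rewrite -scaler_suml (eq_bigr (fun r : 'I_T => om ^ (- j%:Z * r%:Z))) => [|r _]; last first.
  by congr (_ ^ _); lia.
rewrite omega_sum // ifF ?scale0r //; apply: contraNF j0 => /dvdzP [x hx].
have lj := ltn_ord j; have x0 : x = 0 by nia.
by apply/eqP/val_inj => /=; rewrite x0 in hx; lia.
Qed.

Lemma gproj_id r v (r' : nat) : gcls r v -> (r' < T)%N ->
  gproj g T r' v = if (T%:Z %| r - r'%:Z)%Z then v else 0.
Proof.
move=> hv _; rewrite gprojE; under eq_bigr => j _ do rewrite (gcls_iter _ hv) scalerA.
rewrite -scaler_suml (eq_bigr (fun j : 'I_T => om ^ ((r - r'%:Z) * j%:Z))) => [|j _]; last first.
  by rewrite -expfzDr; [congr (_ ^ _); lia|rewrite -unitfE omega_unit].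
rewrite omega_sum //; case: ifP => _; last by rewrite scale0r scaler0.
by rewrite scalerA mulVf ?scale1r // TC0.
Qed.
End Eigenspaces.

(** * Translation between the axioms and exponent-indexed modes *)

Section Dictionary.
Variable R : realType.
Local Notation C := (complex R).
Variable V : lmodType C.
Variable A : vertex_algebra V.
Variable g : V -> V.
Variable T : nat.
Hypothesis T0 : (0 < T)%N.
Hypothesis ga : is_va_automorphism A g.
Hypothesis gT : forall v, iter T g v = v.
Local Notation om := (omegaT R T).
Local Notation cls := (@gcls R V g T).
Local Notation pj := (gproj g T).
Local Notation mo := (vmode A).
Local Notation D := (vaD A).
Local Notation q_ s := (s%:~R / T%:R : C).
Local Notation twm W := (@tw_mode R V A g T W).

Let pj_cls r u : cls r%:Z (pj r u) := gproj_cls T0 ga gT r u.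
Let pj_sum v : v = \sum_(r < T) pj r v := gproj_sum g T0 v.

(** The test function x^{-j-1} reads off the coefficient of x_0^j, which links [hform] with the
    coefficientwise axiom. *)
Lemma pr_lmonE (W : lmodType C) k j (phi : int -> W) :
  pr (lmon C (- j - 1) * ly C ^+ k) phi = zsum (fun l => expm1_coef R k (j + l + 1) *: phi l).
Proof.
apply: eq_zsum => l; congr (_ *: _); rewrite lco_monM lco_yX.
by have -> : l - (- j - 1) = j + l + 1 by lia.
Qed.

Lemma lres_lmonE j (a : C) : lres (lmon C (- j - 1) * lE a) =
  if j < 0 then 0 else a ^+ absz j / (absz j)`!%:R.
Proof.
rewrite /lres lco_monM (_ : -1 - (- j - 1) = j); last by lia.
case: ifP => hj; first exact: (lord_E a hj).
by have {1}-> : j = (absz j)%:Z by lia.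
Qed.

Section ToModule.
Variable W : TwModule A g T.

(** [tw_mode v j] is the coefficient of x^{-j/T-1}, hence the exponent s/T is j = -s - T. *)
Definition tmd (v : V) (s : int) (w : tw_car W) := twm W v (- s - T%:Z) w.

Lemma tmdE v j w : twm W v j w = tmd v (- j - T%:Z) w.
Proof. by rewrite /tmd; congr (tw_mode _ _ _); lia. Qed.

Lemma tmd_tmod : tmod A T cls tmd.
Proof.
split.
- move=> s w; exact: (@tw_linl _ _ _ _ _ W).
- move=> v s; exact: (@tw_linr _ _ _ _ _ W).
- move=> v w; have [N hN] := @tw_trunc _ _ _ _ _ W v w; exists (- N - T%:Z) => s hs.
  by apply: hN; lia.
- move=> s w; rewrite /tmd tw_vac; congr (if _ then _ else _).
  by apply/eqP/eqP; lia.
move=> r v s w hv hn; have := @tw_g _ _ _ _ _ W v (- s - T%:Z) w; rewrite hv.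
rewrite (is_linearZ (@tw_linl _ _ _ _ _ W _ _)) => /eqP; rewrite -subr_eq0 -scalerBl scaler_eq0.
case/orP => [|/eqP //]; rewrite subr_eq0 => /eqP e; case/negP: hn.
rewrite -(omega_eq1 R T0); have u0 : om != 0 by rewrite -unitfE omega_unit.
rewrite (omega_mod R T0 (j := r - (- s - T%:Z))); last by apply/dvdzP; exists (-1); lia.
by rewrite expfzDr // e -expfzDr // subrr.
Qed.

Lemma tmd_tF u v k w s t : tF T tmd u v k w s t = twF T (twm W) u v k w s t.
Proof.
apply: eq_bigr => i _; congr (_ *: _); rewrite /tmd.
have -> : - (s - T%:Z * (k%:Z - i%:Z)) - T%:Z = T%:Z * (k%:Z - i%:Z - 1) - s by lia.
by have -> : - (t - T%:Z * i%:Z) - T%:Z = T%:Z * (i%:Z - 1) - t by lia.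
Qed.

Lemma tmd_hform u v : exists k, hform A T tmd u v k.
Proof.
have [k hk] := @tw_assoc _ _ _ _ _ W u v; exists k => w; have [N [h1 h2]] := hk w; exists N.
have h1' s t : (s < N) || (t < N) -> tF T tmd u v k w s t = 0 by rewrite tmd_tF; apply: h1.
split=> // M h; have ub := ubd_md tmd_tmod u v M w; have [n0 hn0] := ub.
apply/eqP; rewrite -subr_eq0; apply/eqP; move: h.
have fin h := hform_fin T0 (fun s => lres (h * lE (q_ s))) (M + T%:Z * k%:Z) h1'.
apply: (@cont_ext _ _ _ (Num.max 0 n0)).
- apply: is_linear_sub.
    by move=> a x x'; rewrite mulrDl -scalerAl (pr_lin ub).
  move=> a x x'; rewrite (zsum_raddf (g := fun z => a *: z)) ?scaler0 //; last by move=> z z'; rewrite scalerDr.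
  rewrite -zsumD //; last first.
    by have [n hn] := fin x; exists n => i hi; rewrite hn ?scaler0.
  apply: eq_zsum => s; rewrite mulrDl -scalerAl lresD lresZ scalerDl scalerA //.
- move=> h hh; rewrite (pr_ord (N := n0)) ?sub0r //; last first.
    by apply: (lordW _ (lordM hh (lordX (n := k) (lord_y C)))); lia.
  rewrite zsum0 ?oppr0 // => s; rewrite lres_ord ?scale0r //.
  by apply: (lordW _ (lordM hh (lord_E (q_ s)))); lia.
move=> n; have -> : n = - (- n - 1) - 1 by lia.
rewrite pr_lmonE; have := h2 (M + T%:Z * k%:Z) (- n - 1).
have -> : T%:Z * (k%:Z - 1) - (M + T%:Z * k%:Z) = - M - T%:Z by lia.
move=> ->; apply/eqP; rewrite subr_eq0; apply/eqP; case: ifP => hj.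
  by rewrite zsum0 // => s; rewrite lres_lmonE hj scale0r.
by apply: eq_zsum => s; rewrite lres_lmonE hj tmd_tF.
Qed.

Lemma tmd_WB q : (0 < q)%N -> WBq A T cls tmd q.
Proof. by move=> _; apply: (hform_WB T0 tmd_tmod tmd_hform). Qed.

Lemma tmd_D v w : tmd (D v) 0 w = 0.
Proof. by rewrite (md_D T0 tmd_tmod tmd_hform) mul0r scale0r. Qed.
End ToModule.

Section OfModule.
Variable W : lmodType C.
Variable md : V -> int -> W -> W.
Hypothesis tm : tmod A T cls md.
Hypothesis hf : forall u v, exists k, hform A T md u v k.

Definition mdt (v : V) (j : int) (w : W) := md v (- j - T%:Z) w.

Lemma mdt_linl j w : is_linear (fun v => mdt v j w). Proof. exact: tm_linl tm _ _. Qed.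
Lemma mdt_linr v j : is_linear (mdt v j). Proof. exact: tm_linr tm _ _. Qed.
Lemma mdt_trunc v w : exists N : int, forall j, N <= j -> mdt v j w = 0.
Proof.
have [N hN] := tm_trunc tm v w; exists (- N - T%:Z + 1) => j hj; apply: hN; lia.
Qed.
Lemma mdt_vac j w : mdt (vac A) j w = if j == - T%:Z then w else 0.
Proof.
by rewrite /mdt (tm_vac tm); congr (if _ then _ else _); apply/eqP/eqP; lia.
Qed.
Lemma mdt_g v j w : mdt (g v) j w = om ^ j *: mdt v j w.
Proof.
rewrite /mdt; set s := - j - _; rewrite (pj_sum v) (is_linear_sum (g_lin ga)).
rewrite !(is_linear_sum (tm_linl tm s w)) scaler_sumr; apply: eq_bigr => r _.
rewrite (pj_cls r v) (is_linearZ (tm_linl tm s w)).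
case: (boolP (T%:Z %| s + r%:Z)%Z) => h; last by rewrite (tm_cls tm _ (pj_cls r v) h) !scaler0.
rewrite (omega_mod R T0 (j := j)) //.
by apply: (dvdz_eqD h (dvdzz T%:Z)); rewrite /s; lia.
Qed.

Lemma mdt_tF u v k w s t : twF T mdt u v k w s t = tF T md u v k w s t.
Proof.
apply: eq_bigr => i _; congr (_ *: _); rewrite /mdt.
have -> : - (T%:Z * (k%:Z - i%:Z - 1) - s) - T%:Z = s - T%:Z * (k%:Z - i%:Z) by lia.
by have -> : - (T%:Z * (i%:Z - 1) - t) - T%:Z = t - T%:Z * i%:Z by lia.
Qed.

Lemma mdt_assoc (u v : V) : exists k : nat, forall w : W, exists N : int,
    (forall s t : int, (s < N) || (t < N) -> twF T mdt u v k w s t = 0) /\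
    (forall m j : int,
      zsum (fun l : int => expm1_coef R k (j + l + 1) *:
                mdt (vmode A u l v) (T%:Z * (k%:Z - 1) - m) w)
      =
      (if j < 0 then 0 else
       zsum (fun s : int =>
         (((s%:~R / T%:R) ^+ (absz j)) / ((absz j)`!)%:R) *:
           twF T mdt u v k w s (m - s)))).
Proof.
have [k hk] := hf u v; exists k => w; have [N [h1 h2]] := hk w; exists N.
split=> [s t|m j]; first by rewrite mdt_tF; apply: h1.
have := h2 (m - T%:Z * k%:Z) (lmon C (- j - 1)); rewrite pr_lmonE subrK /mdt.
have -> : - (T%:Z * (k%:Z - 1) - m) - T%:Z = m - T%:Z * k%:Z by lia.
move=> ->; case: ifP => hj; first by rewrite zsum0 // => s; rewrite lres_lmonE hj scale0r.
by apply: eq_zsum => s; rewrite lres_lmonE hj mdt_tF.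
Qed.

Definition tw_of : TwModule A g T :=
  TwMod mdt_linl mdt_linr mdt_trunc mdt_vac mdt_g mdt_assoc.

Lemma tmd_of v s w : @tmd tw_of v s w = md v s w.
Proof. by rewrite /tmd /= /mdt; congr (md _ _ _); lia. Qed.
End OfModule.

Lemma resprod_vm al p u v : resprod A al p u v = vm A u (lE (al + 1) * ly C ^ (- p%:Z)) v.
Proof. by apply: eq_zsum => k; rewrite rescoefE. Qed.

(** The change of variables adds one to the exponent of 1 + y. As r < T, the term [delta0 (T - r)]
    is zero, so the pole has order 2 for r = 0 and 1 otherwise. *)
Lemma diamondE u v : diamond_g A g T u v =
  \sum_(r < T) if r == 0%N :> nat then vm A (pj 0 u) (lE 1 * ly C ^ (-2)) v
    else vm A (pj r u) (lE (q_ r%:Z) * ly C ^ (-1)) v.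
Proof.
apply: eq_bigr => r _; rewrite resprod_vm /delta0.
have r1 : (T - r == 0)%N = false by have := ltn_ord r; lia.
rewrite r1; case: eqP => [->|_].
  have -> : -1 + true%:R + 0%N%:R / T%:R + 1 = 1 :> C by rewrite mul0r addr0 addNr add0r.
  by [].
by have -> : -1 + false%:R + r%:R / T%:R + 1 = q_ r%:Z by rewrite addr0 addrAC addNr add0r.
Qed.

Lemma bulletE u v : bullet_g A g T u v = vm A (pj 0 u) (lE 1 * ly C ^ (-1)) v.
Proof. by rewrite /bullet_g resprod_vm add0r. Qed.

Section Zhu.
Variable W : TwModule A g T.
Local Notation md := (@tmd W).

Lemma Om_sub : is_subspace (Om md).
Proof.
split=> [v s _|a x x' hx hx' v s hs]; first exact: (md0r (tmd_tmod W)).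
by rewrite (tm_linr (tmd_tmod W)) hx // hx' // scaler0 addr0.
Qed.

Definition zact (a : V) (m : sublm Om_sub) : sublm Om_sub :=
  slmk Om_sub (Om_stable T0 pj_cls pj_sum (tmd_tmod W) (@tmd_WB W) a (slvalP m)).

Lemma zactE a m : slval (zact a m) = md a 0 (slval m). Proof. by []. Qed.

Lemma zact_linl m : is_linear (fun a => zact a m).
Proof.
move=> c x x'; apply: (@slval_inj _ _ _ Om_sub); rewrite (slval_lin c (zact x m) (zact x' m)).
exact: (tm_linl (tmd_tmod W)).
Qed.
Lemma zact_linr a : is_linear (zact a).
Proof.
move=> c x x'; apply: (@slval_inj _ _ _ Om_sub); rewrite (slval_lin c (zact a x) (zact a x')) !zactE.
by rewrite slval_lin (tm_linr (tmd_tmod W)).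
Qed.
Lemma zact_O a : in_Og A g T a -> forall m, zact a m = 0.
Proof.
move=> [s [w ->]] m; apply: (@slval_inj _ _ _ Om_sub); rewrite zactE (is_linear0 (@slval_lin _ _ _ Om_sub)).
have hl := tm_linl (tmd_tmod W) 0 (slval m).
rewrite (is_linearD hl) tmd_D addr0 (is_linear_sum hl) big1 // => t _.
rewrite (is_linearZ hl) diamondE (is_linear_sum hl) big1 ?scaler0 // => r _.
have hm := slvalP m; case: eqP => [_|/eqP r0].
  exact: (Om_zero0 T0 (@tmd_WB W) _ (pj_cls 0 _) hm).
apply: (Om_zero T0 (@tmd_WB W) _ _ (pj_cls r _) hm); rewrite lt0n r0; exact: ltn_ord.
Qed.
Lemma zact_mul a b m : zact (bullet_g A g T a b) m = zact a (zact b m).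
Proof.
apply: (@slval_inj _ _ _ Om_sub); rewrite !zactE bulletE.
rewrite (Om_product T0 (@tmd_WB W) _ (pj_cls 0 _) (slvalP m)).
by rewrite [RHS](md_pj T0 pj_cls pj_sum (tmd_tmod W)) cl0.
Qed.
Lemma zact_unit m : zact (vac A) m = m.
Proof.
by apply: (@slval_inj _ _ _ Om_sub); rewrite zactE (tm_vac (tmd_tmod W)).
Qed.

(** The carrier is the space of vacuum vectors, to which every isomorphism of modules restricts. *)
Definition zhu : AgModule A g T :=
  AgMod zact_linl zact_linr zact_O zact_mul zact_unit.
End Zhu.
End Dictionary.

Lemma inj_surj_bij (X Y : Type) (f : X -> Y) : inhabited X -> injective f ->
  (forall z, exists x, f x = z) -> bijective f.
Proof.
move=> i fi fs; pose h z := epsilon i (fun x => f x = z).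
have hh z : f (h z) = z := epsilon_spec i (fun x => f x = z) (fs z).
by exists h => // x; apply: fi.
Qed.

(** * The bijection on isomorphism classes *)

Section Correspondence.
Variable R : realType.
Local Notation C := (complex R).
Variable V : lmodType C.
Variable A : vertex_algebra V.
Variable g : V -> V.
Variable T : nat.
Hypothesis T0 : (0 < T)%N.
Hypothesis ga : is_va_automorphism A g.
Hypothesis gT : forall v, iter T g v = v.
Local Notation cls := (@gcls R V g T).
Local Notation pj := (gproj g T).
Local Notation q_ s := (s%:~R / T%:R : C).
Local Notation twm W := (@tw_mode R V A g T W).
Local Notation tmd W := (@tmd R V A g T W).
Implicit Types W : TwModule A g T.
Local Notation Z := (zhu T0 ga gT).

Let pj_cls r u : cls r%:Z (pj r u) := gproj_cls T0 ga gT r u.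
Let pj_sum v : v = \sum_(r < T) pj r v := gproj_sum g T0 v.

Lemma graded_grading W : tw_graded W -> exists Wn, grading (tmd W) Wn.
Proof.
move=> [Wn [h1 [h2 [h3 [h4 h5]]]]]; exists Wn; split=> // v s a w hw.
have := h4 v (- s - T%:Z) a w hw.
by have -> : a%:Z - (- s - T%:Z) - T%:Z = a%:Z + s by lia.
Qed.

Lemma irreducible_irr W : tw_irreducible W -> irr (tmd W).
Proof.
move=> [h1 h2]; split=> // S hS hmd; apply: h2 => // v j w hw.
by rewrite (tmdE T0); apply: hmd.
Qed.

Lemma slval0 W (x : am_car (Z W)) : slval x = 0 -> x = 0.
Proof.
by move=> h; apply: slval_inj; rewrite h (is_linear0 (@slval_lin _ _ _ (Om_sub T0 W))).
Qed.

Lemma zhu_simple W : tw_graded W -> tw_irreducible W -> am_simple (Z W).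
Proof.
move=> /graded_grading [Wn gr] /irreducible_irr ir; have [p hp] := proj0_ex T0 gr; split.
  have [w [hw w0]] := gr_nz gr; exists (slmk (Om_sub T0 W) (gr_Om gr hw)) => e.
  apply: w0; transitivity (slval (0 : am_car (Z W))); first by rewrite -e.
  exact: (is_linear0 (@slval_lin _ _ _ (Om_sub T0 W))).
move=> S hS hact; case: (pselect (forall m, S m -> m = 0)) => [|h]; [by left|right].
have [m [hm m0]] : exists m, S m /\ m <> 0.
  by apply: contrapT => h'; apply: h => w hw; apply: contrapT => w0; apply: h'; exists w.
pose S' w := exists x : am_car (Z W), slval x = w /\ S x.
have hS' : is_subspace S'.
  split; first by exists 0; split; [exact: (is_linear0 (@slval_lin _ _ _ (Om_sub T0 W)))|exact: subs0 hS].
  move=> a x x' [z [<- hz]] [z' [<- hz']]; exists (a *: z + z'); split; last exact: subsP.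
  exact: slval_lin.
move=> x; have [y [/slval_inj <- hy]] : S' (slval x) => //.
apply: (Om_simple T0 pj_cls pj_sum (tmd_tmod T0 W) (tmd_WB T0 (W := W)) gr hp ir hS' _ _ (m := slval m)).
- by move=> w [z [<- _]]; exact: (slvalP z).
- by move=> v w [z [<- hz]]; exists (am_act v z); split=> //; exact: hact.
- by exists m.
- by move/slval0.
- exact: (slvalP x).
Qed.

Lemma tw_am_iso W1 W2 : tw_iso W1 W2 -> am_iso (Z W1) (Z W2).
Proof.
move=> [f [fl [fb fm]]].
have fmd v s w : f (tmd W1 v s w) = tmd W2 v s (f w) by apply: fm.
have fO w : Om (tmd W1) w -> Om (tmd W2) (f w).
  by move=> h v s hs; rewrite -fmd h // (is_linear0 fl).
have fO' w : Om (tmd W2) (f w) -> Om (tmd W1) w.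
  by move=> h v s hs; apply: (bij_inj fb); rewrite fmd h // (is_linear0 fl).
pose F (x : am_car (Z W1)) : am_car (Z W2) := slmk (Om_sub T0 W2) (fO _ (slvalP x)).
have FE x : slval (F x) = f (slval x) by [].
exists F; split; [|split].
- move=> a x y; apply: slval_inj; rewrite (slval_lin a (F x) (F y)) !FE -fl.
  by rewrite -(slval_lin a x y).
- apply: inj_surj_bij; first by split; exact: 0.
    by move=> x y /(congr1 (@slval _ _ _ _)); rewrite !FE => /(bij_inj fb) /slval_inj.
  move=> y; have [h hK hK'] := fb; have hy : Om (tmd W1) (h (slval y)).
    by apply: fO'; rewrite hK'; exact: (slvalP y).
  by exists (slmk (Om_sub T0 W1) hy); apply: slval_inj; rewrite FE /= hK'.
- by move=> a x; apply: slval_inj; rewrite FE; apply: fmd.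
Qed.

Lemma am_tw_iso W1 W2 : tw_graded W1 -> tw_irreducible W1 -> tw_graded W2 -> tw_irreducible W2 ->
  am_iso (Z W1) (Z W2) -> tw_iso W1 W2.
Proof.
move=> /graded_grading [G1 gr1] /irreducible_irr ir1 /graded_grading [G2 gr2] /irreducible_irr ir2.
move=> [f [fl [fb fm]]].
have [p1 hp1] := proj0_ex T0 gr1; have [p2 hp2] := proj0_ex T0 gr2.
(* Composing with the projection onto the bottom makes the given isomorphism a linear map on all of
   W1, the form [lft_iso] expects. *)
pose em w : am_car (Z W1) := slmk (Om_sub T0 W1) (gr_Om gr1 (proj0_in hp1 w)).
have em_lin : is_linear em.
  move=> a x y; apply: slval_inj; rewrite (slval_lin a (em x) (em y)).
  exact: (proj0_lin hp1).
have emE m : G1 0%N m -> slval (em m) = m by apply: proj0_id hp1 _.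
pose phi w := slval (f (em w)).
have phi_lin : is_linear phi by move=> a x y; rewrite /phi em_lin fl (slval_lin a).
have phi_in m : G1 0%N m -> G2 0%N (phi m).
  move=> _; apply: (Om_gr T0 pj_cls pj_sum (tmd_tmod T0 W2) (tmd_WB T0 (W := W2)) gr2 hp2 ir2).
  exact: (slvalP (f (em m))).
have phi_md v m : G1 0%N m -> phi (tmd W1 v 0 m) = tmd W2 v 0 (phi m).
  move=> hm; rewrite /phi; have -> : em (tmd W1 v 0 m) = am_act v (em m).
    apply: slval_inj; rewrite emE; last exact: (gr_md0 gr1).
    by rewrite -[RHS]/(tmd W1 v 0 (slval (em m))) emE.
  by rewrite fm.
have phi_inj m : G1 0%N m -> phi m = 0 -> m = 0.
  move=> hm /slval0 e; rewrite -(emE m hm); have : em m = 0.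
    by apply: (bij_inj fb); rewrite e (is_linear0 fl).
  by move=> ->; exact: (is_linear0 (@slval_lin _ _ _ (Om_sub T0 W1))).
have [F [Fl [Fb Fm]]] := lft_iso T0 pj_cls pj_sum (tmd_tmod T0 W1) (tmd_tmod T0 W2)
  (tmd_WB T0 (W := W1)) (tmd_WB T0 (W := W2)) gr1 gr2 ir1 ir2 phi_lin phi_in phi_md phi_inj.
by exists F; split=> //; split=> // v j w; rewrite !(tmdE T0) Fm.
Qed.

Section Realize.
Variable M : AgModule A g T.
Hypothesis sM : am_simple M.
Local Notation act := (@am_act R V A g T M).

Lemma act_in_Og_D v m : act (vaD A v) m = 0.
Proof. by apply: am_O; exists [::], v; rewrite big_nil add0r. Qed.
Lemma act_diamond b d m : act (diamond_g A g T b d) m = 0.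
Proof.
apply: am_O; exists [:: (1, b, d)], 0.
by rewrite big_seq1 /= scale1r (is_linear0 (vaD_lin A)) addr0.
Qed.
Lemma diamond_cls (r : nat) b d : (r < T)%N -> cls r%:Z b ->
  diamond_g A g T b d = vm A b (if r == 0%N then lE 1 * ly C ^ (-2) else lE (q_ r%:Z) * ly C ^ (-1)) d.
Proof.
move=> hr hb; rewrite (diamondE A g T0) (bigD1 (Ordinal hr)) //= big1 ?addr0 => [|i hi].
  have [e|r0] := eqVneq r 0%N; first by rewrite (gproj_id T0 ga hb T0) e subrr dvdz0.
  by rewrite (gproj_id T0 ga hb hr) subrr dvdz0.
have hd : (T%:Z %| r%:Z - i%:Z)%Z = false.
  apply: contraNF hi => /dvdzP [x hx]; have li := ltn_ord i; have x0 : x = 0 by nia.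
  by apply/eqP/val_inj => /=; rewrite x0 in hx; lia.
case: eqP => [e|_]; last by rewrite (gproj_id T0 ga hb) // hd (is_linear0 (vm_linb A _ _)).
by rewrite (gproj_id T0 ga hb T0) -{1}e hd (is_linear0 (vm_linb A _ _)).
Qed.

Lemma realize : exists W, tw_graded W /\ tw_irreducible W /\ am_iso (Z W) M.
Proof.
have act_O0 b d m : cls 0 b -> act (vm A b (lE 1 * ly C ^ (-2)) d) m = 0.
  by move=> hb; rewrite -(act_diamond b d m) (diamond_cls _ T0 hb).
have act_Or (r : nat) b d m : (0 < r < T)%N -> cls r%:Z b ->
    act (vm A b (lE (q_ r%:Z) * ly C ^ (-1)) d) m = 0.
  move=> /andP[r0 hr] hb; rewrite -(act_diamond b d m) (diamond_cls _ hr hb).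
  by rewrite ifF //; apply/negbTE; rewrite -lt0n.
have act_mul b d m : cls 0 b -> act (vm A b (lE 1 * ly C ^ (-1)) d) m = act b (act d m).
  move=> hb; rewrite -am_mul bulletE (gproj_id T0 ga hb T0) subrr dvdz0 //.
have [X [md [gr [F [[tm hW hg hi] [Fl Fi FO Fs Fm]]]]]] := @zhu_module _ V A T T0 cls pj pj_cls pj_sum
  (gproj_lin T ga) (fun r v r' => @gproj_id R V A g T T0 ga r v r') (gcls_sub T ga) (gcls_vac T ga)
  (fun r r' b d l => @gcls_mode R V A g T T0 ga r r' b d l) (am_car M) act
  (@am_linl _ _ _ _ _ M) (@am_linr _ _ _ _ _ M) act_in_Og_D act_O0 act_Or act_mul (@am_unit _ _ _ _ _ M) sM.
(* The construction yields the residue identities; this recovers associativity, so that the data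
   form a twisted module. *)
have hf := WB_hform T0 pj_cls pj_sum tm hW.
pose W := tw_of T0 ga gT tm hf.
have eW : tmd W = md :> (V -> int -> X -> X).
  by apply: funext => v; apply: funext => s; apply: funext => w; apply: tmd_of.
exists W; split; [|split].
- have [h1 h2 h3 h4 h5] := hg; exists gr.
  split; [exact: h1|split; [exact: h2|split; [exact: h3|split; [|exact: h5]]]].
  move=> v j a w hw; have := h4 v (- j - T%:Z) a w hw.
  by have -> : a%:Z + (- j - T%:Z) = a%:Z - j - T%:Z by lia.
- have [h1 h2] := hi; split=> // S hS hmd; apply: h2 => // v s w hw.
  by rewrite -eW; apply: hmd.
have OmE w : Om (tmd W) w -> exists m, w = F m by rewrite eW; apply: Fs.
have FOm m : Om (tmd W) (F m) by rewrite eW; apply: FO.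
have Finj : injective F.
  move=> m m' e; apply/eqP; rewrite -subr_eq0; apply/eqP/Fi.
  by rewrite (is_linearB Fl) e subrr.
pose G m : am_car (Z W) := slmk (Om_sub T0 W) (FOm m).
have GE m : slval (G m) = F m by [].
have Gl : is_linear G.
  by move=> a x y; apply: slval_inj; rewrite (slval_lin a (G x) (G y)) !GE Fl.
have Gb : bijective G.
  apply: inj_surj_bij; first by split; exact: 0.
    by move=> x y /(congr1 (@slval _ _ _ _)); rewrite !GE => /Finj.
  by move=> y; have [m hm] := OmE _ (slvalP y); exists m; apply: slval_inj; rewrite GE hm.
have Gm a m : G (act a m) = am_act a (G m).
  by apply: slval_inj; rewrite GE -Fm -eW.
have [H GK HK] := Gb; exists H; split; [|split].
- by move=> a x y; apply: (can_inj GK); rewrite Gl !HK.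
- by exists G.
- by move=> a m; apply: (can_inj GK); rewrite Gm !HK.
Qed.
End Realize.
End Correspondence.

Theorem theorem6p4 (R : realType) (V : lmodType (complex R))
    (A : vertex_algebra V) (g : V -> V) (T : nat) :
  (0 < T)%N -> is_va_automorphism A g -> (forall v, iter T g v = v) ->
  exists F : TwModule A g T -> AgModule A g T,
    (forall W, tw_graded W -> tw_irreducible W -> am_simple (F W)) /\
    (forall W1 W2, tw_graded W1 -> tw_irreducible W1 ->
                   tw_graded W2 -> tw_irreducible W2 ->
                   (tw_iso W1 W2 <-> am_iso (F W1) (F W2))) /\
    (forall M, am_simple M ->
       exists W, tw_graded W /\ tw_irreducible W /\ am_iso (F W) M).
Proof.
move=> T0 ga gT; exists (zhu T0 ga gT); split; first exact: zhu_simple.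
split; last exact: realize.
move=> W1 W2 g1 i1 g2 i2; split; first exact: tw_am_iso.
exact: am_tw_iso g1 i1 g2 i2.
Qed.
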